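(* Fix $\alpha\in[-\infty,0]$ and let $f,g\in\mathcal{C}_\alpha(\mathbb{R}^n)$. Let $u\in\mathbb{S}^{n-1}$ and $H=u^\perp$. (i) ($\alpha$-mean width preserving) $w_\alpha(\tau_u^\alpha f)=w_\alpha(f)$. (ii) (Monotonicity) If $f\le g$, then $\tau_u^\alpha f\le\tau_u^\alpha g$. (iii) (Symmetry with respect to $H$) The $\alpha$-Minkowski symmetral $\tau_u^\alpha f$ is symmetric with respect to $u^\perp$, that is, $R_u(\tau_u^\alpha f)=\tau_u^\alpha f$. (iv) (Idempotence) $\tau_u^\alpha(\tau_u^\alpha f)=\tau_u^\alpha f$. (v) (Invariance on $H$-symmetric functions) If $f_H\in\mathcal{C}_\alpha(\mathbb{R}^n)$ is $H$-symmetric, that is $R_uf_H=f_H$, then $\tau_u^\alpha f_H=f_H$. (vi) (Projection invariance) $\mathrm{proj}_H\tau_u^\alpha f=\mathrm{proj}_H f$. (vii) (Total mass nondecreasing) If $\alpha\in[-1/n,0]$ and $f\in\mathcal{C}_\alpha(\mathbb{R}^n)$, then $J(\tau_u^\alpha f)\ge J(f)$. In the case $\alpha=0$, if $J(f)>0$, then equality holds if and only if $R_uf$ is a translate of $f$, i.e., if and only if there exists $z\in\mathbb{R}^n$ such that $R_uf(x)=f(x-z)$ for all $x\in\mathbb{R}^n$. (viii) (Superlevel sets property) For every $t>0$, $\{\tau_u^{-\infty}f\ge t\}=\tau_u\{f\ge t\}$.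
   Context: For $\alpha\in[-\infty,0]$, a function $f:\mathbb{R}^n\to[0,\infty)$ is $\alpha$-concave if $\{f>0\}$ is convex and for all $x,y$ with $f(x),f(y)>0$ and $\lambda\in[0,1]$, $f(\lambda x+(1-\lambda)y)$ is at least $(\lambda f(x)^\alpha+(1-\lambda)f(y)^\alpha)^{1/\alpha}$ if $\alpha\in(-\infty,0)$, at least $f(x)^\lambda f(y)^{1-\lambda}$ if $\alpha=0$, and at least $\min\{f(x),f(y)\}$ if $\alpha=-\infty$. $\mathcal{C}_\alpha(\mathbb{R}^n)$ is the set of $\alpha$-concave, upper semicontinuous $f:\mathbb{R}^n\to[0,\infty)$, not identically zero, with $\lim_{|x|\to\infty}f(x)=0$. One has $\mathcal{C}_\alpha(\mathbb{R}^n)\subset\mathcal{C}_{-\infty}(\mathbb{R}^n)$ for every $\alpha\in[-\infty,0]$, so $\tau_u^{-\infty}f$ below is defined for every $f\in\mathcal{C}_\alpha(\mathbb{R}^n)$. $R_u(x)=x-2\langle x,u\rangle u$ and $R_uf(x)=f(R_u(x))$. The $\alpha$-Minkowski symmetral is $$\tau_u^\alpha f(x)=\sup_{y+z=x}\begin{cases}\left(\tfrac12 f(2y)^\alpha+\tfrac12 R_uf(2z)^\alpha\right)^{1/\alpha},&\alpha\in(-\infty,0)\\ \sqrt{f(2y)\,R_uf(2z)},&\alpha=0\\ \min\{f(2y),R_uf(2z)\},&\alpha=-\infty,\end{cases}$$ where for $\alpha\in(-\infty,0)$ the expression is $0$ if $f(2y)=0$ or $R_uf(2z)=0$. For a set $A\subset\mathbb{R}^n$,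 $R_uA=\{R_u(x):x\in A\}$ and $\tau_uA=\frac12A+\frac12R_uA$ (Minkowski sum). Base function: $\mathrm{base}_\alpha f:=(1-f^\alpha)/\alpha$ for $\alpha\in(-\infty,0)$ and $\mathrm{base}_0 f:=-\log f$, with value $+\infty$ where $f=0$. With $\mathcal{L}\psi(x)=\sup_y(\langle x,y\rangle-\psi(y))$, put $h_f^{(\alpha)}=\mathcal{L}(\mathrm{base}_\alpha f)$. The $\alpha$-mean width is $$w_\alpha(f)=\begin{cases}\int_{\mathbb{R}^n}h_f^{(\alpha)}(x)\left(1-\frac{\alpha|x|^2}{2}\right)^{\frac{1-\alpha}{\alpha}}dx,&\alpha\in(-\infty,0)\\ \frac2n\int_{\mathbb{R}^n}h_f^{(0)}\,d\gamma_n,&\alpha=0\\ \int_0^\infty w(\{f\ge t\})\,dt,&\alpha=-\infty,\end{cases}$$ where $\gamma_n$ is the standard Gaussian probability measure on $\mathbb{R}^n$ and, for a nonempty compact convex set $K$, $w(K)=2\int_{\mathbb{S}^{n-1}}\sup_{x\in K}\langle x,v\rangle\,d\sigma(v)$ with $\sigma$ the normalized surface measure on $\mathbb{S}^{n-1}$ (and $w(\varnothing)=0$). $\mathrm{proj}_Hf(x)=\sup_{t\in\mathbb{R}}f(x+tu)$ for $x\in H$. $J(f)=\int_{\mathbb{R}^n}f(x)\,dx$ is the total mass.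
   Formalization: In (i), for finite α<0, the equality is proved whenever the integral defining w_α(f) exists in [-∞,∞], and then the one for τ_u^α f exists too; for α ≤ -2/(n-1) it can be ∞-∞, e.g. for f the indicator of {u}. *)

(* Defs.v *)
From HB Require Import structures.
From mathcomp Require Import all_boot all_order all_algebra.
From mathcomp Require Import all_classical all_reals all_analysis.
From mathcomp Require Import measurable_realfun.

Set Implicit Arguments.
Unset Strict Implicit.
Unset Printing Implicit Defensive.

Import Order.TTheory GRing.Theory Num.Theory.
Import numFieldNormedType.Exports.

Local Open Scope classical_set_scope.
Local Open Scope ring_scope.

(* The norm `|x| that the library puts on 'rV[R]_n is the sup norm; the
   Euclidean norm is enorm. *)
Definition dotv (R : realType) (n : nat) (x y : 'rV[R]_n) : R :=
  \sum_(i < n) x 0 i * y 0 i.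

Definition enorm (R : realType) (n : nat) (x : 'rV[R]_n) : R :=
  Num.sqrt (dotv x x).

Definition sphere (R : realType) (n : nat) : set 'rV[R]_n :=
  [set v | enorm v = 1].

Definition orthc (R : realType) (n : nat) (u : 'rV[R]_n) : set 'rV[R]_n :=
  [set x | dotv x u = 0].

Definition refl (R : realType) (n : nat) (u x : 'rV[R]_n) : 'rV[R]_n :=
  x - (2 * dotv x u) *: u.

Definition reflf (R : realType) (n : nat) (u : 'rV[R]_n) (f : 'rV[R]_n -> R)
  : 'rV[R]_n -> R := fun x => f (refl u x).

(* The sigma-algebra generated by the coordinates, i.e. the Borel sets. *)

Section measurable_rV.
Context (R : realType) (n : nat).

Let coor : 'I_n -> 'rV[R]_n -> R := fun i x => x 0 i.

Let rV_set0 : g_sigma_preimage coor set0.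
Proof. exact: sigma_algebra0. Qed.

Let rV_setC A : g_sigma_preimage coor A -> g_sigma_preimage coor (~` A).
Proof. exact: sigma_algebraC. Qed.

Let rV_bigcup (F : (set 'rV[R]_n)^nat) :
  (forall i, g_sigma_preimage coor (F i)) ->
  g_sigma_preimage coor (\bigcup_i (F i)).
Proof. exact: sigma_algebra_bigcup. Qed.

HB.instance Definition _ :=
  @isMeasurable.Build default_measure_display 'rV[R]_n
    (g_sigma_preimage coor) rV_set0 rV_setC rV_bigcup.

End measurable_rV.

Section measurable_rV_lemmas.
Context (R : realType).

Lemma measurable_coor n (i : 'I_n) :
  measurable_fun [set: 'rV[R]_n] (fun x : 'rV[R]_n => x 0 i : R).
Proof.
move=> _ Y mY; rewrite setTI; apply: sub_sigma_algebra => /=.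
rewrite -bigcup_seq/=; exists i => /=; first by rewrite mem_index_enum.
by exists Y => //; rewrite setTI.
Qed.

Lemma measurable_fun_rV d (T : measurableType d) n (f : T -> 'rV[R]_n) :
  (forall i, measurable_fun [set: T] (fun t => f t 0 i)) ->
  measurable_fun [set: T] f.
Proof.
move=> mf.
have H : g_sigma_preimage (fun i => (fun x : 'rV[R]_n => x 0 i) \o f)
    `<=` measurable.
  apply: smallest_sub; first exact: sigma_algebra_measurable.
  move=> A; rewrite -bigcup_seq => -[i _ [B mB <-]]; exact: mf.
move=> _ A mA; apply: H; rewrite g_sigma_preimage_comp.
by exists A.
Qed.

Lemma measurable_dotvv n :
  measurable_fun [set: 'rV[R]_n] (fun x => dotv x x).
Proof.
by apply: measurable_sum => i; apply: measurable_funM; exact: measurable_coor.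
Qed.

Lemma measurable_enorm n : measurable_fun [set: 'rV[R]_n] (@enorm R n).
Proof.
rewrite (_ : @enorm R n = fun x => dotv x x `^ 2^-1); last first.
  apply/funext => x; rewrite powR12_sqrt//.
  by apply: sumr_ge0 => i _; rewrite -expr2 sqr_ge0.
have H := measurableT_comp (@measurable_powR R (2^-1)) (@measurable_dotvv n).
exact: H.
Qed.

End measurable_rV_lemmas.

(* prod_measure m n is the n-fold product of the measure m on R, obtained by
   transporting m \x prod_measure m n along R x R^n ~ R^(n+1).  The library's
   canonical sigma-finite structure on m1 \x m2 is only found when m1 and m2
   are subprobabilities, hence the direct proof below. *)

Section prod_cons.
Context (R : realType) (n : nat).
Variables (m : {sigma_finite_measure set (measurableTypeR R) -> \bar R})
          (mu : {sigma_finite_measure set 'rV[R]_n -> \bar R}).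

Definition rV_cons (p : measurableTypeR R * 'rV[R]_n) : 'rV[R]_n.+1 :=
  \row_i (if unlift ord0 i is Some j then p.2 0 j else p.1).

Definition rV_uncons (x : 'rV[R]_n.+1) : measurableTypeR R * 'rV[R]_n :=
  (x 0 ord0, \row_j x 0 (lift ord0 j)).

Lemma rV_consK : cancel rV_cons rV_uncons.
Proof.
move=> [a v]; rewrite /rV_uncons mxE unlift_none/=; congr (_, _).
by apply/rowP => j; rewrite !mxE liftK.
Qed.

Lemma measurable_rV_cons : measurable_fun setT rV_cons.
Proof.
apply: measurable_fun_rV => i.
under eq_fun do rewrite mxE.
case: (unlift ord0 i) => [j|]; last exact: measurable_fst.
exact: (measurableT_comp (measurable_coor j) measurable_snd).
Qed.

Lemma measurable_rV_uncons : measurable_fun setT rV_uncons.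
Proof.
apply: measurable_fun_pair; first exact: measurable_coor.
apply: measurable_fun_rV => j.
under eq_fun do rewrite mxE.
exact: measurable_coor.
Qed.

Definition prod_cons : set 'rV[R]_n.+1 -> \bar R :=
  pushforward (m \x mu)%E rV_cons.

Let prod_cons0 : prod_cons set0 = 0%E.
Proof. by rewrite /prod_cons /pushforward preimage_set0 measure0. Qed.

Let prod_cons_ge0 A : (0 <= prod_cons A)%E.
Proof. by rewrite /prod_cons /pushforward measure_ge0. Qed.

Let prod_cons_additive : semi_sigma_additive prod_cons.
Proof.
exact: (@measure_semi_sigma_additive _ _ _
  (measure_function_pushforward__canonical__measure_function_Measure
     (m \x mu)%E measurable_rV_cons)).
Qed.

HB.instance Definition _ := isMeasure.Build _ _ _
  prod_cons prod_cons0 prod_cons_ge0 prod_cons_additive.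

Let prod_cons_sigma_finite : sigma_finite setT prod_cons.
Proof.
have /sigma_finiteP[F [FT Fnd Foo]] := sigma_finiteT m.
have /sigma_finiteP[G [GT Gnd Goo]] := sigma_finiteT mu.
exists (fun k => rV_uncons @^-1` (F k `*` G k)).
  rewrite -preimage_bigcup -[LHS](preimage_setT rV_uncons); congr (_ @^-1` _).
  rewrite -setXTT FT GT predeqE => -[x y]; split.
    move=> [/= [i _ Fix] [k _ Gky]]; exists (maxn i k) => //; split.
    - by move: x Fix; exact/subsetPset/Fnd/leq_maxl.
    - by move: y Gky; exact/subsetPset/Gnd/leq_maxr.
  by move=> [i _ []/= ? ?]; split; exists i.
move=> k; have [mF Fk] := Foo k; have [mG Gk] := Goo k; split.
  rewrite -[X in measurable X]setTI; apply: measurable_rV_uncons => //.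
  exact: measurableX.
rewrite /prod_cons /pushforward -comp_preimage (_ : _ \o _ = id).
  by rewrite preimage_id product_measure1E// lte_mul_pinfty// ge0_fin_numE.
by apply/funext; exact: rV_consK.
Qed.

HB.instance Definition _ := Measure_isSigmaFinite.Build _ _ _
  prod_cons prod_cons_sigma_finite.

End prod_cons.

Fixpoint prod_measure (R : realType)
    (m : {sigma_finite_measure set (measurableTypeR R) -> \bar R}) (n : nat) :
    {sigma_finite_measure set 'rV[R]_n -> \bar R} :=
  match n with
  | 0 => dirac (0 : 'rV[R]_0)
  | n'.+1 => prod_cons m (prod_measure m n')
  end.

Definition lebesgue_rV (R : realType) (n : nat) :
    {sigma_finite_measure set 'rV[R]_n -> \bar R} :=
  prod_measure (@lebesgue_measure R) n.

Definition gaussian_rV (R : realType) (n : nat) :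
    {sigma_finite_measure set 'rV[R]_n -> \bar R} :=
  prod_measure (normal_prob 0 1) n.

(* The normalized surface measure sigma on the unit sphere, as the cone
   measure: sigma(A) is the proportion of the unit ball filled by the points
   whose direction lies in A. *)
Section sphere_measure.
Context (R : realType) (n : nat).

Definition unit_ball : set 'rV[R]_n := [set x | enorm x <= 1].

Definition direction (x : 'rV[R]_n) : 'rV[R]_n := (enorm x)^-1 *: x.

Lemma measurable_unit_ball : measurable unit_ball.
Proof.
rewrite (_ : unit_ball = setT `&` @enorm R n @^-1` `]-oo, 1%R]).
  by apply: measurable_enorm => //; exact: measurable_itv.
by rewrite setTI; apply/seteqP; split => x /=; rewrite in_itv.
Qed.

Lemma measurable_direction : measurable_fun setT direction.
Proof.
apply: measurable_fun_rV => i.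
rewrite (_ : (fun _ => _) = (fun x => dotv x x `^ (- 2^-1)) \* (fun x => x 0 i)).
  apply: measurable_funM; last exact: measurable_coor.
  have H := measurableT_comp (@measurable_powR R (- 2^-1))
    (@measurable_dotvv R n).
  exact: H.
apply/funext => x /=; rewrite mxE powRN powR12_sqrt//.
by apply: sumr_ge0 => j _; rewrite -expr2 sqr_ge0.
Qed.

Definition sphere_measure (A : set 'rV[R]_n) : \bar R :=
  (((fine (lebesgue_rV R n unit_ball))^-1)%:E *
   lebesgue_rV R n (direction @^-1` A `&` unit_ball))%E.

Let sphere_cst_ge0 : 0 <= (fine (lebesgue_rV R n unit_ball))^-1.
Proof. by rewrite invr_ge0 fine_ge0. Qed.

Let sphere_measure0 : sphere_measure set0 = 0%E.
Proof. by rewrite /sphere_measure preimage_set0 set0I measure0 mule0. Qed.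

Let sphere_measure_ge0 A : (0 <= sphere_measure A)%E.
Proof. by rewrite /sphere_measure mule_ge0// lee_fin. Qed.

Let sphere_measure_additive : semi_sigma_additive sphere_measure.
Proof.
pose ball_meas : {measure set _ -> \bar R} :=
  mrestr (lebesgue_rV R n) measurable_unit_ball.
pose dir_meas := measure_function_pushforward__canonical__measure_function_Measure
  ball_meas measurable_direction.
exact: (@measure_semi_sigma_additive _ _ _ (mscale (NngNum sphere_cst_ge0) dir_meas)).
Qed.

HB.instance Definition _ := isMeasure.Build _ _ _
  sphere_measure sphere_measure0 sphere_measure_ge0 sphere_measure_additive.

End sphere_measure.

(* Every parameter alpha : \bar R below is meant to satisfy alpha <= 0; the
   values given at alpha = +oo are irrelevant. *)

Definition alpha_mean (R : realType) (alpha : \bar R) (l a b : R) : R :=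
  match alpha with
  | r%:E => if r == 0 then a `^ l * b `^ (1 - l)
            else (l * a `^ r + (1 - l) * b `^ r) `^ (r^-1)
  | -oo%E => Num.min a b
  | +oo%E => 0
  end.

Definition alpha_concave (R : realType) (n : nat) (alpha : \bar R)
    (f : 'rV[R]_n -> R) : Prop :=
  convex_set ([set x | 0 < f x] : set (convex_lmodType 'rV[R]_n)) /\
  forall (x y : 'rV[R]_n) (l : R), 0 < f x -> 0 < f y -> 0 <= l <= 1 ->
    alpha_mean alpha l (f x) (f y) <= f (l *: x + (1 - l) *: y).

Definition upper_semicontinuous (R : realType) (n : nat) (f : 'rV[R]_n -> R)
  : Prop := lower_semicontinuous (fun x => (- f x)%:E).

Definition vanishes_at_infinity (R : realType) (n : nat) (f : 'rV[R]_n -> R)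
  : Prop :=
  forall e : R, 0 < e ->
    exists M : R, forall x : 'rV[R]_n, M < enorm x -> `|f x| < e.

Definition Calpha (R : realType) (n : nat) (alpha : \bar R)
    (f : 'rV[R]_n -> R) : Prop :=
  [/\ forall x, 0 <= f x,
      alpha_concave alpha f,
      upper_semicontinuous f,
      exists x, f x != 0 &
      vanishes_at_infinity f].

(* The library's a `^ r is 0 when a = 0 and r < 0, hence the separate case. *)
Definition half_mean (R : realType) (alpha : \bar R) (a b : R) : R :=
  match alpha with
  | r%:E => if r == 0 then Num.sqrt (a * b)
            else if (a == 0) || (b == 0) then 0
            else (2^-1 * a `^ r + 2^-1 * b `^ r) `^ (r^-1)
  | -oo%E => Num.min a b
  | +oo%E => 0
  end.

(* The supremum is that of R; the set is bounded when f is in Calpha. *)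
Definition tau (R : realType) (n : nat) (alpha : \bar R) (u : 'rV[R]_n)
    (f : 'rV[R]_n -> R) : 'rV[R]_n -> R :=
  fun x => sup [set half_mean alpha (f (2 *: p.1)) (reflf u f (2 *: p.2))
               | p in [set p : 'rV[R]_n * 'rV[R]_n | p.1 + p.2 = x]].

Definition tau_set (R : realType) (n : nat) (u : 'rV[R]_n) (A : set 'rV[R]_n)
  : set 'rV[R]_n :=
  [set 2^-1 *: a + 2^-1 *: b | a in A & b in refl u @` A].

Definition proj_fun (R : realType) (n : nat) (u : 'rV[R]_n)
    (f : 'rV[R]_n -> R) : 'rV[R]_n -> R :=
  fun x => sup [set f (x + t *: u) | t in [set: R]].

Definition total_mass (R : realType) (n : nat) (f : 'rV[R]_n -> R) : \bar R :=
  (\int[lebesgue_rV R n]_x (f x)%:E)%E.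

Definition base (R : realType) (n : nat) (r : R) (f : 'rV[R]_n -> R)
  : 'rV[R]_n -> \bar R :=
  fun x => if f x == 0 then +oo%E
           else if r == 0 then (- ln (f x))%:E
           else ((1 - f x `^ r) / r)%:E.

Definition legendre (R : realType) (n : nat) (psi : 'rV[R]_n -> \bar R)
  : 'rV[R]_n -> \bar R :=
  fun x => ereal_sup [set ((dotv x y)%:E - psi y)%E | y in [set: 'rV[R]_n]].

Definition supp_fun (R : realType) (n : nat) (r : R) (f : 'rV[R]_n -> R)
  : 'rV[R]_n -> \bar R := legendre (base r f).

Definition width (R : realType) (n : nat) (K : set 'rV[R]_n) : \bar R :=
  if `[< K = set0 >] then 0%E
  else (2%:E * \int[@sphere_measure R n]_(v in @sphere R n)
                 ereal_sup [set (dotv x v)%:E | x in K])%E.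

Definition width_integrand (R : realType) (n : nat) (r : R)
    (f : 'rV[R]_n -> R) : 'rV[R]_n -> \bar R :=
  fun x => (supp_fun r f x *
            ((1 - r * enorm x ^+ 2 / 2) `^ ((1 - r) / r))%:E)%E.

Definition mean_width (R : realType) (n : nat) (alpha : \bar R)
    (f : 'rV[R]_n -> R) : \bar R :=
  match alpha with
  | r%:E => if r == 0
            then ((2 / n%:R)%:E * \int[gaussian_rV R n]_x supp_fun 0 f x)%E
            else (\int[lebesgue_rV R n]_x width_integrand r f x)%E
  | -oo%E =>
      (\int[lebesgue_measure]_(t in `]0%R, +oo[) width [set x | t <= f x]%R)%E
  | +oo%E => 0%E
  end.

(* The integral defining the mean width is meaningful in [-oo, +oo], i.e. its
   positive and negative parts are not both infinite.  This may fail only for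
   alpha finite and negative: when alpha <= -2 / (n - 1) the weight does not
   integrate |x|, and the integral of h_f against it can be oo - oo (take for
   f the indicator of a point other than 0), a case in which the library's
   integral takes the conventional value -oo. *)
Definition mean_width_defined (R : realType) (n : nat) (alpha : \bar R)
    (f : 'rV[R]_n -> R) : Prop :=
  match alpha with
  | r%:E => if r == 0 then True
            else (\int[lebesgue_rV R n]_x (width_integrand r f)^\+ x +?
                  - \int[lebesgue_rV R n]_x (width_integrand r f)^\- x)%E
  | _ => True
  end.

(* Main.v *)
Require Import Defs.
From mathcomp Require Import all_boot all_order all_algebra.
From mathcomp Require Import all_classical all_reals all_analysis.
From mathcomp Require Import measurable_realfun.
From mathcomp Require Import ring lra.

Set Implicit Arguments.
Unset Strict Implicit.
Unset Printing Implicit Defensive.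

Import Order.TTheory GRing.Theory Num.Theory.
Import numFieldNormedType.Exports.

Local Open Scope classical_set_scope.
Local Open Scope ring_scope.

(* The Box-Cox transform turns the half mean into an arithmetic mean, so that
   the support function of the symmetral at [x] is the average of the support
   functions of [f] at [x] and at its reflection; (i) follows from the invariance
   of the measures under reflection, which is checked by integrating along the
   lines of direction [u].

   For (vii), the symmetral dominates the Steiner symmetral of [f], in which the
   two points averaged are required to lie on a line of direction [u] and the
   minimum replaces the half mean; its superlevel sets have at least the volume
   of those of [f].  If equality holds for [alpha = 0], then log-concavity of the
   symmetral forces it to coincide everywhere with the Steiner symmetral.
   Therefore, along a segment of base points and log-levels, the fibres
   [[a x, b x]] of [f] in direction [u] satisfy
   [b y - a x <= b ((x + y) / 2) - a ((x + y) / 2)].  Adding up these inequalities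
   for consecutive points of a fine subdivision gives
   [b 1 + a 1 <= b 0 + a 0 + o(1)]: all the fibres have the same centre, and [f] is
   symmetric with respect to a translate of the hyperplane. *)

(** * Integration on row vectors *)

(** Two obstacles shape the proof. The integrals in the mean width may be infinite, so the averaged
    support function is not integrated by plain linearity: its positive and negative parts are
    compared through additive relations between nonnegative integrals, and subtraction comes last.
    The symmetral is a supremum, handled for finite [alpha] through almost optimal pairs whose
    defect is carried through the Box-Cox transform. When the mean is a minimum, the admissible
    pairs above a level form a decreasing chain of compact sets, so an optimal pair exists. This
    makes the superlevel sets of the Steiner symmetral compact, hence measurable, and in the
    equality case it produces actual points of a fibre from a value of the symmetral. *)

Lemma measurable_affine (R : realType) (a b : R) :
  measurable_fun [set: measurableTypeR R]
    (fun t => a * t + b : measurableTypeR R).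
Proof. by apply: measurable_funD => //; exact: measurable_funM. Qed.

(** Both sides are measures in [A], so by uniqueness of Lebesgue measure it is enough to compare
    them on half-open intervals. A negative [a] exchanges the open and the closed end, which does
    not change the length. *)
Lemma lebesgue_measure_affine (R : realType) (a b : R) (A : set (measurableTypeR R)) :
  a != 0 -> measurable A ->
  (`|a|%:E * lebesgue_measure ((fun t => (a * t + b)%R) @^-1` A) =
   lebesgue_measure A)%E.
Proof.
move=> a0 mA.
pose m1 := measure_function_pushforward__canonical__measure_function_Measure
  (@lebesgue_measure R) (measurable_affine a b).
pose m2 := mscale (NngNum (normr_ge0 a)) m1.
rewrite -[LHS]/(m2 A); symmetry.
apply: (@lebesgue_measure_unique R m2) => // _ [[x y] /= _ <-].
rewrite /m2/= /mscale/=.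
rewrite lebesgue_measure_itv /= /m1/= /pushforward/=.
have [a_gt0|a_le0] := ltP 0 a.
  rewrite (_ : _ @^-1` _ = `](x - b) / a, (y - b) / a]%classic); last first.
    apply/seteqP; split => t /=; rewrite !in_itv/= ltr_pdivrMr// ler_pdivlMr//;
    by rewrite ltrBlDr lerBrDr (mulrC t).
  rewrite lebesgue_measure_itv/= !lte_fin ltr_pM2r ?invr_gt0// ltrD2r.
  case: ifPn => xy; last by rewrite mule0.
  by rewrite -!EFinD -EFinM gtr0_norm//; congr EFin; field.
have a_lt0 : a < 0 by rewrite lt_neqAle a0.
rewrite (_ : _ @^-1` _ = `[(y - b) / a, (x - b) / a[%classic); last first.
  apply/seteqP; split => t /=; rewrite !in_itv/= ltr_ndivlMr// ler_ndivrMr//;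
  by rewrite ltrBlDr lerBrDr (mulrC t) andbC.
rewrite lebesgue_measure_itv/= !lte_fin ltr_nM2r ?invr_lt0// ltrD2r.
case: ifPn => xy; last by rewrite mule0.
by rewrite -!EFinD -EFinM ltr0_norm//; congr EFin; field.
Qed.

Lemma ge0_integral_affine (R : realType) (a b : R)
    (F : measurableTypeR R -> \bar R) : a != 0 ->
  measurable_fun setT F -> (forall t, 0 <= F t)%E ->
  (\int[lebesgue_measure]_t F t =
   `|a|%:E * \int[lebesgue_measure]_t F (a * t + b)%R)%E.
Proof.
move=> a0 mF F0.
pose m1 := measure_function_pushforward__canonical__measure_function_Measure
  (@lebesgue_measure R) (measurable_affine a b).
pose m2 := mscale (NngNum (normr_ge0 a)) m1.
transitivity (\int[m2]_t F t)%E.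
  apply: eq_measure_integral => A mA _.
  by rewrite /m2/= /mscale/=; exact/esym/lebesgue_measure_affine.
rewrite ge0_integral_mscale//=; congr (_ * _)%E.
by rewrite ge0_integral_pushforward//=; exact: measurable_affine.
Qed.

Section rV_measurability.
Context (R : realType) (d : measure_display) (T : measurableType d) (n : nat).
Implicit Types f g : T -> 'rV[R]_n.

Lemma measurable_fun_coor f (i : 'I_n) :
  measurable_fun setT f -> measurable_fun setT (fun t => f t 0 i).
Proof. by move=> mf; exact: (measurableT_comp (measurable_coor i) mf). Qed.

Lemma measurable_rVD f g : measurable_fun setT f -> measurable_fun setT g ->
  measurable_fun setT (fun t => f t + g t).
Proof.
move=> mf mg; apply: measurable_fun_rV => i; under eq_fun do rewrite mxE.
by apply: measurable_funD; exact: measurable_fun_coor.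
Qed.

Lemma measurable_rVZ (k : T -> R) f :
  measurable_fun setT k -> measurable_fun setT f ->
  measurable_fun setT (fun t => k t *: f t).
Proof.
move=> mk mf; apply: measurable_fun_rV => i; under eq_fun do rewrite mxE.
by apply: measurable_funM => //; exact: measurable_fun_coor.
Qed.

Lemma measurable_dotv f g : measurable_fun setT f -> measurable_fun setT g ->
  measurable_fun setT (fun t => dotv (f t) (g t)).
Proof.
move=> mf mg; apply: measurable_sum => i.
by apply: measurable_funM; exact: measurable_fun_coor.
Qed.

End rV_measurability.

Lemma measurable_refl (R : realType) (n : nat) (u : 'rV[R]_n) :
  measurable_fun setT (refl u).
Proof.
rewrite /refl; apply: measurable_rVD => //.
under eq_fun do rewrite -scaleNr.
apply: measurable_rVZ => //; apply: measurable_funN.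
by apply: measurable_funM => //; exact: measurable_dotv.
Qed.

Section prod_measure_integral.
Context (R : realType).
Variable m : {sigma_finite_measure set (measurableTypeR R) -> \bar R}.

Lemma ge0_integral_prod_measureS (n : nat) (F : 'rV[R]_n.+1 -> \bar R) :
  measurable_fun setT F -> (forall x, 0 <= F x)%E ->
  (\int[prod_measure m n.+1]_x F x =
   \int[m]_a \int[prod_measure m n]_v F (rV_cons (a, v)))%E.
Proof.
move=> mF F0.
transitivity (\int[pushforward (m \x prod_measure m n) (@rV_cons R n)]_x F x)%E.
  by [].
have mC := @measurable_rV_cons R n.
rewrite ge0_integral_pushforward//=.
rewrite fubini_tonelli1//.
exact: measurableT_comp.
Qed.

End prod_measure_integral.

Lemma rV_consZ (R : realType) (n : nat) (t a : R) (v : 'rV[R]_n) :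
  rV_cons (t * a, t *: v) = t *: rV_cons (a, v).
Proof.
by apply/rowP => i; rewrite !mxE; case: (unlift ord0 i) => [j|]; rewrite ?mxE.
Qed.

Lemma rV_consD (R : realType) (n : nat) (a b : R) (v w : 'rV[R]_n) :
  rV_cons (a + b, v + w) = rV_cons (a, v) + rV_cons (b, w).
Proof.
by apply/rowP => i; rewrite !mxE; case: (unlift ord0 i) => [j|]; rewrite ?mxE.
Qed.

Lemma rV_unconsK (R : realType) (n : nat) :
  cancel (@rV_uncons R n) (@rV_cons R n).
Proof.
move=> x; apply/rowP => i; rewrite mxE.
by case: unliftP => [j ->|->]; rewrite ?mxE.
Qed.

Lemma measurable_rV_cons2 (R : realType) (d : measure_display)
    (T : measurableType d) (n : nat) (f : T -> R) (g : T -> 'rV[R]_n) :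
  measurable_fun setT f -> measurable_fun setT g ->
  measurable_fun setT (fun t => rV_cons (f t, g t)).
Proof.
move=> mf mg; apply: (measurableT_comp (@measurable_rV_cons R n)).
exact: measurable_fun_pair.
Qed.

(** Each coordinate contributes one factor [|k|]: the head by the one-dimensional change of
    variables, the tail by induction. *)
Lemma ge0_integral_rV_affine (R : realType) (n : nat) (k : R) (a : 'rV[R]_n)
    (F : 'rV[R]_n -> \bar R) : k != 0 ->
  measurable_fun setT F -> (forall x, 0 <= F x)%E ->
  (\int[lebesgue_rV R n]_x F x =
   (`|k| ^+ n)%:E * \int[lebesgue_rV R n]_x F (k *: x + a)%R)%E.
Proof.
move=> k0; elim: n a F => [|n IH] a F mF F0.
  rewrite expr0 mul1e; apply: eq_integral => x _; congr F.
  by apply/rowP => -[].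
have mA : measurable_fun setT (fun x : 'rV[R]_n.+1 => k *: x + a).
  by apply: measurable_rVD => //; exact: measurable_rVZ.
have mG : measurable_fun setT (fun x : 'rV[R]_n.+1 => F (k *: x + a)).
  exact: measurableT_comp.
rewrite /lebesgue_rV ge0_integral_prod_measureS//.
rewrite [X in (_ * X)%E]ge0_integral_prod_measureS//.
rewrite -[a](rV_unconsK a); move: (rV_uncons a) => [a0 a'].
have mC := @measurable_rV_cons R n.
have mFc : measurable_fun setT (F \o @rV_cons R n) by exact: measurableT_comp.
have mK : measurable_fun setT
    (fun t => \int[prod_measure lebesgue_measure n]_v F (rV_cons (t, v)))%E.
  by apply: (measurable_fun_fubini_tonelli_F (F \o @rV_cons R n)) => //= p; exact: F0.
have mL : measurable_fun setT (fun t => \int[prod_measure lebesgue_measure n]_v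
    F (k *: rV_cons (t, v) + rV_cons (a0, a'))%R)%E.
  pose G := fun p : measurableTypeR R * 'rV[R]_n =>
    F (k *: rV_cons p + rV_cons (a0, a')).
  apply: (measurable_fun_fubini_tonelli_F G) => [|p]; last exact: F0.
  apply: measurableT_comp => //; apply: measurable_rVD => //.
  exact: measurable_rVZ.
transitivity (`|k|%:E * \int[lebesgue_measure]_t \int[prod_measure
    lebesgue_measure n]_v F (rV_cons (k * t + a0, v)%R))%E.
  by apply: (ge0_integral_affine a0 k0 mK) => t; exact: integral_ge0.
rewrite exprS EFinM -muleA; congr (_ * _)%E.
rewrite -ge0_integralZl_EFin//=; last by move=> t _; exact: integral_ge0.
apply: eq_integral => t _.
rewrite (IH a')//; last first.
  by apply: measurableT_comp => //; exact: measurable_rV_cons2.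
congr (_ * _)%E; apply: eq_integral => v _.
by rewrite rV_consD rV_consZ.
Qed.

Lemma measurable_line (R : realType) (m : nat) (u : 'rV[R]_m.+1)
    (iota : 'rV[R]_m -> 'rV[R]_m.+1) :
  measurable_fun setT iota ->
  measurable_fun setT (fun p : measurableTypeR R * 'rV[R]_m =>
    p.1 *: u + iota p.2 : 'rV[R]_m.+1).
Proof.
move=> mi; apply: measurable_rVD; first exact: measurable_rVZ.
exact: (measurableT_comp mi measurable_snd).
Qed.

Lemma rV_cons_eta (R : realType) (n : nat) (x : 'rV[R]_n.+1) :
  x = rV_cons (x 0 0, \row_j x 0 (lift ord0 j)).
Proof. exact/esym/rV_unconsK. Qed.

(** The head coordinate is written as [u0 * t]; for fixed [t] the tail is translated by [t *: u],
    which preserves its measure. Tonelli then puts the integral along the line inside. *)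
Lemma ge0_integral_lines_cons (R : realType) (n : nat) (u0 : R) (u : 'rV[R]_n)
    (F : 'rV[R]_n.+1 -> \bar R) :
  u0 != 0 -> measurable_fun setT F -> (forall x, 0 <= F x)%E ->
  (\int[lebesgue_rV R n.+1]_x F x =
   `|u0|%:E * \int[lebesgue_rV R n]_w \int[lebesgue_measure]_t
     F (t *: rV_cons (u0, u) + rV_cons (0, w))%R)%E.
Proof.
move=> u00 mF F0; rewrite /lebesgue_rV ge0_integral_prod_measureS//.
have mK : measurable_fun setT
    (fun t => \int[prod_measure lebesgue_measure n]_v F (rV_cons (t, v)))%E.
  apply: (measurable_fun_fubini_tonelli_F (F \o @rV_cons R n)) => [|p].
    by apply: measurableT_comp => //; exact: measurable_rV_cons.
  exact: F0.
transitivity (`|u0|%:E * \int[lebesgue_measure]_t \int[prod_measure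
    lebesgue_measure n]_v F (rV_cons (u0 * t + 0, v)%R))%E.
  by apply: (ge0_integral_affine 0 u00 mK) => t; exact: integral_ge0.
congr (_ * _)%E.
transitivity (\int[lebesgue_measure]_t \int[prod_measure
    lebesgue_measure n]_v F (t *: rV_cons (u0, u) + rV_cons (0%R, v))%R)%E.
  apply: eq_integral => t _.
  rewrite [LHS](ge0_integral_rV_affine (t *: u) (oner_neq0 R))//; last first.
    by apply: measurableT_comp => //; exact: measurable_rV_cons2.
  rewrite normr1 expr1n mul1e; apply: eq_integral => v _; congr F.
  by rewrite -rV_consZ -rV_consD scale1r (mulrC u0) (addrC v).
pose G := fun p : measurableTypeR R * 'rV[R]_n =>
  F (p.1 *: rV_cons (u0, u) + rV_cons (0, p.2)).
apply: (fubini_tonelli G) => [|p]; last exact: F0.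
apply: measurableT_comp => //.
by apply: (measurable_line _ (iota := fun w => rV_cons (0, w))); exact: measurable_rV_cons2.
Qed.

(* [w] parametrizes a coordinate hyperplane complementary to [u]. *)
Lemma ge0_integral_lines (R : realType) (n : nat) (u : 'rV[R]_n.+1) :
  u != 0 -> exists (c : R) (iota : 'rV[R]_n -> 'rV[R]_n.+1),
  [/\ 0 < c, measurable_fun setT iota &
   forall F : 'rV[R]_n.+1 -> \bar R,
     measurable_fun setT F -> (forall x, 0 <= F x)%E ->
     (\int[lebesgue_rV R n.+1]_x F x =
      c%:E * \int[lebesgue_rV R n]_w
               \int[lebesgue_measure]_t F (t *: u + iota w)%R)%E].
Proof.
elim: n u => [|n IH] u un0.
  exists `|u 0 0|, (fun w => rV_cons (0, w)).
  have u00 : u 0 0 != 0.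
    by apply: contra_neq un0 => u00; apply/rowP => i; rewrite ord1 u00 mxE.
  split; [by rewrite normr_gt0|exact: measurable_rV_cons2|move=> F mF F0].
  have := ge0_integral_lines_cons (\row_j u 0 (lift ord0 j)) u00 mF F0.
  by rewrite -rV_cons_eta.
have [u00|u00] := eqVneq (u 0 0) 0; last first.
  exists `|u 0 0|, (fun w => rV_cons (0, w)).
  split; [by rewrite normr_gt0|exact: measurable_rV_cons2|move=> F mF F0].
  have := ge0_integral_lines_cons (\row_j u 0 (lift ord0 j)) u00 mF F0.
  by rewrite -rV_cons_eta.
(* The head of [u] vanishes, so the head coordinate is constant along the lines and becomes part of
   the parameter; the induction hypothesis handles the tail. *)
pose u' : 'rV_n.+1 := \row_j u 0 (lift ord0 j).
have uE : u = rV_cons (0, u') by rewrite -u00; exact: rV_cons_eta.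
have u'0 : u' != 0.
  apply: contra_neq un0 => u'0; rewrite uE u'0.
  by apply/rowP => i; rewrite !mxE; case: (unlift ord0 i) => [j|]; rewrite ?mxE.
have [c [i [c0 mi iE]]] := IH _ u'0.
have mtail : measurable_fun setT (fun w : 'rV[R]_n.+1 => (rV_uncons w).2).
  exact: (measurableT_comp measurable_snd (@measurable_rV_uncons R n)).
pose iota (w : 'rV_n.+1) := rV_cons (w 0 0, i (rV_uncons w).2).
have miota : measurable_fun setT iota.
  apply: measurable_rV_cons2; first exact: measurable_coor.
  exact: measurableT_comp.
exists c, iota; split => // F mF F0.
pose G := fun p : measurableTypeR R * 'rV[R]_n.+1 => F (p.1 *: u + iota p.2).
have mG : measurable_fun setT G.
  by apply: measurableT_comp => //; exact: measurable_line.
have mH : measurable_fun setT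
    (fun w => \int[lebesgue_measure]_t F (t *: u + iota w)%R)%E.
  by apply: (measurable_fun_fubini_tonelli_G G) => // p; exact: F0.
rewrite [X in (_ * X)%E]ge0_integral_prod_measureS//; last first.
  by move=> w; exact: integral_ge0.
pose H := fun w => (\int[lebesgue_measure]_t F (t *: u + iota w)%R)%E.
have H0 w : (0 <= H w)%E by exact: integral_ge0.
rewrite -ge0_integralZl_EFin//=; last first.
- exact: ltW.
- apply: (measurable_fun_fubini_tonelli_F (H \o @rV_cons R n)) => [|p].
    by apply: measurableT_comp => //; exact: measurable_rV_cons.
  exact: H0.
- by move=> a _; apply: integral_ge0 => v _; exact: H0.
rewrite /lebesgue_rV ge0_integral_prod_measureS//; apply: eq_integral => a _.
have mFa : measurable_fun setT (fun v => F (rV_cons (a, v))).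
  by apply: measurableT_comp => //; exact: measurable_rV_cons2.
have FaE := iE _ mFa (fun v => F0 (rV_cons (a, v))).
etransitivity; first exact: FaE.
apply: congr1; apply: eq_integral => v _; apply: eq_integral => t _.
have -> : iota (rV_cons (a, v)) = rV_cons (a, i v).
  by rewrite /iota rV_consK/= mxE unlift_none.
by rewrite uE -rV_consZ -rV_consD mulr0 add0r.
Qed.

(** * Reflections *)

Section euclidean.
Context (R : realType) (n : nat).
Implicit Types x y z u : 'rV[R]_n.

Lemma dotvC x y : dotv x y = dotv y x.
Proof. by apply: eq_bigr => i _; rewrite mulrC. Qed.

Lemma dotvDl x y z : dotv (x + y) z = dotv x z + dotv y z.
Proof. by rewrite -big_split; apply: eq_bigr => i _; rewrite mxE mulrDl. Qed.

Lemma dotvZl a x y : dotv (a *: x) y = a * dotv x y.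
Proof. by rewrite mulr_sumr; apply: eq_bigr => i _; rewrite mxE mulrA. Qed.

Lemma dotvDr x y z : dotv z (x + y) = dotv z x + dotv z y.
Proof. by rewrite !(dotvC z) dotvDl. Qed.

Lemma dotvZr a x y : dotv x (a *: y) = a * dotv x y.
Proof. by rewrite !(dotvC x) dotvZl. Qed.

Lemma dotvNl x y : dotv (- x) y = - dotv x y.
Proof. by rewrite -scaleN1r dotvZl mulN1r. Qed.

Lemma dotvBl x y z : dotv (x - y) z = dotv x z - dotv y z.
Proof. by rewrite dotvDl dotvNl. Qed.

Lemma dotvBr x y z : dotv z (x - y) = dotv z x - dotv z y.
Proof. by rewrite !(dotvC z) dotvBl. Qed.

Lemma dotvv_ge0 x : 0 <= dotv x x.
Proof. by apply: sumr_ge0 => i _; rewrite -expr2 sqr_ge0. Qed.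

Lemma sqr_enorm x : enorm x ^+ 2 = dotv x x.
Proof. by rewrite sqr_sqrtr ?dotvv_ge0. Qed.

Lemma coor_le_enorm x i : `|x 0 i| <= enorm x.
Proof.
rewrite -sqrtr_sqr ler_sqrt ?dotvv_ge0// /dotv (bigD1 i)//= -expr2 lerDl.
by apply: sumr_ge0 => j _; rewrite -expr2 sqr_ge0.
Qed.

Lemma sphere_dotv u : sphere u -> dotv u u = 1.
Proof. by rewrite -sqr_enorm => ->; rewrite expr1n. Qed.

Lemma sphere_neq0 u : sphere u -> u != 0.
Proof.
move=> /sphere_dotv; apply: contra_eq_neq => ->.
by rewrite -(scale0r u) dotvZl mul0r eq_sym oner_eq0.
Qed.

Lemma reflD u x y : refl u (x + y) = refl u x + refl u y.
Proof. by apply/rowP => i; rewrite !mxE dotvDl; ring. Qed.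

Lemma reflZ u a x : refl u (a *: x) = a *: refl u x.
Proof. by apply/rowP => i; rewrite !mxE dotvZl; ring. Qed.

Lemma refl_adj u x y : dotv (refl u x) y = dotv x (refl u y).
Proof. by rewrite /refl dotvBl dotvZl dotvBr dotvZr (dotvC y u); ring. Qed.

Lemma reflK u : sphere u -> involutive (refl u).
Proof.
move=> /sphere_dotv uu x.
by rewrite /refl dotvBl dotvZl uu; apply/rowP => i; rewrite !mxE; ring.
Qed.

Lemma dotv_refl u x y : sphere u -> dotv (refl u x) (refl u y) = dotv x y.
Proof. by move=> su; rewrite refl_adj reflK. Qed.

Lemma enorm_refl u x : sphere u -> enorm (refl u x) = enorm x.
Proof. by move=> su; rewrite /enorm dotv_refl. Qed.

(** The reflection preserves each line of direction [u] and flips its parameter, so its invariance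
    properties reduce to the substitution of [- t - const] for [t] on the real line. *)
Lemma refl_line u t x : sphere u ->
  refl u (t *: u + x) = (- t - 2 * dotv x u) *: u + x.
Proof.
move=> /sphere_dotv uu; rewrite /refl dotvDl dotvZl uu.
by apply/rowP => i; rewrite !mxE; ring.
Qed.

End euclidean.

Lemma ge0_integral_refl (R : realType) (n : nat) (u : 'rV[R]_n)
    (F : 'rV[R]_n -> \bar R) : sphere u ->
  measurable_fun setT F -> (forall x, 0 <= F x)%E ->
  (\int[lebesgue_rV R n]_x F (refl u x) = \int[lebesgue_rV R n]_x F x)%E.
Proof.
case: n u F => [|n] u F su mF F0.
  by apply: eq_integral => x _; congr F; apply/rowP => -[].
have [c [i [c0 mi iE]]] := ge0_integral_lines (sphere_neq0 su).
have mR : measurable_fun setT (fun x => F (refl u x)).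
  by apply: measurableT_comp => //; exact: measurable_refl.
etransitivity; first exact: (iE _ mR (fun x => F0 (refl u x))).
apply/esym; etransitivity; first exact: (iE F).
apply: congr1; apply: eq_integral => w _.
have mG : measurable_fun setT (fun t : measurableTypeR R => F (t *: u + i w)).
  apply: measurableT_comp => //; apply: measurable_rVD => //.
  exact: measurable_rVZ.
have N10 : (-1 : R) != 0 by rewrite oppr_eq0 oner_eq0.
etransitivity.
  exact: (ge0_integral_affine (- (2 * dotv (i w) u)) N10 mG).
rewrite normrN1 mul1e; apply: eq_integral => t _.
by rewrite refl_line// mulN1r.
Qed.

Lemma lebesgue_refl (R : realType) (n : nat) (u : 'rV[R]_n) (A : set 'rV[R]_n) :
  sphere u -> measurable A ->
  lebesgue_rV R n (refl u @^-1` A) = lebesgue_rV R n A.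
Proof.
move=> su mA; have mR := @measurable_refl R n u.
have mA' : measurable (refl u @^-1` A) by rewrite -[X in measurable X]setTI; exact: mR.
have E B : measurable B ->
    lebesgue_rV R n B = (\int[lebesgue_rV R n]_x (\1_B x)%:E)%E.
  by move=> mB; rewrite integral_indic// setIT.
rewrite !E// -(ge0_integral_refl su (F := fun x => (\1_A x)%:E))//.
exact/measurable_EFinP/measurable_indic.
Qed.

(** * Borel sets and semicontinuity *)

Section borel_rV.
Context (R : realType) (n : nat).

Let box (p : 'rV[rat]_n * nat) : set 'rV[R]_n :=
  [set x | forall i, `|x 0 i - ratr (p.1 0 i)| < (p.2.+1%:R)^-1].

Let measurable_box p : measurable (box p).
Proof.
rewrite (_ : box p = \bigcap_(i in [set: 'I_n]) ((fun x : 'rV[R]_n => x 0 i) @^-1`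
    `](ratr (p.1 0 i) - (p.2.+1%:R)^-1), (ratr (p.1 0 i) + (p.2.+1%:R)^-1)[)).
  apply: fin_bigcap_measurable => [|i _]; first exact: finite_finset.
  by rewrite -[X in measurable X]setTI; apply: measurable_coor => //;
    exact: measurable_itv.
apply/seteqP; split => x /= xp i.
  by move=> _ /=; rewrite in_itv/= -ltr_distl.
by have := xp i Logic.I; rewrite /= in_itv/= -ltr_distl.
Qed.

(** The bridge from the topology to the coordinate sigma-algebra: an open set is the union of the
    countably many rational boxes that it contains. *)
Lemma open_measurable_rV (A : set 'rV[R]_n) : open A -> measurable A.
Proof.
move=> oA.
pose F p := if `[< box p `<=` A >] then box p else set0.
rewrite (_ : A = \bigcup_p F p).
  apply: countable_bigcupT_measurable => [|p]; first exact: countableP.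
  by rewrite /F; case: ifP.
apply/seteqP; split => [x Ax|x [p _]]; last first.
  by rewrite /F; case: asboolP => // pA /pA.
have /nbhs_ballP[e /= e0 eA] : nbhs x A by exact: open_nbhs_nbhs.
(* The radius is taken below [e / 2], so that a box containing [x] has diameter below [e] and stays
   inside the ball. *)
pose k := Num.truncn (2 / e).
have ke : (k.+1%:R)^-1 < e / 2.
  rewrite invf_plt ?posrE ?divr_gt0// ?ltr0n// invf_div.
  exact: truncnS_gt.
have k0 : (0 : R) < (k.+1%:R)^-1 by rewrite invr_gt0 ltr0n.
have /choice[q qx] (i : 'I_n) : exists q : rat,
    `|x 0 i - ratr q| < (k.+1%:R)^-1.
  have [q] : exists q : rat,
      ratr q \in `]x 0 i - (k.+1%:R)^-1, x 0 i + (k.+1%:R)^-1[.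
    by apply: rat_in_itvoo; rewrite ltrBlDr -addrA ltrDl addr_gt0.
  by rewrite in_itv/= -ltr_distl distrC; exists q.
have qxk : box (\row_i q i, k) x by move=> i /=; rewrite mxE.
exists (\row_i q i, k) => //; rewrite /F; case: asboolP => // -[].
move=> y ykq; apply: eA; split => // a i; rewrite ord1 /ball/=.
have := qxk i; have := ykq i => /=; rewrite mxE => yq xq.
rewrite (_ : x 0 i - y 0 i = (x 0 i - ratr (q i)) - (y 0 i - ratr (q i))); last by ring.
by rewrite (le_lt_trans (ler_normB _ _))// [ltRHS]splitr ltrD// (lt_trans _ ke).
Qed.

Lemma closed_measurable_rV (A : set 'rV[R]_n) : closed A -> measurable A.
Proof.
by rewrite -openC => /open_measurable_rV /measurableC; rewrite setCK.
Qed.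

Lemma lower_semicontinuous_measurable_rV (f : 'rV[R]_n -> \bar R) :
  lower_semicontinuous f -> measurable_fun setT f.
Proof.
move=> scif; apply: (measurability _ (ErealGenOInfty.measurableE R)).
move=> /= _ [_ [a ->]] <-; apply: measurableI => //.
apply: open_measurable_rV.
by rewrite preimage_itvoy; move/lower_semicontinuousP : scif; exact.
Qed.

Lemma dotv_continuous (y : 'rV[R]_n) : continuous (dotv y).
Proof.
apply: (@continuous_big _ _ _ _ predT) => [|i _ x]; first exact: add_continuous.
apply: (@continuous_comp _ _ _ (fun z : 'rV[R]_n => z 0 i) ( *%R (y 0 i))).
  exact: coord_continuous.
exact: mulrl_continuous.
Qed.

Lemma refl_continuous (u : 'rV[R]_n) : continuous (refl u).
Proof.
have cu : continuous (fun x => (2 * dotv x u) *: u).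
  rewrite (_ : (fun _ => _) = ( *:%R^~ u \o *%R 2) \o dotv u); last first.
    by apply/funext => x /=; rewrite dotvC.
  move=> x; apply: continuous_comp; first exact: dotv_continuous.
  apply: continuous_comp; first exact: mulrl_continuous.
  exact: scalel_continuous.
move=> x; apply: (@continuousB _ _ _ id (fun x => (2 * dotv x u) *: u)).
  exact: cvg_id.
exact: cu.
Qed.

(** A supremum of affine functions is lower semicontinuous. This is where the measurability of
    support functions comes from. *)
Lemma lower_semicontinuous_legendre (psi : 'rV[R]_n -> \bar R) :
  lower_semicontinuous (legendre psi).
Proof.
apply/lower_semicontinuousP => a.
rewrite (_ : [set _ | _] = \bigcup_y [set x | (a%:E < (dotv x y)%:E - psi y)%E]).
  apply: bigcup_open => y _.
  case: (psi y) => [r||] /=.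
  - rewrite (_ : [set _ | _] = dotv y @^-1` [set t | a + r < t]).
      by apply: open_comp; [move=> x _; exact: dotv_continuous|exact: open_gt].
    by apply/seteqP; split => x /=; rewrite -EFinB lte_fin ltrBrDr dotvC.
  - rewrite (_ : [set _ | _] = set0); first exact: open0.
    by apply/seteqP; split => x.
  - rewrite (_ : [set _ | _] = setT); first exact: openT.
    by apply/seteqP; split => // x _ /=; rewrite ltry.
apply/seteqP; split => x /=.
  by move=> /ereal_sup_gt[_ [y _ <-] ay]; exists y.
by move=> [y _ /=]  /lt_le_trans; apply; apply: ereal_sup_ubound; exists y.
Qed.

End borel_rV.

(** * Means and their concavity *)

(* [- base r f] is [boxcox r \o f] on the support of [f], and the [r]-mean is
   the quasi-arithmetic mean generated by [boxcox r]. *)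
Definition boxcox (R : realType) (r c : R) : R :=
  if r == 0 then ln c else (c `^ r - 1) / r.

Section means.
Context (R : realType).
Implicit Types (r a b c d l : R) (alpha : \bar R).

Lemma le_boxcox r a b : r <= 0 -> 0 < a -> 0 < b ->
  (boxcox r a <= boxcox r b) = (a <= b).
Proof.
move=> r0 a0 b0; rewrite /boxcox; have [_|rn0] := eqVneq r 0.
  by rewrite ler_ln.
have {rn0}r0 : r < 0 by rewrite lt_neqAle rn0.
rewrite ler_nM2r ?invr_lt0// lerD2r /powR !gt_eqF// ler_expR.
by rewrite ler_nM2l// ler_ln.
Qed.

Lemma alpha_mean_gt0 r l a b : 0 < a -> 0 < b -> 0 <= l <= 1 ->
  0 < alpha_mean r%:E l a b.
Proof.
move=> a0 b0 /andP[l0 l1] /=; case: ifP => _; first by rewrite mulr_gt0 ?powR_gt0.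
rewrite powR_gt0//; have a0' := powR_gt0 r a0; have b0' := powR_gt0 r b0.
have [->|ln0] := eqVneq l 0; first by rewrite mul0r add0r subr0 mul1r.
apply: ltr_pwDl; first by rewrite mulr_gt0// lt0r ln0.
by rewrite mulr_ge0 ?subr_ge0// ltW.
Qed.

Lemma boxcox_alpha_mean r l a b : 0 < a -> 0 < b -> 0 <= l <= 1 ->
  boxcox r (alpha_mean r%:E l a b) = l * boxcox r a + (1 - l) * boxcox r b.
Proof.
move=> a0 b0 l01; have := alpha_mean_gt0 r a0 b0 l01; rewrite /boxcox /=.
have [r0|rn0] := eqVneq r 0 => M0.
  by rewrite lnM ?posrE ?powR_gt0// !ln_powR.
rewrite -powRrM mulVf// powRr1; first by field.
move: l01 => /andP[l0 l1].
by rewrite addr_ge0// mulr_ge0 ?subr_ge0// ?powR_ge0.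
Qed.

Lemma half01 : (0 <= 2^-1 :> R) && (2^-1 <= 1 :> R).
Proof. by apply/andP; split; lra. Qed.

Lemma half_mean_alpha_mean alpha a b : 0 < a -> 0 < b ->
  half_mean alpha a b = alpha_mean alpha 2^-1 a b.
Proof.
move=> a0 b0; case: alpha => [r||]//=.
have h : 1 - 2^-1 = 2^-1 :> R by field.
rewrite (gt_eqF a0) (gt_eqF b0)/=; case: ifP => _; rewrite h//.
by rewrite !powR12_sqrt ?ltW// -sqrtrM// ltW.
Qed.

Lemma half_mean_gt0 r a b : 0 < a -> 0 < b -> 0 < half_mean r%:E a b.
Proof.
move=> a0 b0; rewrite half_mean_alpha_mean// alpha_mean_gt0//.
exact: half01.
Qed.

Lemma boxcox_half_mean r a b : 0 < a -> 0 < b ->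
  boxcox r (half_mean r%:E a b) = 2^-1 * boxcox r a + 2^-1 * boxcox r b.
Proof.
move=> a0 b0; rewrite half_mean_alpha_mean// boxcox_alpha_mean ?half01//.
by congr (_ + _ * _); field.
Qed.

Lemma half_mean_ge0 alpha a b : 0 <= a -> 0 <= b -> 0 <= half_mean alpha a b.
Proof.
move=> a0 b0; case: alpha => [r||]//=; last by rewrite le_min a0.
by case: ifP => _; [exact: sqrtr_ge0|case: ifP => _ //; exact: powR_ge0].
Qed.

Lemma half_mean_eq0 alpha a b : (alpha <= 0)%E -> 0 <= a -> 0 <= b ->
  a = 0 \/ b = 0 -> half_mean alpha a b = 0.
Proof.
move=> al0 a0 b0 ab0; case: alpha al0 => [r||]//= _.
  case: ifP => _; first by case: ab0 => ->; rewrite ?mul0r ?mulr0 sqrtr0.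
  by case: ab0 => ->; rewrite eqxx ?orbT.
by case: ab0 => ->; [exact: min_l|exact: min_r].
Qed.

Lemma half_mean_gt0_imp alpha a b : (alpha <= 0)%E -> 0 <= a -> 0 <= b ->
  0 < half_mean alpha a b -> 0 < a /\ 0 < b.
Proof.
move=> al0 a0 b0 h0; rewrite !lt_neqAle a0 b0 !andbT !(eq_sym 0).
by split; apply: contraTneq h0 => ab0; rewrite half_mean_eq0 ?ltxx//; [left|right].
Qed.

Lemma half_meanC alpha a b : half_mean alpha a b = half_mean alpha b a.
Proof.
case: alpha => [r||]; rewrite /half_mean; last exact: minC.
  by rewrite (mulrC a) orbC addrC.
by [].
Qed.

(** Means are compared through their transforms, since [boxcox r] is increasing; the two equations
    allow the transforms to be supplied in expanded form. *)
Let le_of_boxcox r c d x y : r <= 0 -> 0 < c -> 0 < d ->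
  boxcox r c = x -> boxcox r d = y -> x <= y -> c <= d.
Proof. by move=> r0 c0 d0 <- <-; rewrite le_boxcox. Qed.

Lemma half_mean_le alpha a b a' b' : (alpha <= 0)%E -> 0 <= a -> 0 <= b ->
  a <= a' -> b <= b' -> half_mean alpha a b <= half_mean alpha a' b'.
Proof.
move=> al0 a0 b0 aa bb.
have a'0 := le_trans a0 aa; have b'0 := le_trans b0 bb.
have [h0|] := ltP 0 (half_mean alpha a b); last first.
  by move=> /le_trans; apply; exact: half_mean_ge0.
have [{}a0 {}b0] := half_mean_gt0_imp al0 a0 b0 h0.
have {}a'0 := lt_le_trans a0 aa; have {}b'0 := lt_le_trans b0 bb.
case: alpha al0 h0 => [r|//|_ _]; last first.
  by rewrite [leLHS]/= [leRHS]/= le_min !ge_min aa bb orbT.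
rewrite lee_fin => r0 _.
have h0 := half_mean_gt0 r a0 b0; have h'0 := half_mean_gt0 r a'0 b'0.
apply: (le_of_boxcox r0 h0 h'0 (boxcox_half_mean r a0 b0)
  (boxcox_half_mean r a'0 b'0)).
by rewrite lerD// ler_pM2l ?invr_gt0// le_boxcox.
Qed.

Lemma half_meanxx alpha a : (alpha <= 0)%E -> 0 <= a -> half_mean alpha a a = a.
Proof.
move=> al0; rewrite le_eqVlt => /predU1P[<-|a0]; first by rewrite half_mean_eq0//; left.
case: alpha al0 => [r|//|_]; last by rewrite /half_mean minxx.
rewrite lee_fin => r0; have h0 := half_mean_gt0 r a0 a0.
apply/eqP; rewrite eq_le; apply/andP; split.
  by apply: (le_of_boxcox r0 h0 a0 (boxcox_half_mean r a0 a0) erefl); lra.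
by apply: (le_of_boxcox r0 a0 h0 erefl (boxcox_half_mean r a0 a0)); lra.
Qed.

Lemma half_mean_ge_min alpha a b : (alpha <= 0)%E -> 0 <= a -> 0 <= b ->
  Num.min a b <= half_mean alpha a b.
Proof.
move=> al0 a0 b0; have m0 : 0 <= Num.min a b by rewrite le_min a0.
by rewrite -[leLHS](half_meanxx al0)// half_mean_le// ge_min lexx ?orbT.
Qed.

Lemma half_mean_le_ub alpha a b c : (alpha <= 0)%E -> 0 <= a -> 0 <= b ->
  a <= c -> b <= c -> half_mean alpha a b <= c.
Proof.
move=> al0 a0 b0 ac bc.
by rewrite -[leRHS](half_meanxx al0) ?half_mean_le// (le_trans a0).
Qed.

(** Left continuity of the transform, in the form needed for suprema: every value above [c] has a
    transform within [e] of that of the supremum [d], or above it. *)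
Lemma boxcox_left_cont r d e : r <= 0 -> 0 < d -> 0 < e ->
  exists2 c, 0 < c < d & boxcox r d - e < boxcox r c.
Proof.
move=> r_le0 d0 e0.
have [->|rn0] := eqVneq r 0.
  exists (d * expR (- (e / 2))).
    by rewrite mulr_gt0 ?expR_gt0// gtr_pMr// expR_lt1 oppr_lt0 divr_gt0.
  by rewrite /boxcox eqxx lnM ?posrE ?expR_gt0// expRK; lra.
have {rn0 r_le0}r0 : r < 0 by rewrite lt_neqAle rn0.
have re : 0 < - (r * (e / 2)) by rewrite -mulNr mulr_gt0 ?divr_gt0 ?oppr_gt0.
have x0 : 0 < d `^ r - r * (e / 2) by rewrite addr_gt0 ?powR_gt0.
(* The witness solves [boxcox r c = boxcox r d - e / 2]; since [r < 0], the base of the outer power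
   is positive. *)
have NE : boxcox r ((d `^ r - r * (e / 2)) `^ r^-1) = boxcox r d - e / 2.
  rewrite /boxcox lt_eqF// -powRrM mulVf ?lt_eqF// powRr1 ?ltW//.
  by field; rewrite lt_eqF.
exists ((d `^ r - r * (e / 2)) `^ r^-1); last by rewrite NE; lra.
rewrite powR_gt0//= ltNge -(le_boxcox (ltW r0)) ?powR_gt0// NE -ltNge.
by rewrite ltrBlDr ltrDl divr_gt0.
Qed.

End means.

(** * The Minkowski symmetral *)

(** The substitution [a = 2y], [b = refl u (2z)] turns the constraint [y + z = x] of [tau] into
    [reflmid u a b = x] and the averaged values into [f a] and [f b]. *)
Definition reflmid (R : realType) (n : nat) (u a b : 'rV[R]_n) : 'rV[R]_n :=
  2^-1 *: a + 2^-1 *: refl u b.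

Lemma refl_reflmid (R : realType) (n : nat) (u a b : 'rV[R]_n) : sphere u ->
  refl u (reflmid u a b) = reflmid u b a.
Proof. by move=> su; rewrite reflD !reflZ reflK// addrC. Qed.

Lemma reflmidK (R : realType) (n : nat) (u x : 'rV[R]_n) : sphere u ->
  reflmid u x (refl u x) = x.
Proof.
by move=> su; rewrite /reflmid reflK//; apply/rowP => i; rewrite !mxE; field.
Qed.

Lemma reflmid_conv (R : realType) (n : nat) (u a b c d : 'rV[R]_n) (l : R) :
  l *: reflmid u a b + (1 - l) *: reflmid u c d =
  reflmid u (l *: a + (1 - l) *: c) (l *: b + (1 - l) *: d).
Proof.
by rewrite /reflmid reflD !reflZ !scalerDr !scalerA !(mulrC l, mulrC (1 - l)) addrACA.
Qed.

Section tau_sup.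
Context (R : realType) (n : nat) (u : 'rV[R]_n) (alpha : \bar R).
Hypotheses (su : sphere u) (alpha0 : (alpha <= 0)%E).
Implicit Types (f g : 'rV[R]_n -> R) (a b x : 'rV[R]_n).

Lemma tau_le f x c :
  (forall a b, reflmid u a b = x -> half_mean alpha (f a) (f b) <= c) ->
  tau alpha u f x <= c.
Proof.
move=> fc; apply: ge_sup.
  by exists (half_mean alpha (f (2 *: x)) (reflf u f (2 *: 0))), (x, 0) => //=;
    rewrite addr0.
move=> _ [[y z] /= yz <-]; apply: fc; rewrite -yz.
by rewrite /reflmid reflK// !scalerA mulVf// !scale1r.
Qed.

Lemma tau_gt f x c : c < tau alpha u f x ->
  exists a b, reflmid u a b = x /\ c < half_mean alpha (f a) (f b).
Proof.
move=> cf; apply: contrapT => h; move: cf; apply/negP; rewrite -leNgt.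
apply: tau_le => a b ab; rewrite leNgt; apply/negP => cab.
by apply: h; exists a, b.
Qed.

(** The bound [B] makes the real supremum genuine: an unbounded set would receive a default
    value. *)
Lemma tau_ge f B a b : (forall x, 0 <= f x <= B) ->
  half_mean alpha (f a) (f b) <= tau alpha u f (reflmid u a b).
Proof.
move=> fB; apply: ub_le_sup.
  exists B => _ [[y z] /= _ <-]; rewrite /reflf.
  have /andP[? ?] := fB (2 *: y); have /andP[? ?] := fB (refl u (2 *: z)).
  exact: half_mean_le_ub.
exists (2^-1 *: a, 2^-1 *: refl u b) => //=.
by rewrite /reflf !scalerA divff// !scale1r reflK.
Qed.

Lemma tau_bounded f B : (forall x, 0 <= f x <= B) ->
  forall x, 0 <= tau alpha u f x <= B.
Proof.
move=> fB x; apply/andP; split.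
  rewrite -[X in tau _ _ _ X](reflmidK x su); apply: le_trans (tau_ge x (refl u x) fB).
  by apply: half_mean_ge0; [have /andP[] := fB x|have /andP[] := fB (refl u x)].
apply: tau_le => a b _; have /andP[? ?] := fB a; have /andP[? ?] := fB b.
exact: half_mean_le_ub.
Qed.

(** Reflecting the averaged point exchanges [a] and [b], and the half mean is symmetric. One
    inequality suffices because the reflection is an involution. *)
Lemma reflf_tau f B : (forall x, 0 <= f x <= B) ->
  reflf u (tau alpha u f) = tau alpha u f.
Proof.
move=> fB; apply/funext => x; rewrite /reflf.
have h y : tau alpha u f (refl u y) <= tau alpha u f y.
  apply: tau_le => a b ab; rewrite half_meanC -[y](reflK su) -ab refl_reflmid//.
  exact: tau_ge fB.
by apply/eqP; rewrite eq_le h/=; have := h (refl u x); rewrite reflK.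
Qed.

Lemma le_tau f g B : (forall x, 0 <= f x) -> (forall x, g x <= B) ->
  (forall x, f x <= g x) -> forall x, tau alpha u f x <= tau alpha u g x.
Proof.
move=> f0 gB fg x; apply: tau_le => a b <-.
apply: (@le_trans _ _ (half_mean alpha (g a) (g b))); first exact: half_mean_le.
by apply: (@tau_ge _ B) => y; rewrite gB (le_trans (f0 y)).
Qed.

(** The inequality in [alpha_concave], isolated because it is what the symmetral inherits from
    [f]. *)
Definition mean_concave f := forall x y l, 0 < f x -> 0 < f y -> 0 <= l <= 1 ->
  alpha_mean alpha l (f x) (f y) <= f (l *: x + (1 - l) *: y).

(** Upper bound: [f b] equals the value of [f] at [refl u b], so concavity at the midpoint of [a]
    and [refl u b] applies. Lower bound: the pair formed by [x] and [refl u x] has midpoint [x] and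
    mean [f x]. *)
Lemma tau_invariant f B : (forall x, 0 <= f x <= B) -> mean_concave f ->
  reflf u f = f -> tau alpha u f = f.
Proof.
move=> fB fc fH; apply/funext => x; apply/eqP; rewrite eq_le; apply/andP; split.
  apply: tau_le => a b <-; rewrite -[f b]/(f b) -[in f b]fH /reflf.
  have /andP[a0 _] := fB a; have /andP[b0 _] := fB (refl u b).
  have [h0|] := ltP 0 (half_mean alpha (f a) (f (refl u b))); last first.
    by move=> /le_trans; apply; have /andP[] := fB (reflmid u a b).
  have [fa0 fb0] := half_mean_gt0_imp alpha0 a0 b0 h0.
  rewrite half_mean_alpha_mean// (le_trans (fc _ _ _ fa0 fb0 (half01 R)))//.
  by rewrite (_ : 1 - 2^-1 = 2^-1)//; field.
have /andP[x0 _] := fB x.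
rewrite -[leLHS](half_meanxx alpha0 x0) -[in X in _ <= X](reflmidK x su).
rewrite -[X in half_mean _ _ X <= _]/(f x) -[in X in half_mean _ _ X <= _]fH.
exact: tau_ge fB.
Qed.

(** The ordinary midpoint of [a] and [b] differs from [reflmid u a b] by a multiple of [u], so
    concavity bounds each half mean by a value of [f] on the same line. Conversely, averaging a
    point with its own reflection projects it onto the hyperplane and keeps its value. *)
Lemma tau_proj f B : (forall x, 0 <= f x <= B) -> mean_concave f ->
  forall x, orthc u x -> proj_fun u (tau alpha u f) x = proj_fun u f x.
Proof.
move=> fB fc x xu; rewrite /proj_fun.
have ub g : (forall y, 0 <= g y <= B) -> has_ubound [set g (x + t *: u) | t in [set: R]].
  by move=> gB; exists B => _ [t _ <-]; have /andP[] := gB (x + t *: u).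
apply/eqP; rewrite eq_le; apply/andP; split; apply: ge_sup.
- by exists (tau alpha u f (x + 0 *: u)), 0.
- move=> _ [t _ <-]; apply: tau_le => a b ab.
  have /andP[a0 _] := fB a; have /andP[b0 _] := fB b.
  have abE : 2^-1 *: a + (1 - 2^-1) *: b = x + (t + dotv b u) *: u.
    have -> : x + (t + dotv b u) *: u = (x + t *: u) + dotv b u *: u.
      by rewrite scalerDl addrA.
    rewrite -ab /reflmid /refl.
    by apply/rowP => i; rewrite !mxE; field.
  have : f (x + (t + dotv b u) *: u) <= sup [set f (x + t *: u) | t in [set: R]].
    by apply: ub_le_sup; [exact: ub|exists (t + dotv b u)].
  rewrite -abE; apply: le_trans.
  have [h0|] := ltP 0 (half_mean alpha (f a) (f b)); last first.
    by move=> /le_trans; apply; have /andP[] := fB (2^-1 *: a + (1 - 2^-1) *: b).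
  have [fa0 fb0] := half_mean_gt0_imp alpha0 a0 b0 h0.
  by rewrite half_mean_alpha_mean// fc// half01.
- by exists (f (x + 0 *: u)), 0.
move=> _ [t _ <-].
have /andP[x0 _] := fB (x + t *: u).
have xE : reflmid u (x + t *: u) (x + t *: u) = x + 0 *: u.
  have uu := sphere_dotv su.
  rewrite /reflmid /refl dotvDl dotvZl uu (xu : dotv x u = 0).
  by apply/rowP => i; rewrite !mxE; field.
apply: (@le_trans _ _ (tau alpha u f (x + 0 *: u))).
  by rewrite -[leLHS](half_meanxx alpha0 x0) -xE; exact: tau_ge fB.
by apply: ub_le_sup; [apply: ub; exact: tau_bounded|exists 0].
Qed.

End tau_sup.

(** Almost optimal pairs for [x] and [y] are combined componentwise, which [reflmid_conv] allows.
    After the transform both the half mean and the [l]-mean are arithmetic, so they commute. *)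
Lemma tau_mean_concave (R : realType) (n : nat) (u : 'rV[R]_n) (alpha : \bar R)
    (f : 'rV[R]_n -> R) (B : R) : sphere u -> (alpha <= 0)%E ->
  (forall x, 0 <= f x <= B) -> mean_concave alpha f ->
  mean_concave alpha (tau alpha u f).
Proof.
move=> su al0 fB fc x y l tx ty l01; have /andP[l0 l1] := l01.
have f0 z : 0 <= f z by have /andP[] := fB z.
set z := l *: x + _.
(* The minimum has no transform; there a value strictly between the two sides is refuted
   directly. *)
case: alpha al0 fc tx ty => [r|//|] fc0 fc tx ty; last first.
  rewrite /alpha_mean leNgt; apply/negP; rewrite lt_min => /andP[zx zy].
  have z0 : 0 <= tau -oo u f z by have /andP[] := tau_bounded su (leNye 0) fB z.
  have [a [b [ab]]] := tau_gt su zx; rewrite /half_mean lt_min => /andP[za zb].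
  have [c [d [cd]]] := tau_gt su zy; rewrite /half_mean lt_min => /andP[zc zd].
  have := tau_ge (alpha := -oo%E) su (leNye 0) (l *: a + (1 - l) *: c)
    (l *: b + (1 - l) *: d) fB.
  rewrite -reflmid_conv ab cd -/z; apply/negP; rewrite -ltNge /half_mean lt_min.
  apply/andP; split.
    apply: lt_le_trans (fc a c l _ _ l01); rewrite ?(le_lt_trans z0)//.
    by rewrite /alpha_mean lt_min za.
  apply: lt_le_trans (fc b d l _ _ l01); rewrite ?(le_lt_trans z0)//.
  by rewrite /alpha_mean lt_min zb.
have r0 : r <= 0 by rewrite -lee_fin.
have [Nx NxE] : exists N, N = boxcox r (tau r%:E u f x) by eexists.
have [Ny NyE] : exists N, N = boxcox r (tau r%:E u f y) by eexists.
have approx w N e : 0 < tau r%:E u f w -> N = boxcox r (tau r%:E u f w) ->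
    0 < e -> exists a b, [/\ 0 < f a, 0 < f b, reflmid u a b = w &
      N - e <= 2^-1 * boxcox r (f a) + 2^-1 * boxcox r (f b)].
  move=> tw -> e0; have [c /andP[c0 cw] Nc] := boxcox_left_cont r0 tw e0.
  have [a [b [ab cab]]] := tau_gt su cw.
  have [fa fb] := half_mean_gt0_imp fc0 (f0 a) (f0 b) (lt_trans c0 cab).
  exists a, b; split => //; apply: le_trans (ltW Nc) _.
  have [H [HE H0]] : exists H, H = half_mean r%:E (f a) (f b) /\ 0 < H.
    by eexists; split; [reflexivity|exact: half_mean_gt0].
  by rewrite -(boxcox_half_mean r fa fb) -HE le_boxcox// HE ltW.
have conc a c : 0 < f a -> 0 < f c -> exists P, [/\ 0 < P,
    boxcox r P = l * boxcox r (f a) + (1 - l) * boxcox r (f c) &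
    P <= f (l *: a + (1 - l) *: c)].
  move=> fa fc'; exists (alpha_mean r%:E l (f a) (f c)).
  by split; [exact: alpha_mean_gt0|exact: boxcox_alpha_mean|exact: fc].
have key e : 0 < e -> exists2 c, 0 < c <= tau r%:E u f z &
    l * Nx + (1 - l) * Ny - e <= boxcox r c.
  move=> e0.
  have [a [b [fa fb ab Nab]]] := approx x Nx e tx NxE e0.
  have [c [d [fc' fd cd Ncd]]] := approx y Ny e ty NyE e0.
  have [P [P0 NP leP]] := conc a c fa fc'.
  have [Q [Q0 NQ leQ]] := conc b d fb fd.
  have H0 := half_mean_gt0 r P0 Q0.
  exists (half_mean r%:E P Q).
    rewrite H0/= /z -ab -cd reflmid_conv; apply: le_trans (tau_ge su fc0 _ _ fB).
    exact: (half_mean_le fc0 (ltW P0) (ltW Q0) leP leQ).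
  rewrite (boxcox_half_mean r P0 Q0) NP NQ.
  have h3 := ler_wpM2l l0 Nab.
  have l1' : 0 <= 1 - l by rewrite subr_ge0.
  have h4 := ler_wpM2l l1' Ncd.
  by move: h3 h4; lra.
have z0 : 0 < tau r%:E u f z.
  by have [c /andP[c0 cz] _] := key 1 ltr01; exact: lt_le_trans cz.
have [M [ME M0]] : exists M, M = alpha_mean r%:E l (tau r%:E u f x) (tau r%:E u f y)
    /\ 0 < M.
  by eexists; split; [reflexivity|exact: alpha_mean_gt0].
have NM : boxcox r M = l * Nx + (1 - l) * Ny.
  by rewrite ME NxE NyE; exact: boxcox_alpha_mean.
rewrite -ME -(le_boxcox r0 M0 z0) NM.
apply/ler_addgt0Pr => e e0; have [c /andP[c0 cz]] := key _ e0.
rewrite lerBlDr => /le_trans; apply; rewrite lerD2r.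
by rewrite le_boxcox.
Qed.

(** * Superlevel sets *)

(** Cantor's intersection theorem for a chain indexed by reals: the filter generated by the sets
    clusters in [K c0], and closedness puts the cluster point in every member. *)
Lemma compact_chain (R : realType) (T : topologicalType) (D : set R)
    (K : R -> set T) (c0 : R) :
  D c0 -> compact (K c0) -> (forall c, D c -> closed (K c)) ->
  (forall c, D c -> K c !=set0) ->
  (forall c d, c <= d -> K d `<=` K c) ->
  exists p, forall c, D c -> K c p.
Proof.
move=> Dc0 cK clK K0 Knd.
have FF : ProperFilter (filter_from D K).
  apply: filter_from_proper => //; apply: filter_from_filter; first by exists c0.
  move=> c d Dc Dd; have [cd|dc] := leP c d.
    by exists d => // p Kp; split => //; exact: Knd Kp.
  by exists c => // p Kp; split => //; exact: (Knd _ _ (ltW dc)) Kp.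
have [|p [_ clp]] := cK _ FF; first by exists c0.
exists p => c Dc; apply: clK => // B Bp; apply: clp => //.
by exists c.
Qed.

Section superlevel.
Context (R : realType) (n : nat).
Implicit Types (f : 'rV[R]_n -> R).

Lemma mx_norm_le_enorm (x : 'rV[R]_n) : `|x| <= enorm x.
Proof.
rewrite [leLHS]/Num.Def.normr /= mx_normrE; apply/bigmax_leP.
split => [|[i j] _ /=]; first exact: sqrtr_ge0.
by rewrite ord1; exact: coor_le_enorm.
Qed.

Lemma closed_superlevel f c : upper_semicontinuous f -> closed [set x | c <= f x].
Proof.
move=> /lower_semicontinuousP uf; rewrite -openC.
rewrite (_ : ~` _ = [set x | ((- c)%:E < (- f x)%:E)%E]); first exact: uf.
apply/seteqP; split => x /=; rewrite lte_fin ltrN2.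
  by move=> /negP; rewrite -ltNge.
by rewrite ltNge => /negP.
Qed.

Lemma compact_superlevel f c : upper_semicontinuous f ->
  vanishes_at_infinity f -> 0 < c -> compact [set x | c <= f x].
Proof.
move=> uf vf c0; apply: bounded_closed_compact; last exact: closed_superlevel.
have [M fM] := vf _ c0; exists M; split; first exact: num_real.
move=> N MN x /= cx; apply: le_trans (ltW MN); apply: le_trans (mx_norm_le_enorm x) _.
rewrite leNgt; apply/negP => /fM; apply/negP; rewrite -leNgt.
exact: le_trans (ler_norm _).
Qed.

(** If [f] were unbounded, all superlevel sets at positive levels would be nonempty, and a point
    common to them would have an infinite value. *)
Lemma upper_semicontinuous_bounded f : upper_semicontinuous f ->
  vanishes_at_infinity f -> exists B, forall x, f x <= B.
Proof.
move=> uf vf; apply: contrapT => nB.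
have [|||||p fp] := @compact_chain R _ [set c | 0 < c] (fun c => [set x | c <= f x]) 1.
- exact: ltr01.
- exact: compact_superlevel.
- by move=> c _; exact: closed_superlevel.
- move=> c _; apply: contrapT => h; apply: nB; exists c => x.
  by rewrite leNgt; apply/negP => /ltW cx; apply: h; exists x.
- by move=> c d cd x /=; exact: le_trans.
have /= := fp (`|f p| + 1); rewrite ltr_pwDr// => /(_ isT).
by rewrite leNgt ltr_pwDr// ler_norm.
Qed.

(** Turns a supremum of minima over a closed set of pairs into a maximum: the pairs admissible at
    the levels below [t] form a decreasing chain of compact sets. *)
Lemma pair_superlevel_attained f (C : set ('rV[R]_n * 'rV[R]_n)) t :
  upper_semicontinuous f -> vanishes_at_infinity f -> closed C -> 0 < t ->
  (forall c, 0 < c < t -> exists p, [/\ C p, c <= f p.1 & c <= f p.2]) ->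
  exists p, [/\ C p, t <= f p.1 & t <= f p.2].
Proof.
move=> uf vf clC t0 Ct.
pose K c := C `&` ([set x | c <= f x] `*` [set x | c <= f x]).
have clK c : closed (K c).
  apply: closedI => //; rewrite (_ : _ `*` _ =
      fst @^-1` [set x | c <= f x] `&` snd @^-1` [set x | c <= f x])//.
  apply: closedI; apply: preimage_closed; try exact: closed_superlevel.
    by move=> p _; exact: cvg_fst.
  by move=> p _; exact: cvg_snd.
have t2 : 0 < t / 2 < t by rewrite divr_gt0//= ltr_pdivrMr// ltr_pMr// ltr1n.
have [|||||p Kp] := @compact_chain R _ [set c | 0 < c < t] K (t / 2).
- exact: t2.
- move: t2 => /andP[t20 _].
  apply: (subclosed_compact (clK _) (B := [set x | t / 2 <= f x] `*` [set x | t / 2 <= f x])).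
    by apply: compact_setX; exact: compact_superlevel.
  by move=> p [].
- by move=> c _; exact: clK.
- by move=> c /Ct [p [Cp c1 c2]]; exists p.
- by move=> c d cd p [Cp [/= d1 d2]]; split => //; split; exact: (le_trans cd).
have [Cp _] := Kp _ t2; exists p; split => //.
  rewrite leNgt; apply/negP => pt.
  (* A level of the chain strictly between [f p.1] and [t]; the maximum with [t / 2] keeps it
     positive. *)
  have m : 0 < Num.max (t / 2) ((f p.1 + t) / 2) < t by rewrite lt_max gt_max; lra.
  by have [_ [/= + _]] := Kp _ m; rewrite ge_max; lra.
rewrite leNgt; apply/negP => pt.
have m : 0 < Num.max (t / 2) ((f p.2 + t) / 2) < t by rewrite lt_max gt_max; lra.
by have [_ [/= _]] := Kp _ m; rewrite ge_max; lra.
Qed.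

Lemma reflmid_continuous (u : 'rV[R]_n) :
  continuous (fun p : 'rV[R]_n * 'rV[R]_n => reflmid u p.1 p.2).
Proof.
move=> p; apply: (@continuousD _ _ _ (fun p => 2^-1 *: p.1) (fun p => 2^-1 *: refl u p.2)).
  apply: (@continuous_comp _ _ _ fst ( *:%R 2^-1)); first exact: cvg_fst.
  exact: scaler_continuous.
apply: (@continuous_comp _ _ _ snd (fun x => 2^-1 *: refl u x)); first exact: cvg_snd.
apply: (@continuous_comp _ _ _ (refl u) ( *:%R 2^-1)); first exact: refl_continuous.
exact: scaler_continuous.
Qed.

End superlevel.

Lemma superlevel_tau_min (R : realType) (n : nat) (u : 'rV[R]_n)
    (f : 'rV[R]_n -> R) (t : R) : sphere u -> (forall x, 0 <= f x) ->
  upper_semicontinuous f -> vanishes_at_infinity f -> 0 < t ->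
  [set x | t <= tau -oo%E u f x] = tau_set u [set x | t <= f x].
Proof.
move=> su f0 uf vf t0; have [B fB] := upper_semicontinuous_bounded uf vf.
apply/seteqP; split => x /=; last first.
  move=> [a ta [_ [b tb <-] <-]]; rewrite -/(reflmid u a b).
  apply: le_trans (tau_ge (B := B) su (leNye 0) a b _); last by move=> y; rewrite f0 fB.
  by rewrite /half_mean le_min; apply/andP; split.
move=> tx.
pose C := (fun p : 'rV[R]_n * 'rV[R]_n => reflmid u p.1 p.2) @^-1` [set x].
have clC : closed C.
  apply: preimage_closed; first by move=> p _; exact: reflmid_continuous.
  exact/accessible_closed_set1/hausdorff_accessible/norm_hausdorff.
have [|[a b] [/= Cp ta tb]] := pair_superlevel_attained uf vf clC t0.
  move=> c /andP[_ ct]; have [a [b [ab]]] := tau_gt su (lt_le_trans ct tx).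
  by rewrite /half_mean lt_min => /andP[ca cb]; exists (a, b); split => //; exact: ltW.
by exists a => //; exists (refl u b) => //; exists b.
Qed.

(** * Steiner symmetrization and the total mass *)

(** Layer cake formula: [h x] is the length of the interval from 0 to [h x], so by Tonelli the
    integral of [h] is the integral over the levels of the measures of its superlevel sets. *)
Lemma le_integral_superlevel d (T : measurableType d) (R : realType)
    (mu : {sigma_finite_measure set T -> \bar R}) (f g : T -> R) :
  measurable_fun setT f -> measurable_fun setT g ->
  (forall x, 0 <= f x) -> (forall x, 0 <= g x) ->
  (forall t, 0 < t -> (mu [set x | t <= f x]%R <= mu [set x | t <= g x]%R)%E) ->
  (\int[mu]_x (f x)%:E <= \int[mu]_x (g x)%:E)%E.
Proof.
move=> mf mg f0 g0 fg.
pose A (h : T -> R) : set (T * measurableTypeR R) := [set p | 0 < p.2 <= h p.1].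
have mA (h : T -> R) : measurable_fun setT h -> measurable (A h).
  move=> mh; rewrite (_ : A h = [set p | 0 < p.2] `&` [set p | p.2 <= h p.1]).
    apply: measurableI; rewrite -[X in measurable X]setTI.
      rewrite (_ : [set p | _] = snd @^-1` `]0, +oo[); first exact: measurable_snd.
      by apply/seteqP; split => p /=; rewrite in_itv/= andbT.
    apply: (@measurable_fun_le _ _ _ _ snd (h \o fst)) => //.
    exact: measurableT_comp.
  by apply/seteqP; split => p /=; [move/andP|move=> ?; apply/andP].
have mI (h : T -> R) : measurable_fun setT h ->
    measurable_fun setT (fun p => (\1_(A h) p)%:E : \bar R).
  by move=> mh; apply/measurable_EFinP/measurable_indic; exact: mA.
have E (h : T -> R) : measurable_fun setT h -> (forall x, 0 <= h x) ->
    (\int[mu]_x (h x)%:E =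
     \int[lebesgue_measure]_t \int[mu]_x (\1_(A h) (x, t))%:E)%E.
  move=> mh h0; rewrite -(fubini_tonelli (fun p => (\1_(A h) p)%:E)); last 2 first.
  - exact: mI.
  - by move=> p; rewrite lee_fin.
  apply: eq_integral => x _.
  rewrite (_ : (fun _ => _) = (fun t => (\1_(`]0, h x]%classic) t)%:E))//.
    rewrite integral_indic//= setIT lebesgue_measure_itv/= lte_fin.
    case: ltP => hx; first by rewrite oppr0 adde0.
    by congr EFin; apply/eqP; rewrite eq_le hx h0.
rewrite (E f mf f0) (E g mg g0); apply: ge0_le_integral => //=.
- by move=> t _; apply: integral_ge0 => x _; rewrite lee_fin.
- apply: (measurable_fun_fubini_tonelli_G (fun p => (\1_(A f) p)%:E)) => [|p].
    exact: mI.
  by rewrite lee_fin.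
- apply: (measurable_fun_fubini_tonelli_G (fun p => (\1_(A g) p)%:E)) => [|p].
    exact: mI.
  by rewrite lee_fin.
move=> t _.
have E' (h : T -> R) : measurable_fun setT h -> (\int[mu]_x (\1_(A h) (x, t))%:E =
    if (0 < t)%R then mu [set x | t <= h x]%R else 0)%E.
  move=> mh; case: ifP => t0; last first.
    apply: integral0_eq => x _; rewrite indicE memNset// /A/=.
    by rewrite t0.
  rewrite (_ : (fun _ => _) = (fun x => (\1_[set x | t <= h x] x)%:E)).
    rewrite integral_indic//= ?setIT//.
    rewrite -[X in measurable X]setTI.
    exact: (@measurable_fun_le _ _ _ _ (fun=> t) h).
  apply/funext => x; rewrite !indicE.
  suff -> : ((x, t) \in A h) = (x \in [set x | t <= h x]) by [].
  by apply/idP/idP; rewrite !inE /A /= t0.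
by rewrite !E'//; case: ifP => // t0; exact: fg.
Qed.

(** For an interval [K] of length [b - a], the half differences of its points fill the centred open
    interval of the same length. The shift [k] accounts for the choice of origin on the line. *)
Lemma lebesgue_half_difference (R : realType) (K D : set (measurableTypeR R)) (k : R) :
  measurable K -> measurable D -> bounded_set (K : set R) ->
  (forall p q s, K p -> K q -> p <= s <= q -> K s) ->
  (forall p q, K p -> K q -> D ((p - q) / 2 - k)) ->
  (lebesgue_measure K <= lebesgue_measure D)%E.
Proof.
move=> mK mD bK iK KD.
have [->|/set0P[x0 Kx0]] := eqVneq K set0; first by rewrite measure0.
have [M [_ KM]] := bK.
have {}KM x : K x -> `|x| <= `|M| + 1.
  by apply: KM; rewrite (le_lt_trans (ler_norm _))// ltrDl.
have hs : has_sup K.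
  split; first by exists x0.
  by exists (`|M| + 1) => x /KM; exact: le_trans (ler_norm _).
have hi : has_inf K.
  split; first by exists x0.
  exists (- (`|M| + 1)) => x /KM; rewrite lerNl => /(le_trans _); apply.
  by rewrite -normrN ler_norm.
set a := inf K; set b := sup K.
have ab : a <= b.
  apply: (@le_trans _ _ x0); first by apply: ge_inf => //; case: hi.
  by apply: ub_le_sup => //; case: hs.
apply: (@le_trans _ _ (b - a)%:E).
  apply: (@le_trans _ _ (lebesgue_measure (`[a, b]%classic : set (measurableTypeR R)))).
    apply: le_measure; [exact/mem_set|apply/mem_set; exact: measurable_itv|].
    move=> x Kx /=; rewrite in_itv/=; apply/andP; split.
      by apply: ge_inf => //; case: hi.
    by apply: ub_le_sup => //; case: hs.
  rewrite lebesgue_measure_itv/= lte_fin; case: ifP => // _.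
  by rewrite lee_fin subr_ge0.
apply: (@le_trans _ _ (lebesgue_measure
    (`](a - b) / 2 - k, (b - a) / 2 - k[%classic : set (measurableTypeR R)))).
  rewrite lebesgue_measure_itv/= lte_fin; case: ifPn => h.
    by rewrite -EFinD lee_fin; lra.
  by rewrite lee_fin; move: h; rewrite -leNgt; lra.
apply: le_measure; [apply/mem_set; exact: measurable_itv|exact/mem_set|].
move=> t /=; rewrite in_itv/= => /andP[t1 t2].
(* The distance that two points of [K] must have to produce [t]. Points [q] and [p] within half the
   slack [b - a - r] of the two ends satisfy [p <= q - r], hence [q - r] belongs to [K]. *)
pose r := 2 * `|t + k|; have r0 : 0 <= r by rewrite mulr_ge0.
have rab : r < b - a.
  by rewrite /r; have [h|h] := leP 0 (t + k); [rewrite ger0_norm//|rewrite ltr0_norm//]; lra.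
have e0 : 0 < (b - a - r) / 2 by rewrite divr_gt0// subr_gt0.
have [q Kq bq] := sup_adherent e0 hs.
have [p Kp pa] := inf_adherent e0 hi.
have Kqr : K (q - r).
  apply: (iK p q) => //; apply/andP; split; last by lra.
  by move: bq pa; rewrite -/a -/b; lra.
have [h|h] := leP 0 (t + k).
  have -> : t = (q - (q - r)) / 2 - k by rewrite /r ger0_norm//; field.
  exact: KD.
have -> : t = ((q - r) - q) / 2 - k by rewrite /r ltr0_norm//; field.
exact: KD.
Qed.

(** For a unit vector [u]: the two points lie on a common line of direction [u]. The equation, used
    instead of an existential, exhibits a closed condition. *)
Definition coline (R : realType) (n : nat) (u : 'rV[R]_n)
    (p : 'rV[R]_n * 'rV[R]_n) : Prop :=
  p.1 - p.2 = dotv (p.1 - p.2) u *: u.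

(* When [f] is quasi-concave, a line of direction [u] meets a superlevel set of
   [f] in a segment, whose half difference body is the centred segment of the
   same length; so the superlevel sets are Steiner symmetrized. *)
Definition steiner (R : realType) (n : nat) (u : 'rV[R]_n) (f : 'rV[R]_n -> R)
    : 'rV[R]_n -> R :=
  fun x => sup [set Num.min (f p.1) (f p.2) |
                p in [set p | coline u p /\ reflmid u p.1 p.2 = x]].

Lemma upper_semicontinuous_superlevel (R : realType) (n : nat) (f : 'rV[R]_n -> R) :
  (forall c, closed [set x | c <= f x]) -> upper_semicontinuous f.
Proof.
move=> clf; apply/lower_semicontinuousP => a.
rewrite (_ : [set _ | _] = ~` [set x | - a <= f x]); first exact/closed_openC.
apply/seteqP; split => x /=; rewrite lte_fin ltrNr.
  by rewrite ltNge => /negP.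
by move=> /negP; rewrite -ltNge.
Qed.

Lemma measurable_upper_semicontinuous (R : realType) (n : nat) (f : 'rV[R]_n -> R) :
  upper_semicontinuous f -> measurable_fun setT f.
Proof.
move=> /lower_semicontinuous_measurable_rV mf.
have : measurable_fun setT (fun x => - f x) by exact/measurable_EFinP.
move=> /measurable_funN; apply: eq_measurable_fun => x _ /=.
by rewrite opprK.
Qed.

Lemma closed_coline (R : realType) (n : nat) (u : 'rV[R]_n) :
  closed [set p | coline u p].
Proof.
pose D (p : 'rV[R]_n * 'rV[R]_n) := p.1 - p.2.
have cD : continuous D.
  move=> p; apply: (@continuousB _ _ _ fst snd); first exact: cvg_fst.
  exact: cvg_snd.
pose E (x : 'rV[R]_n) := x - dotv u x *: u.
have cE : continuous E.
  move=> x; apply: (@continuousB _ _ _ id (fun x => dotv u x *: u)).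
    exact: cvg_id.
  apply: (@continuous_comp _ _ _ (dotv u) ( *:%R^~ u)).
    exact: dotv_continuous.
  exact: scalel_continuous.
rewrite (_ : [set _ | _] = (E \o D) @^-1` [set 0]).
  apply: preimage_closed.
    by move=> p _; apply: continuous_comp; [exact: cD|exact: cE].
  exact/accessible_closed_set1/hausdorff_accessible/norm_hausdorff.
apply/seteqP; split => p /=; rewrite /coline /E /D dotvC.
  by move=> pE; rewrite [X in X - _]pE subrr.
by move=> /eqP; rewrite subr_eq0 => /eqP.
Qed.

Section steiner.
Context (R : realType) (n : nat) (u : 'rV[R]_n) (f : 'rV[R]_n -> R) (B : R).
Hypotheses (su : sphere u) (fB : forall x, 0 <= f x <= B).
Hypotheses (uf : upper_semicontinuous f) (vf : vanishes_at_infinity f).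

Let f0 x : 0 <= f x. Proof. by have /andP[] := fB x. Qed.

Lemma steiner_ge a b : coline u (a, b) ->
  Num.min (f a) (f b) <= steiner u f (reflmid u a b).
Proof.
move=> ab; apply: ub_le_sup; last by exists (a, b).
exists B => _ [[c d] _ <-] /=; rewrite ge_min.
by have /andP[_ ->] := fB c.
Qed.

Lemma coline_refl x : coline u (x, refl u x).
Proof.
by rewrite /coline/= /refl opprB addrCA subrr addr0 dotvZl sphere_dotv// mulr1.
Qed.

Lemma steiner_gt x c : c < steiner u f x ->
  exists a b, [/\ coline u (a, b), reflmid u a b = x, c < f a & c < f b].
Proof.
move=> cx; have [|_ [[a b] /= [ab abx] <-]] := sup_gt _ cx.
  exists (Num.min (f x) (f (refl u x))), (x, refl u x) => //=.
  by split; [exact: coline_refl|exact: reflmidK].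
by rewrite lt_min => /andP[ca cb]; exists a, b.
Qed.

Lemma steiner_ge0 x : 0 <= steiner u f x.
Proof.
rewrite -[x in steiner _ _ x](reflmidK x su).
by apply: le_trans (steiner_ge (coline_refl x)); rewrite le_min !f0.
Qed.

Lemma steiner_le_tau alpha x : (alpha <= 0)%E -> steiner u f x <= tau alpha u f x.
Proof.
move=> al0; rewrite leNgt; apply/negP => /steiner_gt[a [b [_ abx ha hb]]].
have : tau alpha u f x < Num.min (f a) (f b) by rewrite lt_min ha.
apply/negP; rewrite -leNgt -abx; apply: le_trans (tau_ge su al0 a b fB).
exact: half_mean_ge_min.
Qed.

Lemma steiner_attained x t : 0 < t -> t <= steiner u f x ->
  exists a b, [/\ coline u (a, b), reflmid u a b = x, t <= f a & t <= f b].
Proof.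
move=> t0 tx.
pose C := [set p | coline u p] `&`
  (fun p : 'rV[R]_n * 'rV[R]_n => reflmid u p.1 p.2) @^-1` [set x].
have clC : closed C.
  apply: closedI; first exact: closed_coline.
  apply: preimage_closed; first by move=> p _; exact: reflmid_continuous.
  exact/accessible_closed_set1/hausdorff_accessible/norm_hausdorff.
have [|[a b] [/= [Cp abx] ta tb]] := pair_superlevel_attained uf vf clC t0.
  move=> c /andP[_ ct]; have [a [b [ab abx ca cb]]] := steiner_gt (lt_le_trans ct tx).
  by exists (a, b); split => //; exact: ltW.
by exists a, b.
Qed.

(** Since optimal pairs exist, the superlevel set is the continuous image of a compact set of
    pairs. *)
Lemma compact_superlevel_steiner c : 0 < c ->
  compact [set x | c <= steiner u f x].
Proof.
move=> c0.
pose K := [set p | coline u p] `&` ([set x | c <= f x] `*` [set x | c <= f x]).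
have cK : compact K.
  rewrite /K setIC; apply: compact_closedI; last exact: closed_coline.
  by apply: compact_setX; exact: compact_superlevel.
rewrite (_ : [set _ | _] = (fun p => reflmid u p.1 p.2) @` K).
  apply: continuous_compact => //; apply: continuous_subspaceT => p.
  exact: reflmid_continuous.
apply/seteqP; split => x /=.
  move=> /(steiner_attained c0)[a [b [ab abx ca cb]]].
  by exists (a, b).
move=> [[a b] [/= ab [/= ca cb]] <-]; apply: le_trans (steiner_ge ab).
by rewrite le_min ca.
Qed.

Lemma closed_superlevel_steiner c : closed [set x | c <= steiner u f x].
Proof.
have [c0|c0] := leP c 0; last first.
  by apply: compact_closed; [exact: norm_hausdorff|exact: compact_superlevel_steiner].
rewrite (_ : [set _ | _] = setT); first exact: closedT.
by apply/seteqP; split => // x _ /=; exact: le_trans (steiner_ge0 x).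
Qed.

Lemma measurable_steiner : measurable_fun setT (steiner u f).
Proof.
apply: measurable_upper_semicontinuous.
apply: upper_semicontinuous_superlevel => c; exact: closed_superlevel_steiner.
Qed.

End steiner.

Definition quasi_concave (R : realType) (n : nat) (f : 'rV[R]_n -> R) :=
  forall x y l c, 0 < c -> c <= f x -> c <= f y -> 0 <= l <= 1 ->
  c <= f (l *: x + (1 - l) *: y).

Lemma sphere0_false (R : realType) (u : 'rV[R]_0) : ~ sphere u.
Proof. by move=> /sphere_neq0/eqP; apply; apply/rowP => -[]. Qed.

(** Slice along the lines of direction [u]: the slice of the superlevel set of [f] is a bounded
    interval, and that of the Steiner symmetral contains its half differences. *)
Lemma measure_superlevel_steiner (R : realType) (n : nat) (u : 'rV[R]_n)
    (f : 'rV[R]_n -> R) (c : R) :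
  sphere u -> (forall x, 0 <= f x) -> upper_semicontinuous f ->
  vanishes_at_infinity f -> quasi_concave f -> 0 < c ->
  (lebesgue_rV R n [set x | c <= f x]%R <=
   lebesgue_rV R n [set x | c <= steiner u f x]%R)%E.
Proof.
case: n u f => [u f /sphere0_false//|n u f su f0 uf vf qf c0].
have [B fB'] := upper_semicontinuous_bounded uf vf.
have {fB'}fB x : 0 <= f x <= B by rewrite f0 fB'.
have [k [i [k0 mi iE]]] := ge0_integral_lines (sphere_neq0 su).
pose A (h : 'rV[R]_n.+1 -> R) := [set x | c <= h x].
have mA (h : 'rV[R]_n.+1 -> R) : measurable_fun setT h -> measurable (A h).
  move=> mh; rewrite -[X in measurable X]setTI.
  exact: (@measurable_fun_le _ _ _ _ (fun=> c) h).
pose L (h : 'rV[R]_n.+1 -> R) w : set (measurableTypeR R) :=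
  [set t | c <= h (t *: u + i w)].
have mG (h : 'rV[R]_n.+1 -> R) : measurable_fun setT h ->
    measurable_fun setT (fun p : measurableTypeR R * 'rV[R]_n =>
      h (p.1 *: u + i p.2)).
  by move=> mh; apply: measurableT_comp => //; exact: measurable_line.
have mL (h : 'rV[R]_n.+1 -> R) w : measurable_fun setT h -> measurable (L h w).
  move=> mh; rewrite -[X in measurable X]setTI.
  apply: (@measurable_fun_le _ _ _ _ (fun=> c)
    (fun t : measurableTypeR R => h (t *: u + i w) : R)) => //.
  apply: measurableT_comp => //; apply: measurable_rVD => //.
  exact: measurable_rVZ.
have mI (h : 'rV[R]_n.+1 -> R) : measurable_fun setT h -> measurable_fun setT
    (fun x : 'rV[R]_n.+1 => (\1_(A h) x)%:E : \bar R).
  by move=> mh; apply/measurable_EFinP/measurable_indic; exact: mA.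
have mF (h : 'rV[R]_n.+1 -> R) : measurable_fun setT h -> measurable_fun setT
    (fun w : 'rV[R]_n => lebesgue_measure (L h w)).
  move=> mh; pose H (p : measurableTypeR R * 'rV[R]_n) : \bar R :=
    (\1_(A h) (p.1 *: u + i p.2))%:E.
  have -> : (fun w => lebesgue_measure (L h w)) =
      (fun w => \int[lebesgue_measure]_t H (t, w))%E.
    apply/funext => w; rewrite -[L h w]setIT -integral_indic//; last exact: mL.
  apply: (@measurable_fun_fubini_tonelli_G _ _ _ _ R lebesgue_measure H) => [|p];
    last by rewrite lee_fin.
  by apply: (measurableT_comp (mI _ mh)); exact: measurable_line.
have E (h : 'rV[R]_n.+1 -> R) : measurable_fun setT h -> (lebesgue_rV R n.+1 (A h) =
    k%:E * \int[lebesgue_rV R n]_w lebesgue_measure (L h w))%E.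
  move=> mh; rewrite -[A h]setIT -integral_indic//; last exact: mA.
  etransitivity; first by apply: (iE _ (mI _ mh)) => x; rewrite lee_fin.
  apply: congr1; apply: eq_integral => w _.
  by rewrite -[L h w]setIT -integral_indic//; exact: mL.
have mf := measurable_upper_semicontinuous uf.
have mS := measurable_steiner su fB uf vf.
have -> : [set x | c <= f x] = A f by [].
have -> : [set x | c <= steiner u f x] = A (steiner u f) by [].
rewrite (E f mf) (E _ mS); apply: lee_pmul; rewrite ?lee_fin ?(ltW k0)//.
  exact: integral_ge0.
apply: ge0_le_integral => //; [exact: mF|exact: mF|move=> w _].
have uE t : dotv (t *: u) u = t by rewrite dotvZl sphere_dotv// mulr1.
(* The base point [i w] need not be orthogonal to [u], so the centre of symmetry of the line has
   parameter [- dotv (i w) u]. *)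
apply: (@lebesgue_half_difference _ _ _ (dotv (i w) u)); [exact: mL|exact: mL| | |].
- have [j uj] : exists j, u 0 j != 0.
    apply: contrapT => h; have /eqP := sphere_neq0 su; apply; apply/rowP => j.
    by rewrite mxE; apply/eqP/negPn/negP => uj; apply: h; exists j.
  have [M fM] := vf _ c0.
  exists ((M + `|i w 0 j|) / `|u 0 j|); split; first exact: num_real.
  move=> N MN t /= ct; apply: le_trans (ltW MN).
  rewrite ler_pdivlMr ?normr_gt0// -normrM.
  have xM : enorm (t *: u + i w) <= M.
    rewrite leNgt; apply/negP => /fM; apply/negP; rewrite -leNgt.
    exact: le_trans (ler_norm _).
  have := le_trans (coor_le_enorm (t *: u + i w) j) xM; rewrite !mxE => hM.
  rewrite -[t * u 0 j](addrK (i w 0 j)) (le_trans (ler_normB _ _))//.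
  by rewrite lerD.
- move=> p q s; rewrite /L/= => cp cq /andP[ps sq].
  have [pq|pq] := eqVneq p q.
    by have -> : s = p by apply/eqP; rewrite eq_le ps andbT pq.
  have pq' : p < q by rewrite lt_neqAle pq (le_trans ps).
  have qp0 : q - p != 0 by rewrite subr_eq0 eq_sym.
  pose l := (q - s) / (q - p).
  have -> : s *: u + i w = l *: (p *: u + i w) + (1 - l) *: (q *: u + i w).
    by apply/rowP => j; rewrite !mxE /l; field.
  apply: qf => //; rewrite /l divr_ge0 ?subr_ge0//=; last exact: ltW.
  by rewrite ler_pdivrMr ?subr_gt0// mul1r lerD2l lerN2.
move=> p q; rewrite /L/= => cp cq.
have pqE : coline u (p *: u + i w, q *: u + i w).
  rewrite /coline/= opprD addrACA subrr addr0 -scalerBl.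
  by rewrite uE.
have := steiner_ge fB pqE.
have -> : reflmid u (p *: u + i w) (q *: u + i w) =
    ((p - q) / 2 - dotv (i w) u) *: u + i w.
  by rewrite /reflmid refl_line//; apply/rowP => j; rewrite !mxE; field.
by apply: le_trans; rewrite le_min cp.
Qed.

Lemma le_total_mass_steiner (R : realType) (n : nat) (u : 'rV[R]_n)
    (f : 'rV[R]_n -> R) :
  sphere u -> (forall x, 0 <= f x) -> upper_semicontinuous f ->
  vanishes_at_infinity f -> quasi_concave f ->
  (total_mass f <= total_mass (steiner u f))%E.
Proof.
move=> su f0 uf vf qf; have [B fB'] := upper_semicontinuous_bounded uf vf.
have {fB'}fB x : 0 <= f x <= B by rewrite f0 fB'.
apply: le_integral_superlevel => //.
- exact: measurable_upper_semicontinuous.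
- exact: measurable_steiner fB uf vf.
- by move=> x; exact: steiner_ge0 fB x.
- by move=> t t0; exact: measure_superlevel_steiner.
Qed.

(* No measurability of [g] is required, the integral being a supremum over
   simple functions below the integrand. *)
Lemma ge0_le_integral_nomeas d (T : measurableType d) (R : realType)
    (mu : {measure set T -> \bar R}) (f g : T -> \bar R) :
  (forall x, 0 <= f x)%E -> (forall x, f x <= g x)%E ->
  (\int[mu]_x f x <= \int[mu]_x g x)%E.
Proof.
move=> f0 fg; rewrite !ge0_integralTE//; last by move=> x; exact: le_trans (fg x).
by apply: ereal_sup_le => _ [h hf <-]; exists h => // x; exact: le_trans (fg x).
Qed.

Lemma le_total_mass_tau (R : realType) (n : nat) (alpha : \bar R) (u : 'rV[R]_n)
    (f : 'rV[R]_n -> R) : (alpha <= 0)%E ->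
  sphere u -> (forall x, 0 <= f x) -> upper_semicontinuous f ->
  vanishes_at_infinity f -> quasi_concave f ->
  (total_mass f <= total_mass (tau alpha u f))%E.
Proof.
move=> al0 su f0 uf vf qf; apply: le_trans (le_total_mass_steiner su f0 uf vf qf) _.
have [B fB'] := upper_semicontinuous_bounded uf vf.
have fB x : 0 <= f x <= B by rewrite f0 fB'.
apply: ge0_le_integral_nomeas => x; rewrite lee_fin; first exact: steiner_ge0 fB x.
exact: steiner_le_tau fB _ _ al0.
Qed.

(** * Gaussian and exponential integrals *)

(** The Radon-Nikodym derivative has the same integral as [phi] over every measurable set, so the
    two agree almost everywhere and the change of variables for the derivative carries over to
    [phi]. *)
Lemma ge0_integral_density d (T : measurableType d) (R : realType)
    (nu : {finite_measure set T -> \bar R}) (mu : {sigma_finite_measure set T -> \bar R})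
    (phi : T -> R) (F : T -> \bar R) :
  nu `<< mu -> measurable_fun setT phi ->
  (forall A, measurable A -> nu A = \int[mu]_(x in A) (phi x)%:E)%E ->
  (forall x, 0 <= phi x) -> measurable_fun setT F -> (forall x, 0 <= F x)%E ->
  (\int[nu]_x F x = \int[mu]_x (F x * (phi x)%:E))%E.
Proof.
move=> numu mphi nuE phi0 mF F0.
pose g := Radon_Nikodym_SigmaFinite.f nu mu.
have ig := Radon_Nikodym_SigmaFinite.f_integrable numu.
have g0 x : (0 <= g x)%E by exact: Radon_Nikodym_SigmaFinite.f_ge0.
rewrite -(Radon_Nikodym_SigmaFinite.change_of_variables numu)//.
apply: ge0_ae_eq_integral => //.
- by apply: emeasurable_funM => //; exact: measurable_int ig.
- by apply: emeasurable_funM => //; exact/measurable_EFinP.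
- by move=> x _; rewrite mule_ge0// g0.
- by move=> x _; rewrite mule_ge0// lee_fin.
apply: ae_eqe_mul2l; apply: integral_ae_eq => //; first exact/measurable_EFinP.
by move=> A _ mA; rewrite -nuE// -Radon_Nikodym_SigmaFinite.f_integral.
Qed.

Lemma ge0_integral_normal (R : realType) (F : measurableTypeR R -> \bar R) :
  measurable_fun setT F -> (forall x, 0 <= F x)%E ->
  (\int[normal_prob 0 1]_x F x =
   \int[lebesgue_measure]_x (F x * (normal_pdf 0 1 x)%:E))%E.
Proof.
move=> mF F0.
apply: (@ge0_integral_density _ _ _ (normal_prob 0 1) lebesgue_measure (normal_pdf 0 1)) => //.
- exact: normal_prob_dominates.
- exact: measurable_normal_pdf.
- by move=> x; exact: normal_pdf_ge0.
Qed.

Lemma measurable_prod_coor (R : realType) (n : nat) (phi : measurableTypeR R -> R) :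
  measurable_fun setT phi ->
  measurable_fun setT (fun x : 'rV[R]_n => \prod_(i < n) phi (x 0 i) : R).
Proof.
move=> mphi; apply: measurable_prod => i _.
by apply: (measurableT_comp mphi); exact: measurable_coor.
Qed.

Lemma prod_coor_cons (R : realType) (n : nat) (phi : R -> R) a (v : 'rV[R]_n) :
  \prod_(i < n.+1) phi (rV_cons (a, v) 0 i) = phi a * \prod_(i < n) phi (v 0 i).
Proof.
rewrite big_ord_recl mxE unlift_none; congr (_ * _).
by apply: eq_bigr => i _; rewrite mxE liftK.
Qed.

Lemma ge0_integral_gaussian (R : realType) (n : nat) (F : 'rV[R]_n -> \bar R) :
  measurable_fun setT F -> (forall x, 0 <= F x)%E ->
  (\int[gaussian_rV R n]_x F x =
   \int[lebesgue_rV R n]_x (F x * (\prod_(i < n) normal_pdf 0 1 (x 0 i))%:E))%E.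
Proof.
have pdf0 x := normal_pdf_ge0 (0 : R) 1 x.
have mpdf := measurable_normal_pdf (0 : R) 1.
elim: n F => [|n IH] F mF F0.
  by apply: eq_integral => x _; rewrite big_ord0 mule1.
have mFp : measurable_fun setT
    (fun x : 'rV[R]_n.+1 => F x * (\prod_(i < n.+1) normal_pdf 0 1 (x 0 i))%:E)%E.
  by apply: emeasurable_funM => //; apply/measurable_EFinP; exact: measurable_prod_coor.
have P0 m (x : 'rV[R]_m) : 0 <= \prod_(i < m) normal_pdf 0 1 (x 0 i).
  exact: prodr_ge0.
rewrite /gaussian_rV (ge0_integral_prod_measureS _ mF F0).
rewrite /lebesgue_rV (ge0_integral_prod_measureS _ mFp); last first.
  by move=> x; rewrite mule_ge0// lee_fin.
have mFc : measurable_fun setT (F \o @rV_cons R n).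
  by apply: measurableT_comp => //; exact: measurable_rV_cons.
have Fc0 p : (0 <= (F \o @rV_cons R n) p)%E by exact: F0.
etransitivity.
  apply: ge0_integral_normal; last by move=> a; exact: integral_ge0.
  exact: (measurable_fun_fubini_tonelli_F (m2 := prod_measure (normal_prob 0 1) n) _ mFc Fc0).
apply: eq_integral => a _.
have mFa : measurable_fun setT (fun v => F (rV_cons (a, v))).
  by apply: measurableT_comp => //; exact: measurable_rV_cons2.
have /= -> := IH _ mFa (fun v => F0 _).
rewrite muleC -ge0_integralZl_EFin//=.
- by apply: eq_integral => v _; rewrite prod_coor_cons EFinM muleCA.
- by move=> v _; apply: mule_ge0; [exact: F0|rewrite lee_fin; exact: P0].
- by apply: emeasurable_funM => //; apply/measurable_EFinP; exact: measurable_prod_coor.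
Qed.

Lemma integral_prod_coor_lty (R : realType) (n : nat) (phi : measurableTypeR R -> R) :
  measurable_fun setT phi -> (forall x, 0 <= phi x) ->
  (\int[lebesgue_measure]_x (phi x)%:E < +oo)%E ->
  (\int[lebesgue_rV R n]_x (\prod_(i < n) phi (x 0 i))%:E < +oo)%E.
Proof.
move=> mphi phi0 phioo.
have P0 m (x : 'rV[R]_m) : 0 <= \prod_(i < m) phi (x 0 i) by exact: prodr_ge0.
have mP m : measurable_fun setT (fun x : 'rV[R]_m => (\prod_(i < m) phi (x 0 i))%:E).
  by apply/measurable_EFinP; exact: measurable_prod_coor.
elim: n => [|n IH].
  rewrite [X in (X < _)%E]integral_dirac//=; last exact: (mP 0%N).
  by rewrite big_ord0 diracT mul1e ltry.
rewrite /lebesgue_rV (ge0_integral_prod_measureS _ (mP n.+1)); last first.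
  by move=> x; rewrite lee_fin; exact: P0.
rewrite (eq_integral (fun a => (\int[prod_measure lebesgue_measure n]_x
    (\prod_(i < n) phi (x 0 i))%:E) * (phi a)%:E)%E); last first.
  move=> a _; rewrite muleC -ge0_integralZl_EFin//=.
  - by apply: eq_integral => v _; rewrite prod_coor_cons EFinM.
  - by move=> x _; rewrite lee_fin; exact: P0.
  - exact: mP.
have I0 : (0 <= \int[prod_measure lebesgue_measure n]_x
    (\prod_(i < n) phi (x 0 i))%:E)%E.
  by apply: integral_ge0 => x _; rewrite lee_fin; exact: P0.
rewrite ge0_integralZl//; last 2 first.
- exact/measurable_EFinP.
- by move=> x _; rewrite lee_fin.
by rewrite lte_mul_pinfty// ge0_fin_numE.
Qed.

Lemma integral_expN_abs_lty (R : realType) :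
  (\int[@lebesgue_measure R]_x (expR (- `|x|))%:E < +oo)%E.
Proof.
have mp := measurable_exponential_pdf (1 : R).
have p0 x : 0 <= exponential_pdf (1 : R) x by exact: exponential_pdf_ge0.
have mpN : measurable_fun setT (fun x : measurableTypeR R => exponential_pdf (1 : R) (- x)).
  by apply: (measurableT_comp mp).
have Ip : (\int[@lebesgue_measure R]_x (exponential_pdf 1 x)%:E = 1)%E.
  exact: integral_exponential_pdf.
have N10 : (-1 : R) != 0 by rewrite oppr_eq0 oner_eq0.
have IpN : (\int[@lebesgue_measure R]_x (exponential_pdf 1 (- x)%R)%:E = 1)%E.
  rewrite -Ip; have /= -> := ge0_integral_affine 0 N10
    (F := fun x => (exponential_pdf 1 x)%:E) _ _.
  - by rewrite normrN1 mul1e; apply: eq_integral => x _; rewrite mulN1r addr0.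
  - exact/measurable_EFinP.
  - by move=> x; rewrite lee_fin.
(* The integrand is dominated by the exponential density plus its mirror image, each of integral
   1. *)
apply: (@le_lt_trans _ _ (\int[lebesgue_measure]_x
    ((exponential_pdf 1 x)%:E + (exponential_pdf 1 (- x)%R)%:E))%E).
  apply: ge0_le_integral_nomeas => x; first by rewrite lee_fin expR_ge0.
  have pE (y : R) : 0 <= y -> exponential_pdf 1 y = expR (- y).
    by move=> y0; rewrite exponential_pdfE// mul1r mulN1r.
  rewrite -EFinD lee_fin; have [x0|x0] := leP 0 x.
    by rewrite (pE _ x0) ger0_norm// lerDl.
  have Nx0 : 0 <= - x by rewrite oppr_ge0 ltW.
  by rewrite (pE _ Nx0) ltr0_norm// lerDr.
rewrite ge0_integralD//; last 4 first.
- by move=> x _; rewrite lee_fin.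
- exact/measurable_EFinP.
- by move=> x _; rewrite lee_fin.
- exact/measurable_EFinP.
by rewrite Ip IpN -EFinD ltry.
Qed.

(** The common integrable majorant for the indicator of the unit ball, the first Gaussian moment
    and, up to an affine change of variables, log-concave functions. *)
Lemma integral_exp_coor_lty (R : realType) (n : nat) :
  (\int[lebesgue_rV R n]_x (\prod_(i < n) expR (- `|x 0 i|))%:E < +oo)%E.
Proof.
apply: (@integral_prod_coor_lty R n (fun t => expR (- `|t|))).
- by apply: measurableT_comp => //; apply: measurableT_comp.
- by move=> x; exact: expR_ge0.
- exact: integral_expN_abs_lty.
Qed.

Lemma lebesgue_unit_ball_lty (R : realType) (n : nat) :
  (lebesgue_rV R n (@unit_ball R n) < +oo)%E.
Proof.
have mB := @measurable_unit_ball R n.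
have mP : measurable_fun setT
    (fun x : 'rV[R]_n => (\prod_(i < n) expR (- `|x 0 i|))%:E).
  apply/measurable_EFinP.
  apply: (@measurable_prod_coor R n (fun t => expR (- `|t|))).
  by apply: measurableT_comp => //; apply: measurableT_comp.
rewrite -[@unit_ball R n]setIT -integral_indic//.
(* On the unit ball every coordinate is at most 1 in absolute value, so one factor [expR 1] per
   coordinate lifts the product above 1. *)
apply: (@le_lt_trans _ _ (\int[lebesgue_rV R n]_x
    ((expR 1 ^+ n)%:E * (\prod_(i < n) expR (- `|x 0 i|))%:E))%E).
  apply: ge0_le_integral_nomeas => x; first by rewrite lee_fin.
  rewrite -EFinM lee_fin indicE; have [|_] := boolP (x \in _); last first.
    by rewrite mulr_ge0 ?exprn_ge0 ?expR_ge0//; apply: prodr_ge0 => i _; exact: expR_ge0.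
  rewrite inE => xB.
  rewrite -[expR 1 ^+ n](_ : \prod_(i < n) expR 1 = _); last first.
    by rewrite prodr_const card_ord.
  rewrite -big_split/= -[leLHS](_ : \prod_(i < n) 1 = _); last by rewrite big1.
  apply: ler_prod => i _; rewrite ler01/= -expRD -[leLHS]expR0 ler_expR subr_ge0.
  exact: le_trans (coor_le_enorm x i) xB.
have e0 : 0 <= expR 1 ^+ n :> R by rewrite exprn_ge0 ?expR_ge0.
rewrite ge0_integralZl_EFin//; last first.
  by move=> x _; rewrite lee_fin; apply: prodr_ge0 => i _; exact: expR_ge0.
by rewrite lte_mul_pinfty// ?lee_fin ?exprn_ge0 ?expR_ge0//; exact: integral_exp_coor_lty.
Qed.

(** * Mean width *)

Section half_sums.
Context (R : realType).
Local Notation half := (2^-1 : R).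

Lemma adde_half (x : \bar R) : (half%:E * x + half%:E * x = x)%E.
Proof.
rewrite -ge0_muleDl ?lee_fin ?invr_ge0// -EFinD (_ : half + half = 1) ?mul1e//.
by field.
Qed.

Lemma mule_halfy : (half%:E * +oo = +oo :> \bar R)%E.
Proof. by rewrite gt0_muley// lte_fin invr_gt0. Qed.

(** The equality of the average with the average of positive parts minus that of negative parts,
    rearranged without subtraction so that it remains true at infinite values. *)
Lemma half_sum_posneg (a b : \bar R) : (-oo < a)%E -> (-oo < b)%E ->
  (maxe (half%:E * a + half%:E * b) 0 +
     (half%:E * maxe (- a) 0 + half%:E * maxe (- b) 0) =
   maxe (- (half%:E * a + half%:E * b)) 0 +
     (half%:E * maxe a 0 + half%:E * maxe b 0))%E.
Proof.
have half_oo := mule_halfy.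
case: a => [a||//] _; case: b => [b||//] _.
- rewrite -!EFinM -!EFinD -!EFinN -!EFin_max -!EFinM -!EFinD; congr EFin.
  by rewrite !maxEle; do !case: ifP => ?; lra.
- rewrite half_oo -EFinM addey// !maxye /= maxNye mule0 adde0 add0e.
  by rewrite -!EFin_max -!EFinM addye// addey.
- rewrite half_oo -EFinM [(+oo + (_ * b)%:E)%E]addye// !maxye /= maxNye mule0 !add0e.
  by rewrite -!EFin_max -!EFinM !addye.
- rewrite half_oo [(+oo + +oo)%E]addye// !maxye /= maxNye mule0 !adde0 !add0e.
  by rewrite ?addye.
Qed.

(** Convexity of the positive part; together with its counterpart for the negative part it keeps
    finite integrals finite under averaging. *)
Lemma le_half_sum_pos (a b : \bar R) : (-oo < a)%E -> (-oo < b)%E ->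
  (maxe (half%:E * a + half%:E * b) 0 <=
   half%:E * maxe a 0 + half%:E * maxe b 0)%E.
Proof.
move=> a0 b0; rewrite ge_max; apply/andP; split.
  by apply: leeD; apply: lee_wpmul2l; rewrite ?lee_fin ?invr_ge0// le_max lexx.
by rewrite adde_ge0// mule_ge0 ?lee_fin ?invr_ge0// le_max lexx orbT.
Qed.

Lemma le_half_sum_neg (a b : \bar R) : (-oo < a)%E -> (-oo < b)%E ->
  (maxe (- (half%:E * a + half%:E * b)) 0 <=
   half%:E * maxe (- a) 0 + half%:E * maxe (- b) 0)%E.
Proof.
move=> a0 b0.
have h : (- (half%:E * a + half%:E * b) <= half%:E * (- a) + half%:E * (- b))%E.
  case: a a0 => [a||//] _; case: b b0 => [b||//] _.
  - by rewrite -!EFinM -!EFinD -EFinN lee_fin; lra.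
  - by rewrite mule_halfy -EFinM addey// leNye.
  - by rewrite mule_halfy -EFinM addye// leNye.
  - by rewrite mule_halfy addye// leNye.
rewrite ge_max; apply/andP; split.
  apply: le_trans h _.
  by apply: leeD; apply: lee_wpmul2l; rewrite ?lee_fin ?invr_ge0// le_max lexx.
by rewrite adde_ge0// mule_ge0 ?lee_fin ?invr_ge0// le_max lexx orbT.
Qed.

(** The two variables range independently. If the joint supremum is finite, fixing one variable
    bounds the supremum over the other, so no infinite value can occur on the right. *)
Lemma ereal_sup_half (T : Type) (X : set T) (phi psi : T -> R) : X !=set0 ->
  ereal_sup [set (half * phi p.1 + half * psi p.2)%:E | p in X `*` X] =
  (half%:E * ereal_sup [set (phi a)%:E | a in X] +
   half%:E * ereal_sup [set (psi a)%:E | a in X])%E.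
Proof.
move=> [x0 Xx0]; set A := ereal_sup [set (phi a)%:E | a in X].
set B := ereal_sup [set (psi a)%:E | a in X].
have hA a : X a -> ((phi a)%:E <= A)%E by move=> Xa; apply: ereal_sup_ubound; exists a.
have hB a : X a -> ((psi a)%:E <= B)%E by move=> Xa; apply: ereal_sup_ubound; exists a.
have half0 : (0 <= half%:E)%E by rewrite lee_fin invr_ge0.
apply/eqP; rewrite eq_le; apply/andP; split.
  apply: ge_ereal_sup => _ [[a b] [/= Xa Xb] <-]; rewrite EFinD !EFinM.
  by apply: leeD; apply: lee_wpmul2l => //; [exact: hA|exact: hB].
set C := ereal_sup _.
have hC a b : X a -> X b -> ((half * phi a + half * psi b)%:E <= C)%E.
  by move=> Xa Xb; apply: ereal_sup_ubound; exists (a, b).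
case: C hC => [c| |] hC; [|by rewrite leey|by have := hC _ _ Xx0 Xx0].
have Bc a : X a -> (B <= (2 * c - phi a)%:E)%E.
  move=> Xa; apply: ge_ereal_sup => _ [b Xb <-].
  by have := hC _ _ Xa Xb; rewrite !lee_fin; lra.
case: B hB Bc => [b| |] hB Bc; [|by have := Bc _ Xx0|by have := hB _ Xx0].
have Ac : (A <= (2 * c - b)%:E)%E.
  by apply: ge_ereal_sup => _ [a Xa <-]; have := Bc _ Xa; rewrite !lee_fin; lra.
case: A hA Ac => [a| |] hA Ac //; last by have := hA _ Xx0.
by move: Ac; rewrite -!EFinM -EFinD !lee_fin; lra.
Qed.

End half_sums.

(** By invariance, averaging over [rho] preserves the integrals of [h^\+] and [h^\-]. The parts of
    [hs] have integrals at most as large, and the four integrals satisfy an additive relation; as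
    those of [h] are not both infinite, it can be solved for the difference. *)
Lemma integral_half_sum_invariant d (T : measurableType d) (R : realType)
    (mu : {measure set T -> \bar R}) (rho : T -> T) (h : T -> \bar R) :
  measurable_fun setT rho ->
  (forall F : T -> \bar R, measurable_fun setT F -> (forall x, 0 <= F x)%E ->
     \int[mu]_x F (rho x) = \int[mu]_x F x)%E ->
  measurable_fun setT h -> (forall x, -oo < h x)%E ->
  (\int[mu]_x h^\+ x +? - \int[mu]_x h^\- x)%E ->
  let hs := fun x => (2^-1%:E * h x + 2^-1%:E * h (rho x))%E in
  (\int[mu]_x hs^\+ x +? - \int[mu]_x hs^\- x)%E /\
  (\int[mu]_x hs x = \int[mu]_x h x)%E.
Proof.
move=> mrho inv mh h_gtNy.
have mhp : measurable_fun setT (h^\+)%E by exact: measurable_funepos.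
have mhn : measurable_fun setT (h^\-)%E by exact: measurable_funeneg.
have half0 : 0 <= 2^-1 :> R by rewrite invr_ge0.
move=> dh hs.
have mhr : measurable_fun setT (h \o rho) by exact: measurableT_comp.
have mhs : measurable_fun setT hs.
  by apply: emeasurable_funD; exact: measurable_funeM.
have mhsp : measurable_fun setT (hs^\+)%E by exact: measurable_funepos.
have mhsn : measurable_fun setT (hs^\-)%E by exact: measurable_funeneg.
have avg (F : T -> \bar R) : measurable_fun setT F -> (forall x, 0 <= F x)%E ->
    [/\ measurable_fun setT (fun x => 2^-1%:E * F x + 2^-1%:E * F (rho x))%E,
       (forall x, 0 <= 2^-1%:E * F x + 2^-1%:E * F (rho x))%E &
       \int[mu]_x (2^-1%:E * F x + 2^-1%:E * F (rho x)) = \int[mu]_x F x]%E.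
  move=> mF F0.
  have mFr : measurable_fun setT (fun x => F (rho x)) by exact: measurableT_comp.
  split.
  - by apply: emeasurable_funD; exact: measurable_funeM.
  - by move=> x; rewrite adde_ge0// mule_ge0.
  rewrite ge0_integralD//; last 4 first.
  - by move=> x _; rewrite mule_ge0.
  - exact: measurable_funeM.
  - by move=> x _; rewrite mule_ge0.
  - exact: measurable_funeM.
  rewrite !ge0_integralZl_EFin// inv//.
  exact: adde_half.
have [mP P0 PE] := avg _ mhp (fun x => funepos_ge0 h x).
have [mM M0 ME] := avg _ mhn (fun x => funeneg_ge0 h x).
have leP : (\int[mu]_x hs^\+ x <= \int[mu]_x h^\+ x)%E.
  rewrite -PE; apply: ge0_le_integral_nomeas => x; first exact: funepos_ge0.
  rewrite !funeposE; exact: (le_half_sum_pos (h_gtNy x) (h_gtNy (rho x))).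
have leM : (\int[mu]_x hs^\- x <= \int[mu]_x h^\- x)%E.
  rewrite -ME; apply: ge0_le_integral_nomeas => x; first exact: funeneg_ge0.
  rewrite !funenegE; exact: (le_half_sum_neg (h_gtNy x) (h_gtNy (rho x))).
have sum : (\int[mu]_x hs^\+ x + \int[mu]_x h^\- x =
            \int[mu]_x hs^\- x + \int[mu]_x h^\+ x)%E.
  rewrite -PE -ME -!ge0_integralD//.
  apply: eq_integral => x _; rewrite !funeposE !funenegE.
  exact: (half_sum_posneg (h_gtNy x) (h_gtNy (rho x))).
have hsP0 : (0 <= \int[mu]_x hs^\+ x)%E by apply: integral_ge0 => x _; exact: funepos_ge0.
have hsM0 : (0 <= \int[mu]_x hs^\- x)%E by apply: integral_ge0 => x _; exact: funeneg_ge0.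
have hP0 : (0 <= \int[mu]_x h^\+ x)%E by apply: integral_ge0 => x _; exact: funepos_ge0.
have hM0 : (0 <= \int[mu]_x h^\- x)%E by apply: integral_ge0 => x _; exact: funeneg_ge0.
rewrite [X in _ /\ X = _]integralE [X in _ /\ _ = X]integralE.
move: dh leP leM sum hsP0 hsM0 hP0 hM0.
move: (\int[mu]_x hs^\+ x)%E (\int[mu]_x hs^\- x)%E.
move: (\int[mu]_x h^\+ x)%E (\int[mu]_x h^\- x)%E.
move=> [p||] [m||] [p'||] [m'||]//= _; rewrite ?lee_fin => pp' mm' + _ _ _ _ //.
by rewrite -!EFinD => -[sum]; split=> //; congr EFin; lra.
Qed.

(** * Support functions of the symmetral *)

Section legendre_tau.
Context (R : realType) (n : nat).
Implicit Types (f : 'rV[R]_n -> R) (u x a b : 'rV[R]_n) (r : R).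

Lemma supp_funE r f x : (forall y, 0 <= f y) -> (exists y, f y != 0) ->
  supp_fun r f x =
  ereal_sup [set (dotv x a + boxcox r (f a))%:E | a in [set a | 0 < f a]].
Proof.
move=> f0 [y0 fy0]; apply/eqP; rewrite eq_le; apply/andP; split.
  apply: ge_ereal_sup => _ [y _ <-]; rewrite /base.
  have [fy|fy] := eqVneq (f y) 0; first by rewrite leNye.
  apply: ereal_sup_ubound; exists y; first by rewrite /= lt_neqAle eq_sym fy f0.
  rewrite /boxcox; case: ifPn => r0; rewrite -EFinB; congr EFin.
    by rewrite opprK.
  by field.
apply: ge_ereal_sup => _ [y /= fy <-]; apply: ereal_sup_ubound; exists y => //.
rewrite /base gt_eqF// /boxcox; case: ifPn => r0; rewrite -EFinB; congr EFin.
  by rewrite opprK.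
by field.
Qed.

Lemma supp_fun_gtNy r f x : (forall y, 0 <= f y) -> (exists y, f y != 0) ->
  (-oo < supp_fun r f x)%E.
Proof.
move=> f0 f_neq0; have [y0 fy0] := f_neq0.
rewrite supp_funE//; apply: (@lt_le_trans _ _ (dotv x y0 + boxcox r (f y0))%:E).
  exact: ltNyr.
by apply: ereal_sup_ubound; exists y0 => //=; rewrite lt_neqAle eq_sym fy0 f0.
Qed.

Lemma supp_fun_tau r u f B x : sphere u -> r <= 0 ->
  (forall y, 0 <= f y <= B) -> (exists y, f y != 0) ->
  supp_fun r (tau r%:E u f) x =
  (2^-1%:E * supp_fun r f x + 2^-1%:E * supp_fun r f (refl u x))%E.
Proof.
move=> su r0 fB [y0 fy0].
have al0 : (r%:E <= 0)%E by rewrite lee_fin.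
have f0 y : 0 <= f y by have /andP[] := fB y.
have y0_gt0 : 0 < f y0 by rewrite lt_neqAle eq_sym fy0 f0.
have t0 y : 0 <= tau r%:E u f y by have /andP[] := tau_bounded su al0 fB y.
have tE : exists y, tau r%:E u f y != 0.
  exists (reflmid u y0 y0); rewrite gt_eqF//.
  apply: lt_le_trans (tau_ge su al0 y0 y0 fB); exact: half_mean_gt0.
rewrite !supp_funE//; last by exists y0. 2: by exists y0.
set X := [set a | 0 < f a].
have dE a b : dotv x (reflmid u a b) = 2^-1 * dotv x a + 2^-1 * dotv (refl u x) b.
  by rewrite /reflmid dotvDr !dotvZr refl_adj.
have X0 : X !=set0 by exists y0.
rewrite -(ereal_sup_half (fun a => dotv x a + boxcox r (f a))
  (fun b => dotv (refl u x) b + boxcox r (f b)) X0).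
apply/eqP; rewrite eq_le; apply/andP; split; last first.
  apply: ge_ereal_sup => _ [[a b] [/= fa fb] <-].
  have h0 := half_mean_gt0 r fa fb.
  have hle := tau_ge su al0 a b fB.
  apply: (@le_trans _ _ (dotv x (reflmid u a b) +
      boxcox r (tau r%:E u f (reflmid u a b)))%:E); last first.
    by apply: ereal_sup_ubound; exists (reflmid u a b) => //=; exact: lt_le_trans hle.
  have : boxcox r (half_mean r%:E (f a) (f b)) <=
      boxcox r (tau r%:E u f (reflmid u a b)).
    by rewrite (le_boxcox r0 h0)//; exact: lt_le_trans hle.
  rewrite (boxcox_half_mean r fa fb) lee_fin dE.
  by move: (boxcox r (tau _ _ _ _)) => N hN; lra.
(* The value of the symmetral at [y] is only approached by pairs, at a cost [e] in the transform. *)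
apply: ge_ereal_sup => _ [y /= ty <-]; apply/lee_addgt0Pr => e e0.
have [c /andP[c0 cy] Nc] := boxcox_left_cont r0 ty e0.
have [a [b [ab cab]]] := tau_gt su cy.
have [fa fb] := half_mean_gt0_imp al0 (f0 a) (f0 b) (lt_trans c0 cab).
have h0 := half_mean_gt0 r fa fb.
have Nab : boxcox r c <= boxcox r (half_mean r%:E (f a) (f b)).
  by rewrite (le_boxcox r0 c0 h0) ltW.
apply: (@le_trans _ _ ((2^-1 * (dotv x a + boxcox r (f a)) +
    2^-1 * (dotv (refl u x) b + boxcox r (f b)))%:E + e%:E)%E); last first.
  by apply: leeD => //; apply: ereal_sup_ubound; exists (a, b).
subst y; rewrite -EFinD lee_fin dE.
move: Nab Nc; rewrite (boxcox_half_mean r fa fb).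
by move: (boxcox r (tau _ _ _ _)) (boxcox r c) => N M hM hN; lra.
Qed.

End legendre_tau.

(** The Gaussian density depends on [x] only through [dotv x x], which the reflection preserves;
    invariance of the Gaussian measure then follows from that of Lebesgue measure. *)
Lemma prod_normal_pdf (R : realType) (n : nat) (x : 'rV[R]_n) :
  \prod_(i < n) normal_pdf 0 1 (x 0 i) = normal_peak 1 ^+ n * expR (- dotv x x / 2).
Proof.
transitivity (\prod_(i < n) (normal_peak 1 * expR (- (x 0 i * x 0 i) / 2))).
  apply: eq_bigr => i _; rewrite normal_pdfE ?oner_neq0//; congr (_ * expR _).
  by rewrite subr0 expr1n -expr2; congr (_ / _).
rewrite big_split/= prodr_const card_ord; congr (_ * _).
by rewrite -expR_sum -mulr_suml sumrN.
Qed.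

Lemma ge0_integral_gaussian_refl (R : realType) (n : nat) (u : 'rV[R]_n)
    (F : 'rV[R]_n -> \bar R) : sphere u ->
  measurable_fun setT F -> (forall x, 0 <= F x)%E ->
  (\int[gaussian_rV R n]_x F (refl u x) = \int[gaussian_rV R n]_x F x)%E.
Proof.
move=> su mF F0.
have mFr : measurable_fun setT (fun x => F (refl u x)).
  by apply: measurableT_comp => //; exact: measurable_refl.
rewrite (ge0_integral_gaussian mFr)// (ge0_integral_gaussian mF)//.
pose G x := (F x * (\prod_(i < n) normal_pdf 0 1 (x 0 i))%:E)%E.
transitivity (\int[lebesgue_rV R n]_x G (refl u x))%E.
  by apply: eq_integral => x _; rewrite /G !prod_normal_pdf dotv_refl.
apply: ge0_integral_refl => //.
  apply: emeasurable_funM => //; apply/measurable_EFinP.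
  apply: measurable_prod_coor; exact: measurable_normal_pdf.
move=> x; apply: mule_ge0 => //; rewrite lee_fin.
by apply: prodr_ge0 => i _; exact: normal_pdf_ge0.
Qed.

(** A support function is bounded below by an affine function, so this controls its negative
    part. *)
Lemma integral_gaussian_norm1_lty (R : realType) (n : nat) :
  (\int[gaussian_rV R n]_x (1 + \sum_(i < n) `|x 0 i|)%:E < +oo)%E.
Proof.
have s0 (x : 'rV[R]_n) : 0 <= 1 + \sum_(i < n) `|x 0 i|.
  by rewrite addr_ge0// sumr_ge0.
have ms : measurable_fun setT (fun x : 'rV[R]_n => (1 + \sum_(i < n) `|x 0 i|)%:E).
  apply/measurable_EFinP; apply: measurable_funD => //.
  apply: measurable_sum => i.
  by apply: measurableT_comp => //; exact: measurable_coor.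
rewrite (ge0_integral_gaussian ms); last by move=> x; rewrite lee_fin.
have p0 : 0 <= normal_peak 1 ^+ n * expR 2 ^+ n :> R.
  by rewrite mulr_ge0 ?exprn_ge0 ?expR_ge0 ?normal_peak_ge0.
apply: (@le_lt_trans _ _ (\int[lebesgue_rV R n]_x
   ((normal_peak 1 ^+ n * expR 2 ^+ n)%:E * (\prod_(i < n) expR (- `|x 0 i|))%:E))%E).
  apply: ge0_le_integral_nomeas => x.
    apply: mule_ge0; rewrite lee_fin//.
    by apply: prodr_ge0 => i _; exact: normal_pdf_ge0.
  rewrite -!EFinM lee_fin prod_normal_pdf mulrCA -mulrA.
  rewrite ler_wpM2l ?exprn_ge0 ?normal_peak_ge0//.
  apply: (@le_trans _ _ (expR (\sum_(i < n) `|x 0 i|) * expR (- dotv x x / 2))).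
    by rewrite ler_wpM2r ?expR_ge0// expR_ge1Dx.
  rewrite -expRD -expR_sum.
  have -> : expR 2 ^+ n = expR (\sum_(i < n) 2) :> R.
    by rewrite expR_sum prodr_const card_ord.
  rewrite -expRD ler_expR /dotv -sumrN mulr_suml -!big_split/=.
  apply: ler_sum => i _; rewrite -expr2 -real_normK ?num_real//.
  (* With [t] the absolute value of a coordinate, [t - t^2 / 2 <= 2 - t] amounts to
     [(t - 2)^2 >= 0]; this is the origin of the factor [expR 2]. *)
  have := sqr_ge0 (`|x 0 i| - 2).
  by move: (`|x 0 i|) => t; lra.
rewrite ge0_integralZl_EFin//; last 2 first.
- by move=> x _; rewrite lee_fin; apply: prodr_ge0 => i _; exact: expR_ge0.
- apply/measurable_EFinP; apply: (@measurable_prod_coor R n (fun t => expR (- `|t|))).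
  by apply: measurableT_comp => //; apply: measurableT_comp.
by rewrite lte_mul_pinfty ?lee_fin//; exact: integral_exp_coor_lty.
Qed.

Lemma dotv_norm_le (R : realType) (n : nat) (x y : 'rV[R]_n) (C : R) :
  (forall i, `|x 0 i| <= C) -> `|dotv x y| <= C * \sum_(i < n) `|y 0 i|.
Proof.
move=> xC; apply: le_trans (ler_norm_sum _ _ _) _; rewrite mulr_sumr.
by apply: ler_sum => i _; rewrite normrM ler_wpM2r.
Qed.

Section mean_width_tau.
Context (R : realType) (n : nat) (u : 'rV[R]_n) (f : 'rV[R]_n -> R) (B : R).
Hypotheses (su : sphere u) (fB : forall x, 0 <= f x <= B).
Hypothesis f_neq0 : exists x, f x != 0.

Let f0 x : 0 <= f x. Proof. by have /andP[] := fB x. Qed.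

Lemma measurable_supp_fun r : measurable_fun setT (supp_fun r f).
Proof.
by apply: lower_semicontinuous_measurable_rV; exact: lower_semicontinuous_legendre.
Qed.

Lemma mean_width_tau_fin r : r < 0 -> mean_width_defined r%:E f ->
  mean_width_defined r%:E (tau r%:E u f) /\
  mean_width r%:E (tau r%:E u f) = mean_width r%:E f.
Proof.
move=> r0; rewrite /mean_width_defined /mean_width (lt_eqF r0) => df.
pose W (x : 'rV[R]_n) : R := (1 - r * enorm x ^+ 2 / 2) `^ ((1 - r) / r).
have mW : measurable_fun setT W.
  have mX : measurable_fun setT (fun x : 'rV[R]_n => 1 - r * enorm x ^+ 2 / 2 : R).
    apply: measurable_funB => //; apply: measurable_funM => //.
    by apply: measurable_funM => //; apply: measurable_funX; exact: measurable_enorm.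
  exact: (measurableT_comp (@measurable_powR R ((1 - r) / r)) mX).
have mh : measurable_fun setT (width_integrand r f).
  apply: emeasurable_funM; first exact: measurable_supp_fun.
  exact/measurable_EFinP.
have h_gtNy x : (-oo < width_integrand r f x)%E.
  rewrite /width_integrand; have := supp_fun_gtNy r x f0 f_neq0.
  have W0 : 0 <= W x by exact: powR_ge0.
  rewrite -/(W x); case: (supp_fun r f x) => [s||//] _; first by rewrite -EFinM ltNyr.
  move: W0; rewrite le_eqVlt => /predU1P[<-|W0]; first by rewrite mule0 ltNyr.
  by rewrite gt0_mulye ?lte_fin// ltNyr.
have := integral_half_sum_invariant (@measurable_refl R n u)
  (fun F => @ge0_integral_refl R n u F su) mh h_gtNy df.
rewrite (_ : (fun x => _) = width_integrand r (tau r%:E u f)) //.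
apply/funext => x; rewrite /width_integrand enorm_refl//.
rewrite (supp_fun_tau _ su (ltW r0) fB f_neq0) muleDl//.
  by rewrite !muleA.
have := supp_fun_gtNy r (refl u x) f0 f_neq0; have := supp_fun_gtNy r x f0 f_neq0.
case: (supp_fun r f x) => [s||//] _; case: (supp_fun r f (refl u x)) => [s'||//] _ //=;
  by rewrite ?mule_halfy.
Qed.

Lemma mean_width_tau0 : mean_width 0%:E (tau 0%:E u f) = mean_width 0%:E f.
Proof.
have wE g : mean_width 0%:E g =
    ((2 / n%:R)%:E * \int[gaussian_rV R n]_x supp_fun 0 g x)%E.
  by rewrite /mean_width eqxx.
etransitivity; first exact: wE.
etransitivity; last exact/esym/wE.
apply: congr1.
have [y0 fy0] := f_neq0; have fy0' : 0 < f y0 by rewrite lt_neqAle eq_sym fy0 f0.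
have mh := measurable_supp_fun 0.
have h_gtNy x := supp_fun_gtNy 0 x f0 f_neq0.
have [|_ <-] := integral_half_sum_invariant (mu := gaussian_rV R n)
  (@measurable_refl R n u)
  (fun F => @ge0_integral_gaussian_refl R n u F su) mh h_gtNy.
  suff mh_fin : (\int[gaussian_rV R n]_x (supp_fun 0 f)^\- x < +oo)%E.
    have p0 : (0 <= \int[gaussian_rV R n]_x (supp_fun 0 f)^\+ x)%E.
      by apply: integral_ge0 => x _; exact: funepos_ge0.
    have m0 : (0 <= \int[gaussian_rV R n]_x (supp_fun 0 f)^\- x)%E.
      by apply: integral_ge0 => x _; exact: funeneg_ge0.
    move: mh_fin p0 m0.
    move: (\int[gaussian_rV R n]_x (supp_fun 0 f)^\- x)%E.
    move: (\int[gaussian_rV R n]_x (supp_fun 0 f)^\+ x)%E.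
    by move=> [p||] [m||].
  (* The support function is at least [dotv x y0 + boxcox 0 (f y0)], and [K] bounds the coefficients
     of this affine function. *)
  pose K := \sum_(i < n) `|y0 0 i| + `|boxcox 0 (f y0)|.
  have K0 : 0 <= K by rewrite addr_ge0// sumr_ge0.
  have s0 (x : 'rV[R]_n) : 0 <= \sum_(i < n) `|x 0 i| by rewrite sumr_ge0.
  apply: (@le_lt_trans _ _ (\int[gaussian_rV R n]_x
      (K%:E * (1 + \sum_(i < n) `|x 0 i|)%:E))%E).
    apply: ge0_le_integral_nomeas => x; first exact: funeneg_ge0.
    rewrite funenegE ge_max; apply/andP; split; last first.
      by rewrite -EFinM lee_fin mulr_ge0// addr_ge0.
    rewrite leeNl; apply: (@le_trans _ _ (dotv x y0 + boxcox 0 (f y0))%:E); last first.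
      by rewrite supp_funE//; apply: ereal_sup_ubound; exists y0.
    rewrite -EFinM -EFinN lee_fin lerNl.
    apply: le_trans (ler_norm _) _; rewrite normrN; apply: le_trans (ler_normD _ _) _.
    have d1 : `|dotv x y0| <= (\sum_(i < n) `|y0 0 i|) * \sum_(i < n) `|x 0 i|.
      rewrite dotvC; apply: dotv_norm_le => i.
      by rewrite (bigD1 i)//= lerDl sumr_ge0.
    rewrite /K mulrDr mulr1 mulrDl.
    have := mulr_ge0 (normr_ge0 (boxcox 0 (f y0))) (s0 x); have := s0 y0.
    by move: d1; lra.
  rewrite ge0_integralZl_EFin//.
  - by rewrite lte_mul_pinfty ?lee_fin//; exact: integral_gaussian_norm1_lty.
  - by move=> x _; rewrite lee_fin addr_ge0.
  - apply/measurable_EFinP; apply: measurable_funD => //; apply: measurable_sum => i.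
    by apply: measurableT_comp => //; exact: measurable_coor.
apply: eq_integral => x _.
by rewrite (supp_fun_tau x su (lexx 0) fB f_neq0).
Qed.

End mean_width_tau.

(** * Widths of sets and the measure on the sphere *)

Lemma sphere_measure_refl (R : realType) (n : nat) (u : 'rV[R]_n) (A : set 'rV[R]_n) :
  sphere u -> measurable A ->
  @sphere_measure R n (refl u @^-1` A) = @sphere_measure R n A.
Proof.
move=> su mA; rewrite /sphere_measure; congr (_ * _)%E.
rewrite -[RHS](lebesgue_refl su); last first.
  apply: measurableI; last exact: measurable_unit_ball.
  by rewrite -[X in measurable X]setTI; exact: measurable_direction.
congr (lebesgue_rV _ _ _); apply/seteqP; split => x /=.
all: by rewrite /direction /unit_ball /= enorm_refl// reflZ.
Qed.

Lemma ge0_integral_sphere_refl (R : realType) (n : nat) (u : 'rV[R]_n)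
    (F : 'rV[R]_n -> \bar R) : sphere u ->
  measurable_fun setT F -> (forall x, 0 <= F x)%E ->
  (\int[@sphere_measure R n]_x F (refl u x) = \int[@sphere_measure R n]_x F x)%E.
Proof.
move=> su mF F0.
transitivity (\int[pushforward (@sphere_measure R n) (refl u)]_x F x)%E.
  by rewrite ge0_integral_pushforward//; exact: measurable_refl.
apply: (@eq_measure_integral _ _ _ _ _
  (measure_function_pushforward__canonical__measure_function_Measure
    (@sphere_measure R n) (@measurable_refl R n u))) => A mA _.
exact: sphere_measure_refl.
Qed.

Lemma sphere_measure_lty (R : realType) (n : nat) :
  (@sphere_measure R n setT < +oo)%E.
Proof.
rewrite /sphere_measure preimage_setT setTI lte_mul_pinfty ?lee_fin//.
  by rewrite invr_ge0 fine_ge0.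
exact: lebesgue_unit_ball_lty.
Qed.

Lemma measurable_sphere (R : realType) (n : nat) : measurable (@sphere R n).
Proof.
rewrite (_ : @sphere R n = @enorm R n @^-1` [set 1]); last by [].
by rewrite -[X in measurable X]setTI; exact: measurable_enorm.
Qed.

Lemma width_tau_set (R : realType) (n : nat) (u : 'rV[R]_n) (K : set 'rV[R]_n) :
  sphere u -> width (tau_set u K) = width K.
Proof.
move=> su.
have [->|/set0P[x0 Kx0]] := eqVneq K set0.
  by congr width; apply/seteqP; split => // x [a].
have tE : tau_set u K = [set reflmid u p.1 p.2 | p in K `*` K].
  apply/seteqP; split => x.
    by move=> [a Ka [_ [b Kb <-] <-]]; exists (a, b).
  by move=> [[a b] [/= Ka Kb] <-]; exists a => //; exists (refl u b) => //; exists b.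
have t0 : tau_set u K !=set0 by rewrite tE; exists (reflmid u x0 x0), (x0, x0).
have wE A : A !=set0 -> width A = (2%:E * \int[@sphere_measure R n]_(v in @sphere R n)
    ereal_sup [set (dotv x v)%:E | x in A])%E.
  by move=> /set0P/eqP A0; rewrite /width; case: asboolP.
rewrite !wE//; last by exists x0.
congr (_ * _)%E.
pose S (A : set 'rV[R]_n) v := ereal_sup [set (dotv x v)%:E | x in A].
rewrite -[LHS]/(\int[@sphere_measure R n]_(v in @sphere R n) S (tau_set u K) v)%E.
rewrite -[RHS]/(\int[@sphere_measure R n]_(v in @sphere R n) S K v)%E.
rewrite integral_mkcond [RHS]integral_mkcond.
have mS : measurable_fun setT (S K).
  (* The convex indicator of [K]: its Legendre transform is the support function of [K], which is
     therefore lower semicontinuous. *)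
  pose psi (y : 'rV[R]_n) : \bar R := if `[< K y >] then 0%E else +oo%E.
  have -> : S K = legendre psi.
    apply/funext => v; apply/eqP; rewrite eq_le; apply/andP; split.
      apply: ge_ereal_sup => _ [y Ky <-]; apply: ereal_sup_ubound; exists y => //.
      by rewrite /psi; case: asboolP => // _; rewrite sube0 dotvC.
    apply: ge_ereal_sup => _ [y _ <-]; rewrite /psi; case: asboolP => Ky.
      by rewrite sube0; apply: ereal_sup_ubound; exists y; rewrite // dotvC.
    by rewrite leNye.
  by apply: lower_semicontinuous_measurable_rV; exact: lower_semicontinuous_legendre.
have mh : measurable_fun setT (S K \_ (@sphere R n)).
  by apply/(measurable_restrictT _ (@measurable_sphere R n)); exact: measurable_funTS.
have S_ge v : ((dotv x0 v)%:E <= S K v)%E by apply: ereal_sup_ubound; exists x0.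
have h_gtNy v : (-oo < (S K \_ (@sphere R n)) v)%E.
  rewrite patchE; case: ifP => _; last exact: ltNyr.
  by apply: lt_le_trans (S_ge v); exact: ltNyr.
have [|_ <-] := integral_half_sum_invariant (mu := @sphere_measure R n)
  (@measurable_refl R n u) (fun F => @ge0_integral_sphere_refl R n u F su) mh h_gtNy.
  set h := S K \_ _.
  suff mh_fin : (\int[@sphere_measure R n]_x h^\- x < +oo)%E.
    have p0 : (0 <= \int[@sphere_measure R n]_x h^\+ x)%E.
      by apply: integral_ge0 => x _; exact: funepos_ge0.
    have m0 : (0 <= \int[@sphere_measure R n]_x h^\- x)%E.
      by apply: integral_ge0 => x _; exact: funeneg_ge0.
    move: mh_fin p0 m0.
    move: (\int[@sphere_measure R n]_x h^\- x)%E (\int[@sphere_measure R n]_x h^\+ x)%E.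
    by move=> [p||] [m||].
  (* On the sphere the support function is at least [dotv x0 v >= - C], and the sphere has finite
     measure. *)
  pose C := \sum_(i < n) `|x0 0 i|.
  have C0 : 0 <= C by rewrite sumr_ge0.
  apply: (@le_lt_trans _ _ (\int[@sphere_measure R n]_x C%:E)%E).
    apply: ge0_le_integral_nomeas => v; first exact: funeneg_ge0.
    rewrite funenegE ge_max lee_fin C0 andbT /h patchE.
    case: ifP => [|_]; last by rewrite oppe0 lee_fin.
    rewrite inE => sv; rewrite leeNl; apply: le_trans (S_ge v).
    rewrite -EFinN lee_fin lerNl; apply: le_trans (ler_norm _) _.
    rewrite normrN dotvC -[C]mul1r; apply: dotv_norm_le => i.
    by rewrite -(sv : enorm v = 1); exact: coor_le_enorm.
  rewrite integral_cst//= lte_mul_pinfty ?lee_fin//.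
  exact: sphere_measure_lty.
apply: eq_integral => v _; rewrite !patchE.
have -> : (refl u v \in @sphere R n) = (v \in @sphere R n).
  by apply/idP/idP; rewrite !inE /sphere /= enorm_refl.
case: ifP => _; last by rewrite !mule0 adde0.
rewrite /S -(ereal_sup_half (fun a => dotv a v) (fun b => dotv b (refl u v)));
  last by exists x0.
rewrite tE image_comp; congr ereal_sup; apply: eq_imagel => -[a b] _ /=.
by rewrite /reflmid dotvDl !dotvZl refl_adj.
Qed.

Lemma mean_widthNy_tau (R : realType) (n : nat) (u : 'rV[R]_n)
    (f : 'rV[R]_n -> R) : sphere u -> (forall x, 0 <= f x) ->
  upper_semicontinuous f -> vanishes_at_infinity f ->
  mean_width -oo (tau -oo u f) = mean_width -oo f.
Proof.
move=> su f0 uf vf; apply: eq_integral => t; rewrite inE /= in_itv/= andbT => t0.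
by rewrite superlevel_tau_min// width_tau_set.
Qed.

(** * Log-concave functions and the equality case *)

Lemma alpha_mean_ge_min (R : realType) (alpha : \bar R) (l a b : R) :
  (alpha <= 0)%E -> 0 < a -> 0 < b -> 0 <= l <= 1 ->
  Num.min a b <= alpha_mean alpha l a b.
Proof.
move=> al0 a0 b0 l01; case: alpha al0 => [r|//|//]; rewrite lee_fin => r0.
have [m [mE m0]] : exists m, m = Num.min a b /\ 0 < m.
  by eexists; split; [reflexivity|rewrite lt_min a0].
rewrite -mE -(le_boxcox r0 m0 (alpha_mean_gt0 r a0 b0 l01)).
rewrite (boxcox_alpha_mean r a0 b0 l01).
have ma : boxcox r m <= boxcox r a by rewrite le_boxcox// mE ge_min lexx.
have mb : boxcox r m <= boxcox r b by rewrite le_boxcox// mE ge_min lexx orbT.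
move: l01 => /andP[l0 l1].
have := ler_wpM2l l0 ma; have l1' : 0 <= 1 - l by rewrite subr_ge0.
by have := ler_wpM2l l1' mb; lra.
Qed.

Lemma mean_concave_quasi_concave (R : realType) (n : nat) (alpha : \bar R)
    (f : 'rV[R]_n -> R) : (alpha <= 0)%E -> mean_concave alpha f -> quasi_concave f.
Proof.
move=> al0 cf x y l c c0 cx cy l01.
have fx := lt_le_trans c0 cx; have fy := lt_le_trans c0 cy.
apply: le_trans (cf x y l fx fy l01); apply: le_trans (alpha_mean_ge_min al0 fx fy l01).
by rewrite le_min cx.
Qed.

Section log_concave.
Context (R : realType) (n : nat) (f : 'rV[R]_n -> R).
Hypotheses (f0 : forall x, 0 <= f x) (cf : mean_concave 0%:E f).

(** Log-concavity for lower bounds of [ln f] instead of its exact values: points and log-levels are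
    combined with the same weights. *)
Lemma log_concave_expR x y l s t : 0 <= l <= 1 ->
  expR s <= f x -> expR t <= f y ->
  expR (l * s + (1 - l) * t) <= f (l *: x + (1 - l) *: y).
Proof.
move=> l01 sx ty; have /andP[l0 l1] := l01.
have fx := lt_le_trans (expR_gt0 s) sx; have fy := lt_le_trans (expR_gt0 t) ty.
apply: le_trans (cf fx fy l01); rewrite /alpha_mean eqxx expRD.
have powE (r k : R) : expR (k * r) = expR r `^ k.
  by rewrite /powR gt_eqF ?expR_gt0// expRK.
rewrite !powE; apply: ler_pM; rewrite ?powR_ge0//.
  by apply: ge0_ler_powR; rewrite // nnegrE ?expR_ge0.
by apply: ge0_ler_powR; rewrite ?subr_ge0// nnegrE ?expR_ge0.
Qed.

Hypotheses (uf : upper_semicontinuous f) (vf : vanishes_at_infinity f).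

(** Beyond distance [rho] from [x0] the function is below half of [f x0]; by log-concavity along the
    segment from [x0], it loses at least such a factor 2 with every further [rho]. *)
Lemma log_concave_exp_decay : (exists x, f x != 0) ->
  exists x0 C k, [/\ 0 <= C, 0 < k & forall x, f x <= C * expR (- (k * `|x - x0|))].
Proof.
move=> [x0 fx0]; have c0 : 0 < f x0 by rewrite lt_neqAle eq_sym fx0 f0.
have [B fB] := upper_semicontinuous_bounded uf vf.
have B0 : 0 <= B by exact: le_trans (fB x0).
have c20 : 0 < f x0 / 2 by rewrite divr_gt0.
have [M fM] := vf c20.
pose rho := `|M| + `|x0| + 1.
have rho0 : 0 < rho by rewrite ltr_wpDl// addr_ge0.
have far x : rho <= `|x - x0| -> f x < f x0 / 2.
  move=> xr; apply: le_lt_trans (ler_norm _) _; apply: fM.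
  apply: lt_le_trans (mx_norm_le_enorm x).
  have := le_trans xr (ler_normB x x0); rewrite /rho => h.
  by apply: le_lt_trans (ler_norm M) _; move: h; lra.
have ln20 : 0 < ln (2 : R) by rewrite ln_gt0// ltr1n.
exists x0, (f x0 + B * expR (ln 2)), (ln 2 / rho); split.
- by rewrite addr_ge0// mulr_ge0 ?expR_ge0.
- by rewrite divr_gt0.
move=> x; set d := `|x - x0|.
have [dr|rd] := leP d rho.
  apply: (@le_trans _ _ (B * expR (ln 2) * expR (- (ln 2 / rho * d)))).
    rewrite -mulrA -expRD; apply: le_trans (fB x) _; rewrite ler_peMr//.
    by rewrite -[leLHS]expR0 ler_expR subr_ge0 mulrAC ler_pdivrMr// ler_pM2l.
  by rewrite ler_wpM2r ?expR_ge0// lerDr.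
apply: (@le_trans _ _ (f x0 * expR (- (ln 2 / rho * d)))); last first.
  by rewrite ler_wpM2r ?expR_ge0// lerDl mulr_ge0 ?expR_ge0.
have [fx|] := ltP 0 (f x); last by move=> /le_trans; apply; rewrite mulr_ge0 ?expR_ge0.
have d0 : 0 < d := lt_trans rho0 rd.
(* The point dividing the segment in this ratio is at distance exactly [rho] from [x0]. *)
pose l := rho / d.
have l0 : 0 < l by rewrite divr_gt0.
have l1 : l <= 1 by rewrite ler_pdivrMr// mul1r ltW.
have := @log_concave_expR x x0 l (ln (f x)) (ln (f x0)).
rewrite !lnK ?posrE// (ltW l0) l1 => /(_ isT (lexx _) (lexx _)) hl.
have yr : rho <= `|l *: x + (1 - l) *: x0 - x0|.
  have -> : l *: x + (1 - l) *: x0 - x0 = l *: (x - x0).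
    by apply/rowP => i; rewrite !mxE; ring.
  by rewrite normrZ gtr0_norm// /l -mulrA mulVf ?gt_eqF// mulr1.
have := le_lt_trans hl (far _ yr).
rewrite -[X in _ < X](lnK _) ?posrE// ltr_expR ln_div ?posrE// => hln.
have fxE : ln (f x) <= ln (f x0) - ln 2 / l.
  rewrite -(ler_pM2l l0) mulrBr [l * (_ / l)]mulrC divfK ?gt_eqF//.
  by move: hln; lra.
rewrite -[leLHS](lnK _) ?posrE// -[X in X * _](lnK (c0 : f x0 \in Num.pos)) -expRD ler_expR.
apply: le_trans fxE _; rewrite lerD2l lerN2 /l invfM invrK mulrA.
by rewrite le_eqVlt; apply/orP; left; apply/eqP; field; rewrite gt_eqF.
Qed.

Lemma log_concave_total_mass_lty : (0 < n)%N -> (exists x, f x != 0) ->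
  (total_mass f < +oo)%E.
Proof.
move=> n0 f_neq0; have [x0 [C [k [C0 k0 fC]]]] := log_concave_exp_decay f_neq0.
have mf := measurable_upper_semicontinuous uf.
have n0' : 0 < n%:R :> R by rewrite ltr0n.
(* Rescaling by [n / k] turns the decay rate [k] in the sup norm into rate [n], and [n] times the
   sup norm dominates the sum of the coordinates in absolute value. *)
pose a := n%:R / k; have a0 : 0 < a by rewrite divr_gt0.
have an0 : a != 0 by rewrite gt_eqF.
rewrite /total_mass.
have mfE : measurable_fun setT (fun x => (f x)%:E) by exact/measurable_EFinP.
have f0E x : (0 <= (f x)%:E)%E by rewrite lee_fin.
rewrite (ge0_integral_rV_affine x0 an0 mfE f0E).
rewrite lte_mul_pinfty ?lee_fin ?exprn_ge0//.
apply: (@le_lt_trans _ _ (\int[lebesgue_rV R n]_x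
    (C%:E * (\prod_(i < n) expR (- `|x 0 i|))%:E))%E).
  apply: ge0_le_integral_nomeas => x; first by rewrite lee_fin.
  rewrite -EFinM lee_fin; apply: le_trans (fC _) _; rewrite ler_wpM2l//.
  rewrite -expR_sum ler_expR sumrN lerN2 addrK normrZ gtr0_norm//.
  rewrite mulrA /a (mulrC k) divfK ?gt_eqF//.
  have xi i : `|x 0 i| <= `|x|.
    rewrite [leRHS]/Num.Def.normr /= mx_normrE.
    by apply/bigmax_geP; right; exists (0, i).
  apply: (@le_trans _ _ (\sum_(i < n) `|x|)); first by apply: ler_sum => i _; exact: xi.
  by rewrite sumr_const card_ord mulr_natl.
rewrite ge0_integralZl_EFin//; last 2 first.
- by move=> x _; rewrite lee_fin; apply: prodr_ge0 => i _; exact: expR_ge0.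
- apply/measurable_EFinP; apply: (@measurable_prod_coor R n (fun t => expR (- `|t|))).
  by apply: measurableT_comp => //; apply: measurableT_comp.
by rewrite lte_mul_pinfty ?lee_fin//; exact: integral_exp_coor_lty.
Qed.

Lemma superlevel_measure_gt0 : (0 < total_mass f)%E ->
  exists2 c, 0 < c & (0 < lebesgue_rV R n [set x | c <= f x]%R)%E.
Proof.
move=> J0; apply: contrapT => h; move: J0; apply/negP; rewrite -leNgt.
have mf := measurable_upper_semicontinuous uf.
apply: (@le_trans _ _ (\int[lebesgue_rV R n]_x (0 : R)%:E)%E); last first.
  by rewrite integral0.
apply: le_integral_superlevel => // t t0.
have [->//|c0] := eqVneq (lebesgue_rV R n [set x | t <= f x]) 0%E.
exfalso; apply: h; exists t => //.
by rewrite lt0e c0 measure_ge0.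
Qed.

End log_concave.

(** * Equal masses: the symmetral is the Steiner symmetral *)

Section equality_case.
Context (R : realType) (n : nat) (u : 'rV[R]_n) (f : 'rV[R]_n -> R).
Hypotheses (su : sphere u) (f0 : forall x, 0 <= f x) (cf : mean_concave 0%:E f).
Hypotheses (uf : upper_semicontinuous f) (vf : vanishes_at_infinity f).
Hypothesis f_neq0 : exists x, f x != 0.

(* Log-concavity of the symmetral propagates a strict inequality at one point to
   the homothetic copies of a superlevel set shrinking to that point, which
   contradicts the equality of the total masses. *)
Lemma tau_eq_steiner : (0 < total_mass f)%E ->
  total_mass (tau 0%:E u f) = total_mass f ->
  tau 0%:E u f = steiner u f.
Proof.
move=> J0 JE; apply/funext => x0.
have [B fB'] := upper_semicontinuous_bounded uf vf.
have fB x : 0 <= f x <= B by rewrite f0 fB'.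
have al0 : (0%:E <= 0 :> \bar R)%E by rewrite lee_fin.
have qf := mean_concave_quasi_concave al0 cf.
have leS x : steiner u f x <= tau 0%:E u f x by exact: steiner_le_tau fB _ _ al0.
apply/eqP; rewrite eq_le leS andbT leNgt; apply/negP => lt0.
have h_conc := tau_mean_concave su al0 fB cf.
have h_ge0 x : 0 <= tau 0%:E u f x by have /andP[] := tau_bounded su al0 fB x.
set h := tau 0%:E u f in JE leS lt0 h_conc h_ge0 *.
have S0 x : 0 <= steiner u f x by exact: steiner_ge0 fB x.
set S := steiner u f in leS lt0 S0 *.
have hx0 : 0 < h x0 by exact: le_lt_trans lt0.
have [c c0 Kc] := superlevel_measure_gt0 f0 uf J0.
have SK : (0 < lebesgue_rV R n [set x | c <= S x]%R)%E.
  by apply: lt_le_trans Kc _; exact: measure_superlevel_steiner.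
set K := [set x | c <= S x] in SK.
have clS t : closed [set x | t <= S x] by exact: closed_superlevel_steiner.
have mK : measurable K by apply: closed_measurable_rV; exact: clS.
have [M [_ KM']] : bounded_set K.
  by apply: compact_bounded; exact: compact_superlevel_steiner.
pose M1 := `|M| + 1 + `|x0|.
have M10 : 0 < M1 by rewrite ltr_pwDl// ltr_wpDl.
have KM y : K y -> `|y - x0| <= M1.
  move=> Ky; apply: le_trans (ler_normB _ _) _; rewrite lerD2r.
  by apply: KM' => //; apply: le_lt_trans (ler_norm _) _; rewrite ltrDl.
(* Two levels strictly between [S x0] and [h x0]: near [x0], semicontinuity keeps [S] below [m],
   while [h] will be at least [m'] on the small copies, a gain of [m' - m]. *)
pose m := S x0 + (h x0 - S x0) / 2.
pose m' := S x0 + (h x0 - S x0) * (3 / 4).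
have d0 : 0 < h x0 - S x0 by rewrite subr_gt0.
have mm' : m < m' by rewrite /m /m'; lra.
have m'h : m' < h x0 by rewrite /m'; lra.
have m'0 : 0 < m' by rewrite /m'; have := S0 x0; lra.
have [e /= e0 Se] : exists2 e, 0 < e & forall y, `|y - x0| < e -> S y < m.
  have /nbhs_ballP[e /= e0 He] : nbhs x0 (~` [set x | m <= S x]).
    apply: open_nbhs_nbhs; split; first exact/closed_openC.
    by apply/negP; rewrite -ltNge /m; lra.
  exists e => // y ye; rewrite ltNge; apply/negP; apply: He.
  by rewrite mx_norm_ball /ball_/= distrC.
pose L := ln (h x0) - ln c.
pose D := ln (h x0) - ln m'.
have D0 : 0 < D by rewrite subr_gt0 ltr_ln ?posrE.
(* The ratio [l] brings the copy of [K] within distance [e] of [x0] and makes the interpolated value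
   [c^l h(x0)^(1-l)] exceed [m']. *)
have [l [l0 l1 lM lL]] : exists l, [/\ 0 < l, l < 1, l * M1 < e & l * L < D].
  have L0 : 0 < `|L| + 1 by rewrite ltr_wpDl.
  exists (Num.min 2^-1 (Num.min (e / 2 / M1) (D / 2 / (`|L| + 1)))).
  set l := Num.min _ _.
  have l2 : l <= 2^-1 by rewrite ge_min lexx.
  have le : l <= e / 2 / M1 by rewrite !ge_min lexx orbT.
  have lD : l <= D / 2 / (`|L| + 1) by rewrite !ge_min lexx !orbT.
  have l0 : 0 < l by rewrite !lt_min invr_gt0 ltr0n !divr_gt0.
  split => //.
  - by apply: le_lt_trans l2 _; rewrite invf_lt1 ?ltr1n.
  - move: le; rewrite ler_pdivlMr// => /le_lt_trans; apply.
    by rewrite ltr_pdivrMr// ltr_pMr// ltr1n.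
  - move: lD; rewrite ler_pdivlMr// => lD.
    apply: (@le_lt_trans _ _ (l * (`|L| + 1))).
      by rewrite ler_pM2l// (le_trans (ler_norm L))// lerDl.
    by apply: le_lt_trans lD _; rewrite ltr_pdivrMr// ltr_pMr// ltr1n.
(* The inverse of the homothety of centre [x0] and ratio [l], so [E] is the shrunken copy of [K] and
   has positive measure. *)
pose A (y : 'rV[R]_n) := l^-1 *: (y - (1 - l) *: x0).
pose E := A @^-1` K.
have ln0 : l != 0 by rewrite gt_eqF.
have mE : measurable E.
  rewrite -[X in measurable X]setTI; suff mA : measurable_fun setT A by exact: mA.
  by apply: measurable_rVZ => //; apply: measurable_rVD.
have EK : lebesgue_rV R n E = ((`|l| ^+ n)%:E * lebesgue_rV R n K)%E.
  have iE (X : set 'rV[R]_n) : measurable X ->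
      (lebesgue_rV R n X = \int[lebesgue_rV R n]_x (\1_X x)%:E)%E.
    by move=> mX; rewrite integral_indic// setIT.
  rewrite (iE _ mE) (iE _ mK).
  have m1 : measurable_fun setT (fun x => (\1_E x)%:E : \bar R).
    exact/measurable_EFinP/measurable_indic.
  have p1 x : (0 <= (\1_E x)%:E :> \bar R)%E by rewrite lee_fin.
  rewrite (ge0_integral_rV_affine ((1 - l) *: x0) ln0 m1 p1).
  congr (_ * _)%E; apply: eq_integral => x _; rewrite !indicE.
  suff -> : (l *: x + (1 - l) *: x0 \in E) = (x \in K) by [].
  apply/idP/idP; rewrite !inE /E /A /= addrK scalerA mulVf// scale1r//.
have E0 : (0 < lebesgue_rV R n E)%E.
  by rewrite EK mule_gt0// lte_fin exprn_gt0// normr_gt0.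
have hE y : E y -> S y + (m' - m) <= h y.
  move=> Ey; have KAy : K (A y) by [].
  have yE : y = l *: A y + (1 - l) *: x0.
    by rewrite /A scalerA divff// scale1r subrK.
  have Sy : S y < m.
    apply: Se; have -> : y - x0 = l *: (A y - x0).
      by rewrite {1}yE; apply/rowP => i; rewrite !mxE; ring.
    rewrite normrZ gtr0_norm//; apply: le_lt_trans lM.
    by rewrite ler_pM2l// KM.
  have hAy : c <= h (A y) by exact: le_trans (leS _).
  have l01 : 0 <= l <= 1 by rewrite !ltW.
  have := @log_concave_expR R n h h_ge0 h_conc (A y) x0 l (ln c) (ln (h x0)) l01.
  rewrite !lnK ?posrE// => /(_ hAy (lexx _)); rewrite -yE => hy.
  have m'hy : m' <= h y.
    apply: le_trans hy; rewrite -[leLHS](lnK (m'0 : m' \in Num.pos)) ler_expR.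
    by move: lL; rewrite /L /D; lra.
  by move: Sy m'hy; lra.
have mm'0 : 0 < m' - m by rewrite subr_gt0.
have mS : measurable_fun setT (fun x => (S x)%:E).
  by apply/measurable_EFinP; exact: measurable_steiner fB uf vf.
(* Strictness relies on the mass of [f] being finite. *)
have lt1 : (total_mass f < total_mass f + (m' - m)%:E * lebesgue_rV R n E)%E.
  rewrite lteDl; first by rewrite mule_gt0.
  rewrite ge0_fin_numE; last by apply: integral_ge0 => x _; rewrite lee_fin.
  apply: (log_concave_total_mass_lty f0 cf uf vf) => //.
  by case: (n) u su => // v /sphere0_false.
have le1 : (total_mass f + (m' - m)%:E * lebesgue_rV R n E <= total_mass h)%E.
  apply: (@le_trans _ _ (\int[lebesgue_rV R n]_x
      ((S x)%:E + (m' - m)%:E * (\1_E x)%:E))%E).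
    rewrite ge0_integralD//; last 3 first.
    - by move=> x _; rewrite lee_fin.
    - by move=> x _; rewrite mule_ge0 ?lee_fin// ltW.
    - by apply: measurable_funeM; exact/measurable_EFinP/measurable_indic.
    apply: leeD; first exact: le_total_mass_steiner.
    have mI : measurable_fun setT (fun x => (\1_E x)%:E : \bar R).
      exact/measurable_EFinP/measurable_indic.
    have I0 x : setT x -> (0 <= (\1_E x)%:E :> \bar R)%E by rewrite lee_fin.
    rewrite (ge0_integralZl_EFin _ measurableT I0 mI (ltW mm'0)).
    by rewrite integral_indic// setIT.
  apply: ge0_le_integral_nomeas => x.
    by rewrite adde_ge0 ?mule_ge0 ?lee_fin// ltW.
  rewrite -EFinM -EFinD lee_fin indicE.
  have [|_] := boolP (x \in E); first by rewrite inE mulr1; exact: hE.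
  by rewrite mulr0 addr0.
by have := lt_le_trans lt1 le1; rewrite JE ltxx.
Qed.

End equality_case.

(* The midpoint inequality, summed over a subdivision of [0, 1]. *)
Lemma midpoint_telescope (R : realType) (a b : R -> R) :
  (forall x y, 0 <= x <= 1 -> 0 <= y <= 1 ->
     b y - a x <= b ((x + y) / 2) - a ((x + y) / 2)) ->
  (forall e, 0 < e -> exists2 d, 0 < d & forall x, 0 < x < d -> x <= 1 ->
     b x <= b 0 + e /\ a 1 - e <= a (1 - x)) ->
  b 1 + a 1 <= b 0 + a 0.
Proof.
move=> mid usc; apply/ler_addgt0Pr => e e0.
have [d d0 hd] := usc (e / 2) (divr_gt0 e0 (ltr0Sn _ 1)).
pose N := (Num.truncn d^-1).+1.
have N0 : 0 < N%:R :> R by rewrite ltr0n.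
have Nd : N%:R^-1 < d by rewrite invf_plt ?posrE// truncnS_gt.
pose p k : R := k%:R / N%:R.
have p01 k : (k <= N)%N -> 0 <= p k <= 1.
  by move=> kN; rewrite /p divr_ge0// ler_pdivrMr// mul1r ler_nat.
have pm k : (p k + p k.+2) / 2 = p k.+1.
  by rewrite /p -[k.+2]addn2 -[k.+1]addn1 !natrD; field; rewrite gt_eqF.
(* The hypothesis is applied to points two steps apart, whose midpoint is the subdivision point
   between them. *)
have step k : (k.+2 <= N)%N -> b (p k.+2) + a (p k.+1) <= b (p k.+1) + a (p k).
  move=> kN; have := mid (p k) (p k.+2); rewrite pm => H.
  have kN' : (k <= N)%N by rewrite (leq_trans _ kN)// -addn2 leq_addr.
  by have := H (p01 _ kN') (p01 _ kN); lra.
have tel k : (k.+1 <= N)%N -> b (p k.+1) + a (p k) <= b (p 1%N) + a (p 0%N).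
  elim: k => // k IH kN; apply: le_trans (step _ kN) (IH _).
  exact: ltnW.
(* Telescoping leaves [b 1 + a (1 - 1/N) <= b (1/N) + a 0]; the semicontinuity hypothesis moves both
   shifted points to the ends at a cost of [e / 2] each. *)
have := tel (Num.truncn d^-1) (leqnn _).
have -> : p (Num.truncn d^-1).+1 = 1 by rewrite /p divff// gt_eqF.
have -> : p 0%N = 0 by rewrite /p mul0r.
have -> : p (Num.truncn d^-1) = 1 - p 1%N.
  have kE : (Num.truncn d^-1)%:R = N%:R - 1 :> R by rewrite -natr1 addrK.
  by rewrite /p kE; field; rewrite gt_eqF.
have p1 : 0 < p 1%N < d by rewrite /p mul1r invr_gt0 N0.
have p11 : p 1%N <= 1 by have /andP[] := p01 1%N (ltn0Sn _).
by have [] := hd _ p1 p11; lra.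
Qed.

(* Levels are parametrized by their logarithm, so that log-concavity makes
   [fibre f u w s] concave in [(w, s)]. *)
Definition fibre (R : realType) (n : nat) (f : 'rV[R]_n -> R) (u w : 'rV[R]_n)
  (s : R) : set R := [set t | expR s <= f (w + t *: u)].

(** * Fibres of a log-concave function *)

Section fibres.
Context (R : realType) (n : nat) (f : 'rV[R]_n -> R).
Hypotheses (f0 : forall x, 0 <= f x) (cf : mean_concave 0%:E f).
Hypotheses (uf : upper_semicontinuous f) (vf : vanishes_at_infinity f).

Lemma fibre_conv (u w1 w0 : 'rV[R]_n) s1 s0 t1 t0 l : 0 <= l <= 1 ->
  fibre f u w1 s1 t1 -> fibre f u w0 s0 t0 ->
  fibre f u (l *: w1 + (1 - l) *: w0) (l * s1 + (1 - l) * s0)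
    (l * t1 + (1 - l) * t0).
Proof.
move=> l01 h1 h0; rewrite /fibre/=.
have -> : l *: w1 + (1 - l) *: w0 + (l * t1 + (1 - l) * t0) *: u =
    l *: (w1 + t1 *: u) + (1 - l) *: (w0 + t0 *: u).
  by apply/rowP => i; rewrite !mxE; ring.
exact: log_concave_expR.
Qed.

Lemma fibre_itv (u w : 'rV[R]_n) s p q t :
  fibre f u w s p -> fibre f u w s q -> p <= t <= q -> fibre f u w s t.
Proof.
move=> hp hq /andP[pt tq].
have [pq|pq] := eqVneq p q.
  by have -> : t = p by apply/eqP; rewrite eq_le pt andbT pq.
have pq' : p < q by rewrite lt_neqAle pq (le_trans pt).
have qp0 : q - p != 0 by rewrite subr_eq0 eq_sym.
pose l := (q - t) / (q - p).
have l01 : 0 <= l <= 1.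
  rewrite /l divr_ge0 ?subr_ge0 ?(ltW pq')//=.
  by rewrite ler_pdivrMr ?subr_gt0// mul1r lerD2l lerN2.
have := fibre_conv l01 hp hq.
rewrite -scalerDl -mulrDl (_ : l + (1 - l) = 1); last by ring.
rewrite scale1r mul1r (_ : l * p + (1 - l) * q = t)//.
by rewrite /l; field.
Qed.

Lemma closed_fibre (u w : 'rV[R]_n) s : closed (fibre f u w s).
Proof.
apply: (@preimage_closed _ _ (fun t : R => w + t *: u) [set x | expR s <= f x]).
  move=> t _.
  apply: (@continuousD R 'rV[R]_n R (fun=> w) (fun t : R => t *: u)).
    exact: cst_continuous.
  exact: scalel_continuous.
exact: closed_superlevel.
Qed.

Lemma bounded_fibre (u w : 'rV[R]_n) s : u != 0 ->
  exists M, forall t, fibre f u w s t -> `|t| <= M.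
Proof.
move=> u0; have [M fM] := vf (expR_gt0 s).
have nu0 : 0 < `|u| by rewrite normr_gt0.
exists ((M + `|w|) / `|u|) => t ht; rewrite ler_pdivlMr// -normrZ.
have xM : `|w + t *: u| <= M.
  apply: le_trans (mx_norm_le_enorm _) _; rewrite leNgt; apply/negP => /fM.
  by apply/negP; rewrite -leNgt (le_trans ht)// ler_norm.
rewrite -[t *: u](addKr w) addrC; apply: le_trans (ler_normB _ _) _.
by rewrite lerD2r.
Qed.

Lemma has_sup_fibre (u w : 'rV[R]_n) s t : u != 0 -> fibre f u w s t ->
  has_sup (fibre f u w s).
Proof.
move=> u0 ht; split; first by exists t.
have [M hM] := bounded_fibre w s u0; exists M => x /hM; exact: le_trans (ler_norm x).
Qed.

Lemma has_inf_fibre (u w : 'rV[R]_n) s t : u != 0 -> fibre f u w s t ->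
  has_inf (fibre f u w s).
Proof.
move=> u0 ht; split; first by exists t.
have [M hM] := bounded_fibre w s u0; exists (- M) => x /hM.
by rewrite ler_norml => /andP[].
Qed.

Lemma fibreN (u w : 'rV[R]_n) s t : fibre f (- u) w s t = fibre f u w s (- t).
Proof. by rewrite /fibre/= scalerN scaleNr. Qed.

Lemma sup_fibreN (u w : 'rV[R]_n) s :
  sup (fibre f (- u) w s) = - inf (fibre f u w s).
Proof.
rewrite /inf opprK; congr sup; apply/seteqP; split => t.
  by rewrite fibreN => ht; exists (- t) => //; rewrite opprK.
by move=> [x hx <-]; rewrite fibreN opprK.
Qed.

(** Near the point of parameter [b0 + e], [f] is below a level [m < expR s0], so for small [x] the
    fibre omits [b0 + e]. Being an interval with a point at most [b0 + e], it lies entirely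
    below. *)
Lemma sup_fibre_usc (u w0 w1 : 'rV[R]_n) s0 s1 t0 t1 e : u != 0 ->
  fibre f u w0 s0 t0 -> fibre f u w1 s1 t1 -> 0 < e ->
  exists2 d, 0 < d & forall x, 0 < x < d -> x <= 1 ->
    sup (fibre f u (x *: w1 + (1 - x) *: w0) (x * s1 + (1 - x) * s0)) <=
    sup (fibre f u w0 s0) + e.
Proof.
move=> u0 h0 h1 e0; set b0 := sup (fibre f u w0 s0).
have sup0 := has_sup_fibre u0 h0.
have t0b : t0 <= b0 by apply: ub_le_sup => //; case: sup0.
pose y := w0 + (b0 + e) *: u.
have fy : f y < expR s0.
  rewrite ltNge; apply/negP => hy.
  have : b0 + e <= b0 by apply: ub_le_sup => //; case: sup0.
  by rewrite gerDl leNgt e0.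
pose m := (f y + expR s0) / 2.
have fm : f y < m by rewrite /m; lra.
have ms : m < expR s0 by rewrite /m; lra.
have m0 : 0 < m by rewrite /m; have := expR_gt0 s0; have := f0 y; lra.
have [r /= r0 hr] : exists2 r, 0 < r & forall z, `|z - y| < r -> f z < m.
  have /nbhs_ballP[r /= r0 Hr] : nbhs y (~` [set x | m <= f x]).
    apply: open_nbhs_nbhs; split; first exact/closed_openC/closed_superlevel.
    by apply/negP; rewrite -ltNge.
  exists r => // z yz; rewrite ltNge; apply/negP; apply: Hr.
  by rewrite mx_norm_ball /ball_/= distrC.
pose C := s0 - ln m.
have C0 : 0 < C by rewrite subr_gt0 -ltr_expR lnK.
pose c1 := `|w1 - w0| + 1; have c10 : 0 < c1 by rewrite ltr_wpDl.
pose c2 := `|s1 - s0| + 1; have c20 : 0 < c2 by rewrite ltr_wpDl.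
pose c3 := `|t1 - t0| + 1; have c30 : 0 < c3 by rewrite ltr_wpDl.
(* The three bounds keep, in this order, the displaced point within [r] of [y], the log-level above
   [ln m], and the interpolated point of the fibre below [b0 + e]. *)
exists (Num.min (r / c1) (Num.min (C / c2) (e / c3))).
  by rewrite !lt_min !divr_gt0.
move=> x /andP[x0]; rewrite !lt_min !ltr_pdivlMr// => /and3P[x1 x2 x3] xle1.
have x01 : 0 <= x <= 1 by rewrite (ltW x0).
have hx := fibre_conv x01 h1 h0.
have xt : x * t1 + (1 - x) * t0 <= b0 + e.
  have : x * (t1 - t0) <= x * c3.
    by rewrite ler_pM2l// /c3 (le_trans (ler_norm _))// lerDl.
  by move: x3 t0b; lra.
apply: ge_sup; first by eexists; exact: hx.
move=> t ht; rewrite leNgt; apply/negP => tb.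
have : fibre f u (x *: w1 + (1 - x) *: w0) (x * s1 + (1 - x) * s0) (b0 + e).
  by apply: (fibre_itv hx ht); rewrite xt ltW.
apply/negP; rewrite -ltNge; apply: (@lt_trans _ _ m).
  apply: hr; rewrite /y.
  have -> : x *: w1 + (1 - x) *: w0 + (b0 + e) *: u - (w0 + (b0 + e) *: u) =
      x *: (w1 - w0) by apply/rowP => i; rewrite !mxE; ring.
  rewrite normrZ gtr0_norm//; apply: le_lt_trans x1.
  by rewrite ler_pM2l// lerDl.
rewrite -[X in X < _](lnK (m0 : m \in Num.pos)) ltr_expR.
have : x * (s0 - s1) <= x * c2.
  by rewrite ler_pM2l// /c2 (le_trans (ler_norm _))// distrC lerDl.
by move: x2; rewrite /C; lra.
Qed.

Variable u : 'rV[R]_n.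
Hypotheses (su : sphere u) (eqS : tau 0%:E u f = steiner u f).

(* [w1 + t1 u] and [w2 + t2 u] are averaged by the symmetral, which coincides
   with the fibrewise one. *)
Lemma fibre_midpoint (w1 w2 : 'rV[R]_n) s1 s2 t1 t2 :
  dotv w1 u = 0 -> dotv w2 u = 0 ->
  fibre f u w1 s1 t1 -> fibre f u w2 s2 t2 ->
  exists p q, [/\ fibre f u (2^-1 *: w1 + 2^-1 *: w2) ((s1 + s2) / 2) p,
    fibre f u (2^-1 *: w1 + 2^-1 *: w2) ((s1 + s2) / 2) q & p - q = t1 - t2].
Proof.
move=> w1u w2u h1 h2; set w := _ + _; set s := _ / 2.
have uu := sphere_dotv su.
have [B fB'] := upper_semicontinuous_bounded uf vf.
have fB x : 0 <= f x <= B by rewrite f0 fB'.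
pose x := reflmid u (w1 + t1 *: u) (w2 + t2 *: u).
have xE : x = w + ((t1 - t2) / 2) *: u.
  rewrite /x /reflmid addrC (addrC w2) refl_line// w2u.
  by apply/rowP => i; rewrite !mxE; field.
have al0 : (0%:E <= 0 :> \bar R)%E by rewrite lee_fin.
have hx : expR s <= tau 0%:E u f x.
  apply: le_trans (tau_ge su al0 _ _ fB).
  rewrite -[leLHS](half_meanxx al0 (expR_ge0 s)) /half_mean eqxx.
  rewrite ler_sqrt ?mulr_ge0// -expRD (_ : s + s = s1 + s2); last by rewrite /s; field.
  by rewrite expRD ler_pM ?expR_ge0.
(* The same level is now reached by a pair [a], [b] on one line of direction [u]. Comparing
   components orthogonal to [u] shows that this line passes through [w]. *)
rewrite eqS in hx.
have [a [b [ab abx ha hb]]] := steiner_attained su uf vf (expR_gt0 s) hx.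
have wu : dotv w u = 0 by rewrite /w dotvDl !dotvZl w1u w2u !mulr0 addr0.
clearbody w s x.
have abE : a = b + dotv (a - b) u *: u by rewrite -[X in _ + X](ab : a - b = _) addrC subrK.
have bE : b = w + dotv b u *: u.
  have : reflmid u a b = w + ((t1 - t2) / 2) *: u by rewrite abx.
  rewrite /reflmid /refl => abw.
  have dE := congr1 (fun z => dotv z u) abw.
  rewrite /= !(dotvDl, dotvNl, dotvZl) uu wu in dE.
  have : b = (2^-1 *: a + 2^-1 *: (b - (2 * dotv b u) *: u))
      + (dotv b u - dotv (a - b) u / 2) *: u.
    by rewrite {1}abE; apply/rowP => i; rewrite !mxE; field.
  rewrite abw => {1}->; rewrite -addrA -scalerDl; congr (_ + _ *: u).
  by rewrite dotvBl; move: dE; lra.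
have aE : a = w + dotv a u *: u.
  by rewrite {1}abE {1}bE -addrA -scalerDl dotvBl (addrC (dotv b u)) subrK.
exists (dotv a u), (dotv b u); split.
- by rewrite /fibre/= -aE.
- by rewrite /fibre/= -bE.
have : dotv (reflmid u a b) u = (t1 - t2) / 2.
  by rewrite abx xE dotvDl dotvZl uu wu add0r mulr1.
rewrite /reflmid /refl !(dotvDl, dotvNl, dotvZl) uu.
by lra.
Qed.

End fibres.

Section symmetric_fibres.
Context (R : realType) (n : nat) (u : 'rV[R]_n) (f : 'rV[R]_n -> R).
Hypotheses (su : sphere u) (f0 : forall x, 0 <= f x) (cf : mean_concave 0%:E f).
Hypotheses (uf : upper_semicontinuous f) (vf : vanishes_at_infinity f).
Hypothesis eqS : tau 0%:E u f = steiner u f.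

Let u0 : u != 0. Proof. exact: sphere_neq0. Qed.

(** Along the segment joining the two base points and log-levels, [fibre_midpoint] gives the
    midpoint inequality for the endpoints of the fibres. Exchanging the roles of 0 and 1 later
    yields equality of the centres. *)
Lemma le_fibre_centre (w0 w1 : 'rV[R]_n) s0 s1 t0 t1 :
  dotv w0 u = 0 -> dotv w1 u = 0 ->
  fibre f u w0 s0 t0 -> fibre f u w1 s1 t1 ->
  sup (fibre f u w1 s1) + inf (fibre f u w1 s1) <=
  sup (fibre f u w0 s0) + inf (fibre f u w0 s0).
Proof.
move=> w0u w1u h0 h1.
pose W (x : R) := x *: w1 + (1 - x) *: w0.
pose S (x : R) := x * s1 + (1 - x) * s0.
have W0 : W 0 = w0 by apply/rowP => i; rewrite !mxE; ring.
have W1 : W 1 = w1 by apply/rowP => i; rewrite !mxE; ring.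
have S0 : S 0 = s0 by rewrite /S; ring.
have S1 : S 1 = s1 by rewrite /S; ring.
pose F x := fibre f u (W x) (S x).
have F0E : F 0 = fibre f u w0 s0 by rewrite /F W0 S0.
have F1E : F 1 = fibre f u w1 s1 by rewrite /F W1 S1.
have Fx x : 0 <= x <= 1 -> F x (x * t1 + (1 - x) * t0) by move=> x01; exact: fibre_conv.
have Wu x : dotv (W x) u = 0 by rewrite /W dotvDl !dotvZl w0u w1u !mulr0 addr0.
have := @midpoint_telescope R (fun x => inf (F x)) (fun x => sup (F x)).
rewrite /= F0E F1E => tel; apply: tel => [x y x01 y01|e e0].
  have FmE : fibre f u (2^-1 *: W y + 2^-1 *: W x) ((S y + S x) / 2) = F ((x + y) / 2).
    rewrite /F; congr (fibre f u _ _); last by rewrite /S; field.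
    by apply/rowP => i; rewrite !mxE; field.
  have dle t t' : F y t -> F x t' ->
      t - t' <= sup (F ((x + y) / 2)) - inf (F ((x + y) / 2)).
    move=> ht ht'.
    have [p [q []]] := fibre_midpoint f0 uf vf su eqS (Wu y) (Wu x) ht ht'.
    rewrite FmE => hp hq <-; apply: lerB.
      by apply: ub_le_sup => //; case: (has_sup_fibre vf u0 hp).
    by apply: ge_inf => //; case: (has_inf_fibre vf u0 hq).
  have hx := Fx _ x01; have hy := Fx _ y01.
  set D := _ - _ in dle *.
  have h t' : F x t' -> sup (F y) <= D + t'.
    move=> ht'; apply: ge_sup; first by eexists; exact: hy.
    by move=> t ht; rewrite -lerBlDr; exact: dle.
  rewrite lerBlDr addrC -lerBlDr.
  apply: lb_le_inf; first by eexists; exact: hx.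
  by move=> t' ht'; rewrite lerBlDr addrC; exact: h.
have [d1 d10 hd1] := sup_fibre_usc f0 cf uf vf u0 h0 h1 e0.
(* Replacing [u] by [- u] turns an infimum into the opposite of a supremum; with the segment
   reversed, this gives the semicontinuity of the lower endpoint at 1. *)
have Nu0 : - u != 0 by rewrite oppr_eq0.
have h0N : fibre f (- u) w0 s0 (- t0) by rewrite fibreN opprK.
have h1N : fibre f (- u) w1 s1 (- t1) by rewrite fibreN opprK.
have [d2 d20 hd2] := sup_fibre_usc f0 cf uf vf Nu0 h1N h0N e0.
exists (Num.min d1 d2); first by rewrite lt_min d10.
move=> x /andP[x0]; rewrite lt_min => /andP[xd1 xd2] x1; split.
  by apply: hd1 => //; rewrite x0.
have := hd2 x; rewrite x0 xd2 => /(_ isT x1).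
have -> : x *: w0 + (1 - x) *: w1 = W (1 - x).
  by apply/rowP => i; rewrite !mxE; ring.
have -> : x * s0 + (1 - x) * s1 = S (1 - x) by rewrite /S; ring.
by rewrite !sup_fibreN /F; lra.
Qed.

Lemma sup_fibre_mem (v w : 'rV[R]_n) s t : v != 0 -> fibre f v w s t ->
  fibre f v w s (sup (fibre f v w s)).
Proof.
move=> v0 ht; apply: closed_fibre => //.
by have [? ?] := has_sup_fibre vf v0 ht; exact: closure_sup.
Qed.

Lemma inf_fibre_mem (w : 'rV[R]_n) s t : fibre f u w s t ->
  fibre f u w s (inf (fibre f u w s)).
Proof.
move=> ht; have Nu0 : - u != 0 by rewrite oppr_eq0.
have htN : fibre f (- u) w s (- t) by rewrite fibreN opprK.
by have := sup_fibre_mem Nu0 htN; rewrite sup_fibreN fibreN opprK.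
Qed.

Lemma steiner_eq_translate : (exists x, f x != 0) ->
  exists z : 'rV[R]_n, forall x, reflf u f x = f (x - z).
Proof.
move=> [y0 fy0]; have uu := sphere_dotv su.
have pos x : f x != 0 -> 0 < f x by rewrite lt_neqAle eq_sym f0 andbT.
pose W (x : 'rV[R]_n) := x - dotv x u *: u.
have Wu x : dotv (W x) u = 0 by rewrite /W dotvBl dotvZl uu mulr1 subrr.
have hW x : f x != 0 -> fibre f u (W x) (ln (f x)) (dotv x u).
  by move=> fx; rewrite /fibre/= /W subrK lnK// posrE pos.
(* Twice the parameter of the common centre of the fibres. *)
pose c := sup (fibre f u (W y0) (ln (f y0))) + inf (fibre f u (W y0) (ln (f y0))).
have cE x : f x != 0 ->
    sup (fibre f u (W x) (ln (f x))) + inf (fibre f u (W x) (ln (f x))) = c.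
  move=> fx; apply/eqP; rewrite eq_le.
  rewrite (le_fibre_centre (Wu y0) (Wu x) (hW _ fy0) (hW _ fx)).
  by rewrite (le_fibre_centre (Wu x) (Wu y0) (hW _ fx) (hW _ fy0)).
(* The parameter of [x], reflected in the centre of its fibre at level [f x], is [c - dotv x u] and
   remains in that fibre. The converse inequality comes from [key] at the image point. *)
have key x : f x <= f (refl u x + c *: u).
  have [->|fx] := eqVneq (f x) 0; first exact: f0.
  have ht := hW _ fx.
  have hs := sup_fibre_mem u0 ht; have hi := inf_fibre_mem ht.
  have ts : dotv x u <= sup (fibre f u (W x) (ln (f x))).
    by apply: ub_le_sup => //; case: (has_sup_fibre vf u0 ht).
  have it : inf (fibre f u (W x) (ln (f x))) <= dotv x u.
    by apply: ge_inf => //; case: (has_inf_fibre vf u0 ht).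
  have : fibre f u (W x) (ln (f x)) (c - dotv x u).
    by apply: (fibre_itv f0 cf hi hs); rewrite -(cE _ fx); lra.
  rewrite /fibre/= lnK ?posrE ?pos//.
  rewrite (_ : W x + (c - dotv x u) *: u = refl u x + c *: u)//.
  by rewrite /W /refl; apply/rowP => i; rewrite !mxE; ring.
exists (- (c *: u)) => x; rewrite /reflf opprK; apply/eqP; rewrite eq_le.
apply/andP; split; first by have := key (refl u x); rewrite reflK.
have := key (x + c *: u); rewrite reflD reflZ.
have -> : refl u u = - u by rewrite /refl uu; apply/rowP => i; rewrite !mxE; ring.
by rewrite scalerN subrK.
Qed.

End symmetric_fibres.

(** * Converse of the equality case and conclusion *)

Lemma total_mass_translate (R : realType) (n : nat) (f : 'rV[R]_n -> R) z :
  (forall x, 0 <= f x) -> upper_semicontinuous f ->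
  total_mass (fun x => f (x - z)) = total_mass f.
Proof.
move=> f0 uf; rewrite /total_mass.
have mf : measurable_fun setT (fun x => (f x)%:E).
  by apply/measurable_EFinP; exact: measurable_upper_semicontinuous.
have f0E x : (0 <= (f x)%:E)%E by rewrite lee_fin.
rewrite (ge0_integral_rV_affine (- z) (oner_neq0 R) mf f0E).
by rewrite normr1 expr1n mul1e; apply: eq_integral => x _; rewrite scale1r.
Qed.

(** Since [f b] is the value of [f] at [refl u b - z], log-concavity bounds the half mean by [f] at
    the midpoint of [a] and [refl u b - z], namely [x - z / 2]. The bound is reached when these two
    points coincide. *)
Lemma tau0_translate (R : realType) (n : nat) (u : 'rV[R]_n) (f : 'rV[R]_n -> R)
    (B : R) (z : 'rV[R]_n) : sphere u -> (forall x, 0 <= f x <= B) ->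
  mean_concave 0%:E f -> (forall x, reflf u f x = f (x - z)) ->
  tau 0%:E u f = fun x => f (x - 2^-1 *: z).
Proof.
move=> su fB cf fz; have al0 : (0%:E <= 0 :> \bar R)%E by rewrite lee_fin.
have f0 x : 0 <= f x by have /andP[] := fB x.
have fE b : f b = f (refl u b - z) by rewrite -fz /reflf reflK.
apply/funext => x; apply/eqP; rewrite eq_le; apply/andP; split.
  apply: tau_le => // a b abx.
  have [h0|] := ltP 0 (half_mean 0%:E (f a) (f b)); last first.
    by move=> /le_trans; apply.
  have [fa fb] := half_mean_gt0_imp al0 (f0 a) (f0 b) h0.
  rewrite half_mean_alpha_mean// (fE b).
  rewrite (fE b) in fb.
  have := cf _ _ _ fa fb (half01 R).
  rewrite (_ : 2^-1 *: a + (1 - 2^-1) *: (refl u b - z) = x - 2^-1 *: z)//.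
  by rewrite -abx /reflmid; apply/rowP => i; rewrite !mxE; field.
pose y := x - 2^-1 *: z.
have fb : f (refl u (x + 2^-1 *: z)) = f y.
  by rewrite (fE (refl u _)) reflK//; congr f; apply/rowP => i; rewrite !mxE; field.
have := tau_ge su al0 y (refl u (x + 2^-1 *: z)) fB.
rewrite fb half_meanxx// (_ : reflmid _ _ _ = x)//.
by rewrite /reflmid reflK//; apply/rowP => i; rewrite !mxE; field.
Qed.

Theorem proposition3p5 (R : realType) (n : nat) (alpha : \bar R)
    (f g : 'rV[R]_n -> R) (u : 'rV[R]_n)
    (halpha : (alpha <= 0)%E)
    (hf : Calpha alpha f) (hg : Calpha alpha g)
    (hu : sphere u) :
  (mean_width_defined alpha f ->
     mean_width_defined alpha (tau alpha u f) /\
     mean_width alpha (tau alpha u f) = mean_width alpha f) /\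
  ((forall x, f x <= g x) ->
     forall x, tau alpha u f x <= tau alpha u g x) /\
  (reflf u (tau alpha u f) = tau alpha u f) /\
  (tau alpha u (tau alpha u f) = tau alpha u f) /\
  (forall fH : 'rV[R]_n -> R, Calpha alpha fH -> reflf u fH = fH ->
     tau alpha u fH = fH) /\
  (forall x, orthc u x -> proj_fun u (tau alpha u f) x = proj_fun u f x) /\
  ((((- n%:R^-1)%:E <= alpha)%E ->
      (total_mass f <= total_mass (tau alpha u f))%E) /\
   (alpha = 0%E -> (0 < total_mass f)%E ->
      (total_mass (tau alpha u f) = total_mass f <->
       exists z : 'rV[R]_n, forall x, reflf u f x = f (x - z)))) /\
  (forall t : R, 0 < t ->
     [set x | t <= tau -oo%E u f x] = tau_set u [set x | t <= f x]).
Proof.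
have [f0 [_ cf] uf f_neq0 vf] := hf; have [g0 _ ug _ vg] := hg.
have [B fB'] := upper_semicontinuous_bounded uf vf.
have fB x : 0 <= f x <= B by rewrite f0 fB'.
have [C gC] := upper_semicontinuous_bounded ug vg.
split; last split; last split; last split; last split; last split; last split.
- case: alpha halpha hf hg cf => [r|//|_ _ _ _ _]; last first.
    by split; [exact: I|exact: mean_widthNy_tau].
  rewrite lee_fin le_eqVlt => /predU1P[->|r0] _ _ _ df.
    split; first by rewrite /mean_width_defined eqxx.
    exact: mean_width_tau0 fB f_neq0.
  exact (mean_width_tau_fin hu fB f_neq0 r0 df).
- by move=> fg; exact: le_tau gC fg.
- exact: reflf_tau fB.
(* Idempotence is the invariance of symmetric functions applied to the symmetral itself. *)
- apply: tau_invariant => //.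
  + by move=> x; exact: (tau_bounded hu halpha fB x).
  + exact: tau_mean_concave fB cf.
  + exact: reflf_tau fB.
- move=> h [h0 [_ ch] uh _ vh] hH.
  have [D hD] := upper_semicontinuous_bounded uh vh.
  by apply: (@tau_invariant _ _ _ _ hu halpha h D) => // x; rewrite h0 hD.
- by move=> x xu; exact: tau_proj fB cf x xu.
- split=> [_|].
    apply: le_total_mass_tau => //; exact: mean_concave_quasi_concave cf.
  move=> alpha0; subst alpha => J0; split=> [JE|[z fz]].
    apply: steiner_eq_translate => //.
    exact: tau_eq_steiner.
  rewrite (tau0_translate hu fB cf fz).
  exact: total_mass_translate.
by move=> t t0; exact: superlevel_tau_min.
Qed.
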